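(* Let $\lambda(z)\,|dz|$ be a regular conformal Riemannian metric on a domain $\Omega\subset\mathbb{C}$ with an isolated boundary point at $z=0$, and suppose that the curvature $\kappa:\Omega\to\mathbb{R}$ of $\lambda(z)\,|dz|$ has a Hölder continuous extension to $\Omega\cup\{0\}$ such that $\kappa(0)<0$. Then $\log\lambda$ has order $\alpha\in(-\infty,1]$ and (a) $\displaystyle\lim_{z\to0}\big(|z|\log(1/|z|)\big)\lambda(z)=\begin{cases}0&\text{if }\alpha<1,\\ 1/\sqrt{-\kappa(0)}&\text{if }\alpha=1;\end{cases}$ (b) $\displaystyle\lim_{z\to0}z\,\Gamma_\lambda(z)=-\alpha$; (c) $\displaystyle\lim_{z\to0}z^2\,S_\lambda(z)=\alpha(2-\alpha)/2$.
   Context: A conformal Riemannian metric $\lambda(z)\,|dz|$ on a domain $\Omega\subseteq\mathbb{C}$ is regular if its positive density $\lambda$ is of class $C^2$ in $\Omega$. Its (Gaussian) curvature is $\kappa_\lambda(z)=-\frac{(\Delta\log\lambda)(z)}{\lambda(z)^2}$, with $\Delta=\partial_x^2+\partial_y^2$, $z=x+iy$. For a real-valued function $u$ defined in a punctured neighborhood of $0$, with $M_u(r)=\sup_{|z|=r}u(z)$, the order of $u$ is $\lim_{r\searrow0}\frac{M_u(r)}{\log(1/r)}$ if this limit exists. With the Wirtinger derivative $\partial/\partial z=\tfrac12(\partial_x-i\partial_y)$, the connection (Pre-Schwarzian) and the Schwarzian of a regular conformal metric $\lambda(z)\,|dz|$ are $$\Gamma_\lambda(z)=2\,\frac{\partial\log\lambda(z)}{\partial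 z},\qquad S_\lambda(z)=\frac{\partial\Gamma_\lambda(z)}{\partial z}-\frac12\Gamma_\lambda(z)^2=2\left[\frac{\partial^2\log\lambda(z)}{\partial z^2}-\left(\frac{\partial\log\lambda(z)}{\partial z}\right)^2\right].$$ *)

(* Defs.v *)
(* Stdlib world: concrete real numbers, with Coquelicot's complex numbers,
   filters and derivatives. *)
From Stdlib Require Import Reals Lra.
From Coquelicot Require Import Coquelicot.
Open Scope R_scope.

Definition connected_set (A : C -> Prop) : Prop :=
  forall U V : C -> Prop, open U -> open V ->
    (forall z, A z -> U z \/ V z) ->
    (forall z, A z -> U z -> V z -> False) ->
    (forall z, A z -> U z) \/ (forall z, A z -> V z).

Definition planar_domain (Omega : C -> Prop) : Prop :=
  open Omega /\ connected_set Omega /\ (exists z, Omega z).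

(* closure minus interior *)
Definition boundary (A : C -> Prop) (z : C) : Prop :=
  ~ locally z (fun w => ~ A w) /\ ~ locally z A.

Definition isolated_boundary_point (A : C -> Prop) (p : C) : Prop :=
  boundary A p /\ locally' p (fun z => ~ boundary A z).

Definition ex_dx (f : C -> R) (z : C) : Prop :=
  ex_derive (fun t : R => f (t, Im z)) (Re z).
Definition ex_dy (f : C -> R) (z : C) : Prop :=
  ex_derive (fun t : R => f (Re z, t)) (Im z).

Definition dx (f : C -> R) (z : C) : R := Derive (fun t : R => f (t, Im z)) (Re z).
Definition dy (f : C -> R) (z : C) : R := Derive (fun t : R => f (Re z, t)) (Im z).

Fixpoint class_C (n : nat) (A : C -> Prop) (f : C -> R) : Prop :=
  (forall z, A z -> continuous f z) /\
  match n with
  | O => True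
  | S m => (forall z, A z -> ex_dx f z /\ ex_dy f z) /\
           class_C m A (dx f) /\ class_C m A (dy f)
  end.

Definition laplacian (f : C -> R) (z : C) : R := dx (dx f) z + dy (dy f) z.

Definition wirtinger (f : C -> C) (z : C) : C :=
  let fx : C := (dx (fun w => Re (f w)) z, dx (fun w => Im (f w)) z) in
  let fy : C := (dy (fun w => Re (f w)) z, dy (fun w => Im (f w)) z) in
  (RtoC (1 / 2) * (fx - Ci * fy))%C.

Definition regular_metric (Omega : C -> Prop) (lam : C -> R) : Prop :=
  (forall z, Omega z -> 0 < lam z) /\ class_C 2 Omega lam.

Definition curvature (lam : C -> R) (z : C) : R :=
  - (laplacian (fun w => ln (lam w)) z / (lam z) ^ 2).

Definition connection (lam : C -> R) (z : C) : C :=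
  (RtoC 2 * wirtinger (fun w => RtoC (ln (lam w))) z)%C.

Definition schwarzian (lam : C -> R) (z : C) : C :=
  (wirtinger (connection lam) z
   - RtoC (1 / 2) * (connection lam z * connection lam z))%C.

(* [z <> w] is needed because [Rpower 0 beta = 1]. *)
Definition holder_on (A : C -> Prop) (f : C -> R) : Prop :=
  exists beta K : R, 0 < beta <= 1 /\
    forall z w, A z -> A w -> z <> w ->
      Rabs (f z - f w) <= K * Rpower (Cmod (z - w)) beta.

(* The exponent and the constant may depend on the point: on an unbounded
   domain a global Hölder bound would restrict growth at infinity. *)
Definition locally_holder (A : C -> Prop) (f : C -> R) : Prop :=
  forall p, A p ->
    exists U : C -> Prop, locally p U /\ holder_on (fun z => A z /\ U z) f.

Definition circle_sup (u : C -> R) (r : R) : Rbar :=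
  Lub_Rbar (fun x => exists z : C, Cmod z = r /\ x = u z).

(* Finiteness of the suprema is required since [real] sends the infinite
   values to 0. *)
Definition has_order (u : C -> R) (alpha : R) : Prop :=
  at_right 0 (fun r => is_finite (circle_sup u r)) /\
  filterlim (fun r => real (circle_sup u r) / ln (1 / r))
            (at_right 0) (locally alpha).

(* Main.v *)
Require Import Defs.
From Stdlib Require Import Reals Lra Lia Psatz ClassicalEpsilon.
From Coquelicot Require Import Coquelicot.
Open Scope R_scope.

(** Write u = log lambda and k = - kappa, so that Delta u = k e^(2u) near the puncture with k
    positive and Hölder continuous. In the coordinates z = exp (- t + i phi) the function
    U = u - t solves the same equation Delta U = k e^(2U) on a half-cylinder t > T, and the
    theorem describes U as t tends to infinity, with alpha = 1 - gamma where - gamma is the limit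
    of the slope of the mean of U over the circle at height t.

    Ahlfors' lemma, by comparison with metrics of constant curvature on strips, gives
    e^U <= C / t ([cyl_upper]). Hence the right-hand side is O(1 / t^2), and U is negative far
    out. The mean a(t) of U over the circle is convex and negative, so its slope has a limit
    - gamma <= 0 and a(t) is bounded below by a linear function. Since U has a sign, all its Fourier
    coefficients in phi grow at most linearly as well. The coefficient of order n >= 1 solves an equation
    y'' = n^2 y + O(1 / t^2), whose solutions without exponential growth are O(1 / (n^2 t))
    ([no_growth_bound]). Summing these by means of Fejér's kernel ([value_minus_mean_le]) gives
    U = a + O(1 / t) ([oscillation]). The order of u is therefore 1 - gamma.

    If gamma > 0 then t e^U tends to 0 because a is at most - gamma t + O(1). If gamma = 0, then
    a'' is asymptotic to k(0) e^(2a); multiplying by a' and integrating from infinity shows that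
    the derivative of e^(- a) tends to the square root of k(0), hence e^(- a) / t does so too
    ([exp_ode_asymptotics]).

    For (b) and (c), the function v = u + alpha log |z| - c, with a suitable constant c, is small on
    the disk of radius |z0| / 2 about z0, and Delta v = k e^(2u) = O(|z0|^(-2) / log^2 |z0|).
    After scaling by |z0| the first derivatives of v at z0 are small, and then so are its
    trace-free second derivatives, because k e^(2u) is Hölder continuous with a small constant
    in that scale. Both interior estimates come from the first and the second Fourier modes of v on
    circles about z0 ([gradient_estimate], [hessian_estimate]): the quotient of the n-th mode by
    r^n satisfies a first-order differential inequality down to r = 0, where it is a derivative
    of v at z0 ([mode_quotient]). *)

(** * Calculus on the real line *)

Lemma is_derive_continuity_pt (f : R -> R) (x l : R) :
  is_derive f x l -> continuity_pt f x.
Proof.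
  intros H. apply continuity_pt_filterlim.
  apply (ex_derive_continuous f x). exists l; exact H.
Qed.

Lemma Rmin_bounds a b : Rmin a b <= a /\ Rmin a b <= b.
Proof. split; [apply Rmin_l | apply Rmin_r]. Qed.

Lemma Rmax_bounds a b : a <= Rmax a b /\ b <= Rmax a b.
Proof. split; [apply Rmax_l | apply Rmax_r]. Qed.

(** Comparison form of the mean value theorem: every integration of a
    differential inequality below goes through it. *)
Lemma increment_le (f g f' g' : R -> R) (a b : R) :
  a <= b ->
  (forall x, a <= x <= b -> is_derive f x (f' x)) ->
  (forall x, a <= x <= b -> is_derive g x (g' x)) ->
  (forall x, a <= x <= b -> f' x <= g' x) ->
  f b - f a <= g b - g a.
Proof.
  intros Hab Hf Hg Hle.
  assert (Hd : forall x, a <= x <= b ->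
            is_derive (fun t => g t - f t) x (g' x - f' x)).
  { intros x Hx. apply (is_derive_minus (V := R_NormedModule)); auto. }
  destruct (MVT_gen (fun t => g t - f t) a b (fun x => g' x - f' x)) as [c [Hc E]].
  - intros x. rewrite Rmin_left, Rmax_right by lra. intros Hx. apply Hd; lra.
  - intros x. rewrite Rmin_left, Rmax_right by lra. intros Hx.
    eapply is_derive_continuity_pt, Hd; lra.
  - rewrite Rmin_left, Rmax_right in Hc by lra.
    specialize (Hle c Hc).
    assert (0 <= (g' c - f' c) * (b - a)) by (apply Rmult_le_pos; lra). lra.
Qed.

Lemma is_derive_linear c x : is_derive (fun t => c * t) x c.
Proof. auto_derive; [exact I | ring]. Qed.

Lemma increment_bound (f f' : R -> R) (a b B : R) :
  a <= b ->
  (forall x, a <= x <= b -> is_derive f x (f' x)) ->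
  (forall x, a <= x <= b -> Rabs (f' x) <= B) ->
  Rabs (f b - f a) <= B * (b - a).
Proof.
  intros Hab Hf HB.
  apply Rabs_le. split.
  - assert (H := increment_le (fun t => (- B) * t) f (fun _ => - B) f' a b Hab
      (fun x _ => is_derive_linear _ x) Hf).
    assert ((- B) * b - (- B) * a <= f b - f a).
    { apply H. intros x Hx. specialize (HB x Hx). apply Rabs_le_between in HB. lra. }
    lra.
  - assert (H := increment_le f (fun t => B * t) f' (fun _ => B) a b Hab Hf
      (fun x _ => is_derive_linear _ x)).
    assert (f b - f a <= B * b - B * a).
    { apply H. intros x Hx. specialize (HB x Hx). apply Rabs_le_between in HB. lra. }
    lra.
Qed.

Lemma exp_le_compat x y : x <= y -> exp x <= exp y.
Proof. intros [H|H]; [left; apply exp_increasing, H | rewrite H; lra]. Qed.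

Lemma second_derivative_at_max (f f' : R -> R) (x l d : R) :
  0 < d ->
  (forall t, Rabs (t - x) < d -> is_derive f t (f' t)) ->
  is_derive f' x l ->
  (forall t, Rabs (t - x) < d -> f t <= f x) ->
  l <= 0.
Proof.
  intros Hd Hf Hf' Hmax.
  destruct (Rle_or_lt l 0) as [|Hl]; [assumption | exfalso].
  apply is_derive_Reals in Hf'.
  destruct (Hf' (l / 2)) as [e He]; [lra |].
  assert (He0 := cond_pos e).
  set (h := Rmin (d / 2) (e / 2)).
  assert (Hh : 0 < h /\ h < d /\ h < e).
  { unfold h. split; [apply Rmin_pos; lra |].
    destruct (Rmin_bounds (d / 2) (e / 2)) as [A B]. lra. }
  assert (Hq : forall s, s <> 0 -> Rabs s < e ->
             l / 2 < (f' (x + s) - f' x) / s).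
  { intros s Hs0 Hse. specialize (He s Hs0 Hse). apply Rabs_def2 in He. lra. }
  assert (Hlim : forall c, Rabs (c - x) < d -> derivable_pt_lim f c (f' c)).
  { intros c Hc. apply is_derive_Reals, Hf, Hc. }
  (* f' has the sign of l to one side of x, so f exceeds f x there *)
  destruct (Rle_or_lt 0 (f' x)) as [H0|H0].
  - destruct (MVT_cor2 f f' x (x + h)) as [c [E Hc]].
    + lra.
    + intros t Ht. apply Hlim. apply Rabs_def1; lra.
    + assert (Hm : f (x + h) <= f x) by (apply Hmax; apply Rabs_def1; lra).
      assert (Q := Hq (c - x) ltac:(lra) ltac:(apply Rabs_def1; lra)).
      replace (x + (c - x)) with c in Q by ring.
      assert (Q' : (f' c - f' x) / (c - x) * (c - x) = f' c - f' x) by (field; lra).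
      apply Rmult_lt_compat_r with (r := c - x) in Q; [|lra].
      assert (0 < l / 2 * (c - x)) by (apply Rmult_lt_0_compat; lra).
      assert (0 < f' c * (x + h - x)) by (apply Rmult_lt_0_compat; lra). lra.
  - destruct (MVT_cor2 f f' (x - h) x) as [c [E Hc]].
    + lra.
    + intros t Ht. apply Hlim. apply Rabs_def1; lra.
    + assert (Hm : f (x - h) <= f x) by (apply Hmax; apply Rabs_def1; lra).
      assert (Q := Hq (c - x) ltac:(lra) ltac:(apply Rabs_def1; lra)).
      replace (x + (c - x)) with c in Q by ring.
      assert (Q' : (f' c - f' x) / (c - x) * (x - c) = - (f' c - f' x)) by (field; lra).
      apply Rmult_lt_compat_r with (r := x - c) in Q; [|lra].
      assert (0 < l / 2 * (x - c)) by (apply Rmult_lt_0_compat; lra).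
      assert (f' c * (x - (x - h)) < 0) by nra. lra.
Qed.

(** At a positive interior maximum the second derivative would be both
    nonpositive and positive. *)
Lemma max_principle (y y' y'' : R -> R) (a b : R) :
  a <= b ->
  (forall t, a <= t <= b -> is_derive y t (y' t)) ->
  (forall t, a <= t <= b -> is_derive y' t (y'' t)) ->
  y a <= 0 -> y b <= 0 ->
  (forall t, a < t < b -> 0 < y t -> 0 < y'' t) ->
  forall t, a <= t <= b -> y t <= 0.
Proof.
  intros Hab Hy Hy' Ha Hb Hpos t Ht.
  destruct (continuity_ab_maj y a b Hab) as [M [HM HMab]].
  { intros c Hc. eapply is_derive_continuity_pt, Hy, Hc. }
  destruct (Rle_or_lt (y M) 0) as [H0|H0].
  { specialize (HM t Ht). lra. }
  exfalso.
  assert (HMi : a < M < b).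
  { split.
    - destruct (Req_dec M a) as [E|E]; [rewrite E in H0; lra | lra].
    - destruct (Req_dec M b) as [E|E]; [rewrite E in H0; lra | lra]. }
  destruct (Rmin_bounds (M - a) (b - M)) as [Hm Hm'].
  assert (y'' M <= 0).
  { apply (second_derivative_at_max y y' M _ (Rmin (M - a) (b - M))).
    - apply Rmin_pos; lra.
    - intros s Hs. apply Rabs_def2 in Hs. apply Hy. lra.
    - apply Hy'. lra.
    - intros s Hs. apply Rabs_def2 in Hs. apply HM. lra. }
  specialize (Hpos M HMi H0). lra.
Qed.

(** * Continuous functions on rectangles *)

Definition bounded_rect (a b c d : R) (f : R -> R -> R) : Prop :=
  exists B, 0 < B /\ forall x y, a <= x <= b -> c <= y <= d -> Rabs (f x y) <= B.

Lemma continuity_2d_bounded (f : R -> R -> R) (a b c d : R) :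
  (forall x y, a <= x <= b -> c <= y <= d -> continuity_2d_pt f x y) ->
  bounded_rect a b c d f.
Proof.
  intros Hc.
  (* around (u,v) the radius is also at most 1 / (|f u v| + 1), so that a uniform
     lower bound for the radius is an upper bound for |f| *)
  assert (Hex : forall p : R * R, exists e : posreal,
    a <= fst p <= b -> c <= snd p <= d ->
    e <= / (Rabs (f (fst p) (snd p)) + 1) /\
    forall x y, Rabs (x - fst p) < e -> Rabs (y - snd p) < e ->
      Rabs (f x y - f (fst p) (snd p)) < 1).
  { intros [u v]; simpl.
    destruct (classic (a <= u <= b /\ c <= v <= d)) as [[Hu Hv]|Hn].
    - destruct (Hc u v Hu Hv (mkposreal 1 Rlt_0_1)) as [e He]. simpl in He.
      assert (Hp : 0 < / (Rabs (f u v) + 1)).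
      { apply Rinv_0_lt_compat. assert (A := Rabs_pos (f u v)). lra. }
      exists (mkposreal _ (Rmin_pos _ _ (cond_pos e) Hp)). intros _ _. simpl. split.
      + apply Rmin_r.
      + intros x y Hx Hy. apply He; (eapply Rlt_le_trans; [eassumption | apply Rmin_l]).
    - exists (mkposreal 1 Rlt_0_1). intros; exfalso; apply Hn; auto. }
  set (g := fun p => proj1_sig (constructive_indefinite_description _ (Hex p))).
  assert (Hg := fun p => proj2_sig (constructive_indefinite_description _ (Hex p))).
  change (forall p, a <= fst p <= b -> c <= snd p <= d ->
    g p <= / (Rabs (f (fst p) (snd p)) + 1) /\
    forall x y, Rabs (x - fst p) < g p -> Rabs (y - snd p) < g p ->
      Rabs (f x y - f (fst p) (snd p)) < 1) in Hg.
  destruct (compactness_value_2d a b c d (fun u v => g (u, v))) as [e He].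
  exists (/ e). split; [apply Rinv_0_lt_compat, cond_pos|].
  intros x y Hx Hy. apply Rnot_lt_le. intros Hlt.
  apply (He x y Hx Hy). intros [u [v [Hu [Hv [H1 [H2 H3]]]]]].
  destruct (Hg (u, v) Hu Hv) as [G1 G2]. simpl in G1, G2.
  specialize (G2 x y H1 H2).
  assert (Hf : Rabs (f x y) < Rabs (f u v) + 1).
  { replace (f x y) with (f u v + (f x y - f u v)) by ring.
    eapply Rle_lt_trans; [apply Rabs_triang | lra]. }
  assert (He0 := cond_pos e).
  assert (Rabs (f u v) + 1 <= / e).
  { rewrite <- (Rinv_inv (Rabs (f u v) + 1)). apply Rinv_le_contravar; lra. }
  lra.
Qed.

(** Otherwise 1 / (sup f - f) would be continuous and unbounded. *)
Lemma continuity_2d_max (f : R -> R -> R) (a b c d : R) :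
  a <= b -> c <= d ->
  (forall x y, a <= x <= b -> c <= y <= d -> continuity_2d_pt f x y) ->
  exists x0 y0, a <= x0 <= b /\ c <= y0 <= d /\
    forall x y, a <= x <= b -> c <= y <= d -> f x y <= f x0 y0.
Proof.
  intros Hab Hcd Hc.
  destruct (continuity_2d_bounded f a b c d Hc) as [B [HB0 HB]].
  destruct (completeness (fun z => exists x y, a <= x <= b /\ c <= y <= d /\ z = f x y))
    as [S [HS1 HS2]].
  - exists B. intros z [x [y [Hx [Hy ->]]]]. specialize (HB x y Hx Hy).
    apply Rabs_le_between in HB. lra.
  - exists (f a c), a, c. repeat split; lra.
  - assert (Hub : forall x y, a <= x <= b -> c <= y <= d -> f x y <= S).
    { intros x y Hx Hy. apply HS1. exists x, y; auto. }
    apply NNPP. intros Hno.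
    assert (Hlt : forall x y, a <= x <= b -> c <= y <= d -> 0 < S - f x y).
    { intros x y Hx Hy. destruct (Req_dec (f x y) S) as [E|E].
      - exfalso. apply Hno. exists x, y. split; [assumption|]. split; [assumption|].
        intros x' y' Hx' Hy'. rewrite E. auto.
      - specialize (Hub x y Hx Hy). lra. }
    destruct (continuity_2d_bounded (fun x y => / (S - f x y)) a b c d) as [B' [HB'0 HB']].
    { intros x y Hx Hy. apply continuity_2d_pt_inv.
      - apply continuity_2d_pt_minus; [apply continuity_2d_pt_const | auto].
      - specialize (Hlt x y Hx Hy). lra. }
    assert (Hcon : S <= S - / B').
    { apply HS2. intros z [x [y [Hx [Hy ->]]]].
      specialize (HB' x y Hx Hy). specialize (Hlt x y Hx Hy).
      assert (Hi := Rinv_0_lt_compat _ Hlt).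
      rewrite Rabs_right in HB' by lra.
      assert (/ B' <= S - f x y).
      { rewrite <- (Rinv_inv (S - f x y)). apply Rinv_le_contravar; lra. }
      lra. }
    assert (0 < / B') by (apply Rinv_0_lt_compat; lra). lra.
Qed.

Ltac derive_as P :=
  match type of P with is_derive _ _ ?v => match goal with |- is_derive _ _ ?w =>
    replace w with v; [exact P |] end end.

(** * Differentiable functions in the plane and their circle averages *)

Definition open_2d (D : R -> R -> Prop) : Prop :=
  forall x y, D x y -> locally_2d D x y.

Definition C1_on (D : R -> R -> Prop) (f fx fy : R -> R -> R) : Prop :=
  forall x y, D x y ->
    is_derive (fun s => f s y) x (fx x y) /\ is_derive (fun s => f x s) y (fy x y) /\
    continuity_2d_pt fx x y /\ continuity_2d_pt fy x y.

Definition C2_on (D : R -> R -> Prop) (f fx fy fxx fxy fyx fyy : R -> R -> R) : Prop :=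
  C1_on D f fx fy /\ C1_on D fx fxx fxy /\ C1_on D fy fyx fyy.

Lemma C1_differentiable D f fx fy x y :
  open_2d D -> C1_on D f fx fy -> D x y ->
  differentiable_pt_lim f x y (fx x y) (fy x y).
Proof.
  intros HD Hf Hxy. apply filterdiff_differentiable_pt_lim.
  apply (is_derive_filterdiff f x y fx (fy x y)).
  - apply locally_2d_locally with (P := fun a b => is_derive (fun z => f z b) a (fx a b)).
    destruct (HD x y Hxy) as [d Hd]. exists d. intros a b Ha Hb.
    apply (Hf a b (Hd a b Ha Hb)).
  - apply (Hf x y Hxy).
  - apply continuity_2d_pt_filterlim, (Hf x y Hxy).
Qed.

Lemma C1_continuity D f fx fy x y :
  open_2d D -> C1_on D f fx fy -> D x y -> continuity_2d_pt f x y.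
Proof.
  intros HD Hf Hxy. apply differentiable_continuity_pt.
  exists (fx x y), (fy x y). eapply C1_differentiable; eauto.
Qed.

Lemma C1_chain D f fx fy (X Y : R -> R) (t X' Y' : R) :
  open_2d D -> C1_on D f fx fy -> D (X t) (Y t) ->
  is_derive X t X' -> is_derive Y t Y' ->
  is_derive (fun s => f (X s) (Y s)) t (fx (X t) (Y t) * X' + fy (X t) (Y t) * Y').
Proof.
  intros HD Hf Hxy HX HY. apply is_derive_Reals, derivable_pt_lim_comp_2d.
  - eapply C1_differentiable; eauto.
  - apply is_derive_Reals, HX.
  - apply is_derive_Reals, HY.
Qed.

Lemma continuity_2d_pt_comp2 (f X Y : R -> R -> R) (a b : R) :
  continuity_2d_pt f (X a b) (Y a b) ->
  continuity_2d_pt X a b -> continuity_2d_pt Y a b ->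
  continuity_2d_pt (fun u v => f (X u v) (Y u v)) a b.
Proof.
  intros Hf HX HY eps. destruct (Hf eps) as [d Hd].
  destruct (HX d) as [d1 H1]. destruct (HY d) as [d2 H2].
  exists (mkposreal _ (Rmin_stable_in_posreal d1 d2)). simpl. intros u v Hu Hv.
  apply Hd.
  - apply H1; (eapply Rlt_le_trans; [eassumption | apply Rmin_l]).
  - apply H2; (eapply Rlt_le_trans; [eassumption | apply Rmin_r]).
Qed.

Lemma continuity_2d_slice (f : R -> R -> R) (x y : R) :
  continuity_2d_pt f x y -> continuous (fun v => f x v) y.
Proof.
  intros H. apply continuity_pt_filterlim. intros e He.
  destruct (H (mkposreal e He)) as [d Hd]. exists d. split; [apply cond_pos|].
  intros z [_ Hz]. apply Hd; [rewrite Rminus_diag, Rabs_R0; apply cond_pos | exact Hz].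
Qed.

Lemma continuity_2d_snd (g : R -> R) (x y : R) :
  continuity_pt g y -> continuity_2d_pt (fun _ v => g v) x y.
Proof.
  intros H. apply (continuity_1d_2d_pt_comp g (fun _ v => v)); [exact H | apply continuity_2d_pt_id2].
Qed.

Lemma weight_continuity (n : nat) (th phi : R) :
  continuity_pt (fun s => cos (INR n * (s - th))) phi.
Proof.
  apply (is_derive_continuity_pt _ _ (- INR n * sin (INR n * (phi - th)))).
  auto_derive; [exact I | unfold Rminus; ring].
Qed.

Ltac cont2 := repeat first
  [ assumption
  | apply continuity_2d_pt_id1 | apply continuity_2d_pt_id2 | apply continuity_2d_pt_const
  | apply continuity_2d_pt_plus | apply continuity_2d_pt_minus | apply continuity_2d_pt_opp
  | apply continuity_2d_pt_mult
  | apply continuity_2d_snd; first [apply continuity_cos | apply continuity_sin | apply weight_continuity] ].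

(** The radius r is any real number, so that circle averages are differentiable at r = 0. *)
Definition pol (f : R -> R -> R) (p q r phi : R) : R :=
  f (p + r * cos phi) (q + r * sin phi).

Definition pol_r (fx fy : R -> R -> R) (p q r phi : R) : R :=
  pol fx p q r phi * cos phi + pol fy p q r phi * sin phi.

Definition pol_phi (fx fy : R -> R -> R) (p q r phi : R) : R :=
  pol fx p q r phi * (- r * sin phi) + pol fy p q r phi * (r * cos phi).

Definition on_circles (D : R -> R -> Prop) (p q r1 r2 : R) : Prop :=
  forall r phi, r1 < r < r2 -> D (p + r * cos phi) (q + r * sin phi).

Lemma pol_continuity f p q r phi :
  continuity_2d_pt f (p + r * cos phi) (q + r * sin phi) ->
  continuity_2d_pt (pol f p q) r phi.
Proof.
  intros H. unfold pol.
  apply (continuity_2d_pt_comp2 f (fun r phi => p + r * cos phi) (fun r phi => q + r * sin phi)).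
  - exact H.
  - cont2.
  - cont2.
Qed.

Lemma pol_r_continuity fx fy p q r phi :
  continuity_2d_pt fx (p + r * cos phi) (q + r * sin phi) ->
  continuity_2d_pt fy (p + r * cos phi) (q + r * sin phi) ->
  continuity_2d_pt (pol_r fx fy p q) r phi.
Proof.
  intros Hx Hy. assert (Px := pol_continuity _ _ _ _ _ Hx). assert (Py := pol_continuity _ _ _ _ _ Hy).
  unfold pol_r. cont2.
Qed.

Lemma is_derive_pol_r D f fx fy p q r phi :
  open_2d D -> C1_on D f fx fy -> D (p + r * cos phi) (q + r * sin phi) ->
  is_derive (fun s => pol f p q s phi) r (pol_r fx fy p q r phi).
Proof.
  intros HD Hf Hd. unfold pol_r, pol.
  apply (C1_chain D f fx fy (fun s => p + s * cos phi) (fun s => q + s * sin phi)); auto;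
    auto_derive; auto; ring.
Qed.

Lemma is_derive_pol_phi D f fx fy p q r phi :
  open_2d D -> C1_on D f fx fy -> D (p + r * cos phi) (q + r * sin phi) ->
  is_derive (fun s => pol f p q r s) phi (pol_phi fx fy p q r phi).
Proof.
  intros HD Hf Hd. unfold pol_phi, pol.
  apply (C1_chain D f fx fy (fun s => p + r * cos s) (fun s => q + r * sin s)); auto;
    auto_derive; auto; ring.
Qed.

Lemma pol_periodic f p q r : pol f p q r (2 * PI) = pol f p q r 0.
Proof. unfold pol. rewrite cos_2PI, sin_2PI, cos_0, sin_0. reflexivity. Qed.

Definition pol_rr (fxx fxy fyx fyy : R -> R -> R) (p q r phi : R) : R :=
  pol_r fxx fxy p q r phi * cos phi + pol_r fyx fyy p q r phi * sin phi.

Definition pol_pp (fx fy fxx fxy fyx fyy : R -> R -> R) (p q r phi : R) : R :=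
  (pol_phi fxx fxy p q r phi * (- r * sin phi) + pol fx p q r phi * (- r * cos phi)) +
  (pol_phi fyx fyy p q r phi * (r * cos phi) + pol fy p q r phi * (- r * sin phi)).

Lemma is_derive_pol_r_r D f fx fy fxx fxy fyx fyy p q r phi :
  open_2d D -> C2_on D f fx fy fxx fxy fyx fyy -> D (p + r * cos phi) (q + r * sin phi) ->
  is_derive (fun s => pol_r fx fy p q s phi) r (pol_rr fxx fxy fyx fyy p q r phi).
Proof.
  intros HD [_ [Hx Hy]] Hd.
  assert (A := is_derive_pol_r D fx fxx fxy p q r phi HD Hx Hd).
  assert (B := is_derive_pol_r D fy fyx fyy p q r phi HD Hy Hd).
  unfold pol_r at 1, pol_rr.
  apply (is_derive_plus (V := R_NormedModule) (fun s => pol fx p q s phi * cos phi)).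
  - apply (is_derive_ext (fun s => cos phi * pol fx p q s phi)); [intros; apply Rmult_comm|].
    rewrite (Rmult_comm _ (cos phi)). apply is_derive_scal, A.
  - apply (is_derive_ext (fun s => sin phi * pol fy p q s phi)); [intros; apply Rmult_comm|].
    rewrite (Rmult_comm _ (sin phi)). apply is_derive_scal, B.
Qed.

Lemma is_derive_pol_phi_phi D f fx fy fxx fxy fyx fyy p q r phi :
  open_2d D -> C2_on D f fx fy fxx fxy fyx fyy -> D (p + r * cos phi) (q + r * sin phi) ->
  is_derive (fun s => pol_phi fx fy p q r s) phi (pol_pp fx fy fxx fxy fyx fyy p q r phi).
Proof.
  intros HD [_ [Hx Hy]] Hd.
  assert (A := is_derive_pol_phi D fx fxx fxy p q r phi HD Hx Hd).
  assert (B := is_derive_pol_phi D fy fyx fyy p q r phi HD Hy Hd).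
  unfold pol_phi at 1, pol_pp.
  apply (is_derive_plus (V := R_NormedModule) (fun s => pol fx p q r s * (- r * sin s))).
  - apply (is_derive_mult (K := R_AbsRing) (fun s => pol fx p q r s) (fun s => - r * sin s));
      [exact A | auto_derive; auto; ring | apply Rmult_comm].
  - apply (is_derive_mult (K := R_AbsRing) (fun s => pol fy p q r s) (fun s => r * cos s));
      [exact B | auto_derive; auto; ring | apply Rmult_comm].
Qed.

Lemma pol_laplacian fx fy fxx fxy fyx fyy p q r phi :
  r ^ 2 * pol_rr fxx fxy fyx fyy p q r phi + r * pol_r fx fy p q r phi +
    pol_pp fx fy fxx fxy fyx fyy p q r phi =
  r ^ 2 * pol (fun x y => fxx x y + fyy x y) p q r phi.
Proof.
  unfold pol_rr, pol_pp, pol_r, pol_phi, pol.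
  set (x := p + r * cos phi). set (y := q + r * sin phi).
  assert (E := sin2_cos2 phi). unfold Rsqr in E.
  replace (r ^ 2 * (fxx x y + fyy x y))
    with (r ^ 2 * (fxx x y + fyy x y) * (sin phi * sin phi + cos phi * cos phi))
    by (rewrite E; ring).
  ring.
Qed.

(** The unnormalized Fourier coefficient of order n. The phase th selects a real combination of
    the cosine and sine coefficients, so that one family of weights serves for all. *)
Definition mode (f : R -> R -> R) (p q : R) (n : nat) (th r : R) : R :=
  RInt (fun phi => pol f p q r phi * cos (INR n * (phi - th))) 0 (2 * PI).

Definition mode_r (fx fy : R -> R -> R) (p q : R) (n : nat) (th r : R) : R :=
  RInt (fun phi => pol_r fx fy p q r phi * cos (INR n * (phi - th))) 0 (2 * PI).

Definition mode_rr (fxx fxy fyx fyy : R -> R -> R) (p q : R) (n : nat) (th r : R) : R :=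
  RInt (fun phi => pol_rr fxx fxy fyx fyy p q r phi * cos (INR n * (phi - th))) 0 (2 * PI).

Lemma two_PI_pos : 0 < 2 * PI.
Proof. assert (H := PI_RGT_0). lra. Qed.

Lemma ex_RInt_slice (g : R -> R -> R) (r a b : R) :
  (forall phi, continuity_2d_pt g r phi) -> ex_RInt (g r) a b.
Proof.
  intros H. apply (ex_RInt_continuous (V := R_CompleteNormedModule)). intros z _. apply (continuity_2d_slice g), H.
Qed.

Lemma is_derive_RInt_slices (g g' : R -> R -> R) (r1 r2 a b r : R) :
  r1 < r < r2 ->
  (forall s phi, r1 < s < r2 -> is_derive (fun z => g z phi) s (g' s phi)) ->
  (forall s phi, r1 < s < r2 -> continuity_2d_pt g s phi) ->
  (forall s phi, r1 < s < r2 -> continuity_2d_pt g' s phi) ->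
  is_derive (fun s => RInt (g s) a b) r (RInt (g' r) a b).
Proof.
  intros Hr Hd Hg Hg'.
  assert (Hloc : locally r (fun s => r1 < s < r2)).
  { apply (open_and (fun s => r1 < s) (fun s => s < r2)).
    - apply open_gt. - apply open_lt. - exact Hr. }
  assert (HE : RInt (g' r) a b = RInt (fun t => Derive (fun u => g u t) r) a b).
  { apply RInt_ext. intros t _. symmetry. apply is_derive_unique, Hd, Hr. }
  rewrite HE. apply (is_derive_RInt_param g a b r).
  - eapply filter_imp; [|exact Hloc]. intros s Hs t _. eexists. apply Hd, Hs.
  - intros t _. apply (continuity_2d_pt_ext_loc g').
    + destruct Hloc as [d Hd']. exists d. intros u v Hu _. symmetry.
      apply is_derive_unique, Hd, (Hd' u), Hu.
    + apply Hg', Hr.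
  - eapply filter_imp; [|exact Hloc]. intros s Hs. apply ex_RInt_slice. intros phi. apply Hg, Hs.
Qed.

Section Modes.
Context (D : R -> R -> Prop) (f fx fy fxx fxy fyx fyy : R -> R -> R).
Context (HD : open_2d D) (Hf : C2_on D f fx fy fxx fxy fyx fyy).
Context (p q r1 r2 : R) (Hcirc : on_circles D p q r1 r2) (n : nat) (th : R).

Let w := fun phi => cos (INR n * (phi - th)).

Lemma C2_cont1 x y : D x y ->
  continuity_2d_pt f x y /\ continuity_2d_pt fx x y /\ continuity_2d_pt fy x y.
Proof.
  destruct Hf as [H0 _]. intros Hd. split; [|split].
  - eapply C1_continuity; eauto.
  - apply (H0 x y Hd).
  - apply (H0 x y Hd).
Qed.

Lemma C2_cont2 x y : D x y ->
  continuity_2d_pt fxx x y /\ continuity_2d_pt fxy x y /\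
  continuity_2d_pt fyx x y /\ continuity_2d_pt fyy x y.
Proof.
  destruct Hf as [_ [H1 H2]]. intros Hd.
  destruct (H1 x y Hd) as [_ [_ [A B]]]. destruct (H2 x y Hd) as [_ [_ [A' B']]]. auto.
Qed.

Lemma pol_rr_continuity r phi : r1 < r < r2 ->
  continuity_2d_pt (pol_rr fxx fxy fyx fyy p q) r phi.
Proof.
  intros Hr. destruct (C2_cont2 _ _ (Hcirc r phi Hr)) as [A [B [C' E]]].
  assert (Px := pol_r_continuity _ _ _ _ _ _ A B). assert (Py := pol_r_continuity _ _ _ _ _ _ C' E).
  unfold pol_rr. cont2.
Qed.

Lemma is_derive_mode r : r1 < r < r2 ->
  is_derive (mode f p q n th) r (mode_r fx fy p q n th r).
Proof.
  intros Hr. unfold mode, mode_r.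
  apply (is_derive_RInt_slices (fun r phi => pol f p q r phi * w phi)
    (fun r phi => pol_r fx fy p q r phi * w phi) r1 r2); [exact Hr | | |];
    intros s phi Hs; assert (Hd := Hcirc s phi Hs).
  - apply (is_derive_ext (fun z => w phi * pol f p q z phi)); [intros; apply Rmult_comm|].
    rewrite (Rmult_comm _ (w phi)). apply is_derive_scal.
    apply (is_derive_pol_r D f); [exact HD | apply Hf | exact Hd].
  - apply continuity_2d_pt_mult; [apply pol_continuity, C2_cont1, Hd |].
    apply continuity_2d_snd, weight_continuity.
  - apply continuity_2d_pt_mult; [apply pol_r_continuity; apply C2_cont1, Hd |].
    apply continuity_2d_snd, weight_continuity.
Qed.

Lemma is_derive_mode_r r : r1 < r < r2 ->
  is_derive (mode_r fx fy p q n th) r (mode_rr fxx fxy fyx fyy p q n th r).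
Proof.
  intros Hr. unfold mode_r, mode_rr.
  apply (is_derive_RInt_slices (fun r phi => pol_r fx fy p q r phi * w phi)
    (fun r phi => pol_rr fxx fxy fyx fyy p q r phi * w phi) r1 r2); [exact Hr | | |];
    intros s phi Hs; assert (Hd := Hcirc s phi Hs).
  - apply (is_derive_ext (fun z => w phi * pol_r fx fy p q z phi)); [intros; apply Rmult_comm|].
    rewrite (Rmult_comm _ (w phi)). apply is_derive_scal.
    apply (is_derive_pol_r_r D f fx fy); [exact HD | apply Hf | exact Hd].
  - apply continuity_2d_pt_mult; [apply pol_r_continuity; apply C2_cont1, Hd |].
    apply continuity_2d_snd, weight_continuity.
  - apply continuity_2d_pt_mult; [apply pol_rr_continuity, Hs |].
    apply continuity_2d_snd, weight_continuity.
Qed.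

(** Integrate the polar form of the Laplacian over the circle and move the angular
    derivatives to the weight, on which they act as - n^2: a partial differential equation
    for f becomes one ordinary differential equation for each mode. *)
Lemma mode_equation r : r1 < r < r2 ->
  r ^ 2 * mode_rr fxx fxy fyx fyy p q n th r + r * mode_r fx fy p q n th r
    - INR n ^ 2 * mode f p q n th r =
  r ^ 2 * mode (fun x y => fxx x y + fyy x y) p q n th r.
Proof.
  intros Hr. assert (Hd := fun phi => Hcirc r phi Hr).
  assert (Hw := fun phi => weight_continuity n th phi).
  set (w' := fun phi => - INR n * sin (INR n * (phi - th))).
  set (b := fun phi => pol_phi fx fy p q r phi * w phi - pol f p q r phi * w' phi).
  set (b' := fun phi => pol_pp fx fy fxx fxy fyx fyy p q r phi * w phi
                        + INR n ^ 2 * (pol f p q r phi * w phi)).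
  assert (XR : forall g : R -> R -> R, (forall phi, continuity_2d_pt g r phi) -> forall c,
     is_RInt (fun phi => c * (g r phi * w phi)) 0 (2 * PI) (c * RInt (fun phi => g r phi * w phi) 0 (2 * PI))).
  { intros g Hg c. apply (is_RInt_scal (V := R_NormedModule) (fun phi => g r phi * w phi)).
    apply (RInt_correct (V := R_CompleteNormedModule)).
    apply (ex_RInt_slice (fun s phi => g s phi * w phi)). intros phi.
    apply continuity_2d_pt_mult; [apply Hg | apply continuity_2d_snd, Hw]. }
  assert (Cf := XR (pol f p q) (fun phi => pol_continuity _ _ _ _ _ (proj1 (C2_cont1 _ _ (Hd phi)))) (INR n ^ 2)).
  assert (Cr := XR (pol_r fx fy p q) (fun phi => pol_r_continuity _ _ _ _ _ _
     (proj1 (proj2 (C2_cont1 _ _ (Hd phi)))) (proj2 (proj2 (C2_cont1 _ _ (Hd phi))))) (- r)).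
  assert (Crr := XR (pol_rr fxx fxy fyx fyy p q) (fun phi => pol_rr_continuity r phi Hr) (- r ^ 2)).
  assert (Clap : is_RInt (fun phi => r ^ 2 * (pol (fun x y => fxx x y + fyy x y) p q r phi * w phi))
     0 (2 * PI) (r ^ 2 * mode (fun x y => fxx x y + fyy x y) p q n th r)).
  { apply (XR (pol (fun x y => fxx x y + fyy x y) p q)). intros phi. apply pol_continuity.
    destruct (C2_cont2 _ _ (Hd phi)) as [A [_ [_ B]]]. cont2. }
  assert (Hsum := is_RInt_plus (V := R_NormedModule) _ _ _ _ _ _ Clap
    (is_RInt_plus (V := R_NormedModule) _ _ _ _ _ _ Crr
      (is_RInt_plus (V := R_NormedModule) _ _ _ _ _ _ Cr Cf))).
  assert (Eb : forall phi, b' phi =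
     r ^ 2 * (pol (fun x y => fxx x y + fyy x y) p q r phi * w phi)
     + ((- r ^ 2) * (pol_rr fxx fxy fyx fyy p q r phi * w phi)
     + ((- r) * (pol_r fx fy p q r phi * w phi)
     + INR n ^ 2 * (pol f p q r phi * w phi)))).
  { intros phi. unfold b'.
    assert (E := pol_laplacian fx fy fxx fxy fyx fyy p q r phi).
    replace (pol_pp fx fy fxx fxy fyx fyy p q r phi) with
      (r ^ 2 * pol (fun x y => fxx x y + fyy x y) p q r phi
       - r ^ 2 * pol_rr fxx fxy fyx fyy p q r phi - r * pol_r fx fy p q r phi) by lra.
    ring. }
  assert (Hint : is_RInt b' 0 (2 * PI) (minus (b (2 * PI)) (b 0))).
  { apply (is_RInt_derive (V := R_CompleteNormedModule)).
    - intros phi _. unfold b, b'.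
      assert (A := is_derive_pol_phi_phi D f fx fy fxx fxy fyx fyy p q r phi HD Hf (Hd phi)).
      assert (B := is_derive_pol_phi D f fx fy p q r phi HD (proj1 Hf) (Hd phi)).
      assert (W : is_derive w phi (w' phi)) by (unfold w, w'; auto_derive; [exact I | unfold Rminus; ring]).
      assert (W' : is_derive w' phi (- INR n ^ 2 * w phi))
        by (unfold w, w'; auto_derive; [exact I | unfold Rminus; ring]).
      assert (P1 := is_derive_mult (fun s => pol_phi fx fy p q r s) w phi _ _ A W Rmult_comm).
      assert (P2 := is_derive_mult (fun s => pol f p q r s) w' phi _ _ B W' Rmult_comm).
      assert (P := is_derive_minus _ _ _ _ _ P1 P2).
      derive_as P.
      unfold minus, plus, opp, mult; simpl. unfold w, w'. ring.
    - intros phi _. apply (continuous_ext (fun phi => _ + _) b' phi (fun t => eq_sym (Eb t))).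
      assert (K1 := C2_cont1 _ _ (Hd phi)). assert (K2 := C2_cont2 _ _ (Hd phi)).
      destruct K1 as [K1 [K3 K4]]. destruct K2 as [K2 [_ [_ K5]]].
      apply (continuity_2d_slice (fun s phi => s ^ 2 * (pol (fun x y => fxx x y + fyy x y) p q s phi * w phi)
         + ((- s ^ 2) * (pol_rr fxx fxy fyx fyy p q s phi * w phi)
         + ((- s) * (pol_r fx fy p q s phi * w phi) + INR n ^ 2 * (pol f p q s phi * w phi))))).
      assert (Q1 := pol_continuity _ _ _ _ _ K1). assert (Q2 := pol_rr_continuity r phi Hr).
      assert (Q3 := pol_r_continuity _ _ _ _ _ _ K3 K4).
      assert (Q4 : continuity_2d_pt (pol (fun x y => fxx x y + fyy x y) p q) r phi)
        by (apply pol_continuity; cont2).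
      unfold w. simpl pow. cont2. }
  assert (Hb : minus (b (2 * PI)) (b 0) = 0).
  { unfold minus, plus, opp; simpl. unfold b, w, w'.
    assert (Epp : pol_phi fx fy p q r (2 * PI) = pol_phi fx fy p q r 0).
    { unfold pol_phi. rewrite !pol_periodic, cos_2PI, sin_2PI, cos_0, sin_0. reflexivity. }
    rewrite Epp, pol_periodic.
    replace (INR n * (2 * PI - th)) with (INR n * (0 - th) + 2 * INR n * PI) by ring.
    rewrite cos_period, sin_period. ring. }
  rewrite Hb in Hint.
  assert (E0 := is_RInt_unique (V := R_CompleteNormedModule) _ _ _ _ Hint).
  assert (E1 := is_RInt_unique (V := R_CompleteNormedModule) _ _ _ _
    (is_RInt_ext (V := R_NormedModule) _ b' _ _ _ (fun phi _ => eq_sym (Eb phi)) Hsum)).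
  assert (T : forall A B E F : R,
    r ^ 2 * A + (- r ^ 2 * B + (- r * E + INR n ^ 2 * F)) = 0 ->
    r ^ 2 * B + r * E - INR n ^ 2 * F = r ^ 2 * A) by (intros; lra).
  exact (T _ _ _ _ (eq_trans (eq_sym E1) E0)).
Qed.

End Modes.

(* Integrals have type R only up to unfolding, which ring does not do. *)
Ltac eq_R := match goal with |- @eq _ ?a ?b => change (@eq R a b) end.
Ltac ring_R := eq_R; ring.

(** * Integrals over a period *)

Lemma ex_RInt_cont (g : R -> R) (a b : R) : (forall x, continuous g x) -> ex_RInt g a b.
Proof. intros H. apply (ex_RInt_continuous (V := R_CompleteNormedModule)). auto. Qed.

Lemma RInt_plus_cont (g h : R -> R) (a b : R) :
  (forall x, continuous g x) -> (forall x, continuous h x) ->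
  RInt (fun x => g x + h x) a b = RInt g a b + RInt h a b.
Proof.
  intros Hg Hh. apply (RInt_plus (V := R_CompleteNormedModule)); apply ex_RInt_cont; assumption.
Qed.

Lemma RInt_scal_cont (g : R -> R) (c a b : R) :
  (forall x, continuous g x) -> RInt (fun x => c * g x) a b = c * RInt g a b.
Proof. intros Hg. apply (RInt_scal (V := R_CompleteNormedModule)), ex_RInt_cont, Hg. Qed.

Lemma continuous_plus_R (g h : R -> R) x :
  continuous g x -> continuous h x -> continuous (fun x => g x + h x) x.
Proof. intros. apply (continuous_plus (V := R_NormedModule)); assumption. Qed.

Lemma continuous_mult_R (g h : R -> R) x :
  continuous g x -> continuous h x -> continuous (fun x => g x * h x) x.
Proof. intros. apply (continuous_mult (K := R_AbsRing)); assumption. Qed.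

Lemma continuous_scal_R c (g : R -> R) x :
  continuous g x -> continuous (fun x => c * g x) x.
Proof. intros. apply continuous_mult_R; [apply continuous_const | assumption]. Qed.

Lemma continuous_weight (n : nat) th x : continuous (fun s => cos (INR n * (s - th))) x.
Proof. apply continuity_pt_filterlim, weight_continuity. Qed.

Lemma RInt_bound (g h : R -> R) :
  (forall x, continuous g x) -> (forall x, continuous h x) ->
  (forall x, 0 <= x <= 2 * PI -> Rabs (g x) <= h x) ->
  Rabs (RInt g 0 (2 * PI)) <= RInt h 0 (2 * PI).
Proof.
  intros Hg Hh Hle. assert (P := two_PI_pos).
  eapply Rle_trans.
  - apply abs_RInt_le; [lra | apply ex_RInt_cont, Hg].
  - apply RInt_le; [lra | | apply ex_RInt_cont, Hh |].
    + apply ex_RInt_cont. intros x. apply (continuous_comp g Rabs); [apply Hg|].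
      apply continuity_pt_filterlim, Rcontinuity_abs.
    + intros x Hx. apply Hle. lra.
Qed.

Lemma RInt_period_const c : RInt (fun _ => c) 0 (2 * PI) = 2 * PI * c.
Proof. rewrite RInt_const. unfold scal; simpl; unfold mult; simpl. ring_R. Qed.

Lemma RInt_weight (n : nat) th : (0 < n)%nat ->
  RInt (fun s => cos (INR n * (s - th))) 0 (2 * PI) = 0.
Proof.
  intros Hn. assert (Hn' : 0 < INR n) by (apply lt_0_INR; exact Hn).
  apply is_RInt_unique.
  replace 0 with (minus (/ INR n * sin (INR n * (2 * PI - th))) (/ INR n * sin (INR n * (0 - th)))) at 2.
  - apply (is_RInt_derive (V := R_CompleteNormedModule) (fun s => / INR n * sin (INR n * (s - th)))).
    + intros x _. auto_derive; [exact I |]. unfold Rminus. field. lra.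
    + intros x _. apply continuous_weight.
  - unfold minus, plus, opp; simpl.
    replace (INR n * (2 * PI - th)) with (INR n * (0 - th) + 2 * INR n * PI) by ring.
    rewrite sin_period. ring.
Qed.

(** * Recovering a function from its Fourier coefficients *)

Fixpoint dirichlet (n : nat) (s : R) : R :=
  match n with
  | O => 1
  | S m => dirichlet m s + 2 * cos (INR (S m) * s)
  end.

(** The sum of the first n Dirichlet kernels, which is n times the Fejér kernel. *)
Fixpoint fejer (n : nat) (s : R) : R :=
  match n with
  | O => 0
  | S m => fejer m s + dirichlet m s
  end.

Lemma dirichlet_closed n s :
  (1 - cos s) * dirichlet n s = cos (INR n * s) - cos (INR (S n) * s).
Proof.
  induction n as [|n IH].
  - simpl. rewrite Rmult_0_l, cos_0, !Rmult_1_l. ring.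
  - change (dirichlet (S n) s) with (dirichlet n s + 2 * cos (INR (S n) * s)).
    rewrite Rmult_plus_distr_l, IH.
    replace (INR n * s) with (INR (S n) * s - s) by (rewrite S_INR; ring).
    replace (INR (S (S n)) * s) with (INR (S n) * s + s) by (rewrite (S_INR (S n)); ring).
    rewrite cos_minus, cos_plus. ring.
Qed.

Lemma fejer_closed n s : (1 - cos s) * fejer n s = 1 - cos (INR n * s).
Proof.
  induction n as [|n IH].
  - simpl. rewrite Rmult_0_l, cos_0. ring.
  - change (fejer (S n) s) with (fejer n s + dirichlet n s).
    rewrite Rmult_plus_distr_l, IH, dirichlet_closed. ring.
Qed.

Lemma fejer_nonneg n s : 0 <= fejer n s.
Proof.
  destruct (Rle_lt_or_eq_dec _ _ (proj2 (COS_bound s))) as [H|H].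
  - assert (E := fejer_closed n s). assert (B := COS_bound (INR n * s)).
    apply Rmult_le_reg_l with (1 - cos s); [lra|]. rewrite E. lra.
  - assert (Hs : sin s = 0).
    { assert (E := sin2_cos2 s). unfold Rsqr in E. rewrite H in E. nra. }
    assert (Hc : forall k, cos (INR k * s) = 1 /\ sin (INR k * s) = 0).
    { induction k as [|k [IHc IHs]].
      - simpl. rewrite Rmult_0_l, cos_0, sin_0. auto.
      - rewrite S_INR, Rmult_plus_distr_r, Rmult_1_l, cos_plus, sin_plus, IHc, IHs, H, Hs.
        split; ring. }
    assert (Hd : forall k, 0 <= dirichlet k s).
    { induction k as [|k IH]; [simpl; lra|].
      change (dirichlet (S k) s) with (dirichlet k s + 2 * cos (INR (S k) * s)).
      rewrite (proj1 (Hc (S k))). lra. }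
    induction n as [|n IH]; [simpl; lra|].
    change (fejer (S n) s) with (fejer n s + dirichlet n s). specialize (Hd n). lra.
Qed.

Lemma continuous_dirichlet n th x : continuous (fun s => dirichlet n (s - th)) x.
Proof.
  induction n as [|n IH].
  - apply continuous_const.
  - change (continuous (fun s => dirichlet n (s - th) + 2 * cos (INR (S n) * (s - th))) x).
    apply continuous_plus_R; [exact IH | apply continuous_scal_R, continuous_weight].
Qed.

Lemma continuous_fejer n th x : continuous (fun s => fejer n (s - th)) x.
Proof.
  induction n as [|n IH].
  - apply continuous_const.
  - change (continuous (fun s => fejer n (s - th) + dirichlet n (s - th)) x).
    apply continuous_plus_R; [exact IH | apply continuous_dirichlet].
Qed.

(* The goals are matched syntactically: unification would unfold the trigonometric kernels. *)
Ltac cont1 := repeat lazymatch goal with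
  | |- continuous (fun _ => ?c) _ => apply continuous_const
  | |- continuous (fun s => dirichlet _ (s - _)) _ => apply continuous_dirichlet
  | |- continuous (fun s => fejer _ (s - _)) _ => apply continuous_fejer
  | |- continuous (fun s => cos (INR _ * (s - _))) _ => apply continuous_weight
  | |- continuous (fun s => _ + _) _ => apply continuous_plus_R
  | |- continuous (fun s => _ * _) _ => apply continuous_mult_R
  | H : forall x, continuous ?g x |- continuous ?g _ => apply H
  | H : forall x, continuous ?g x |- continuous (fun s => ?g s) _ => apply H
  end.

Lemma RInt_dirichlet n th : RInt (fun s => dirichlet n (s - th)) 0 (2 * PI) = 2 * PI.
Proof.
  induction n as [|n IH].
  - simpl. rewrite RInt_period_const. ring.
  - change (RInt (fun s => dirichlet n (s - th) + 2 * cos (INR (S n) * (s - th))) 0 (2 * PI) = 2 * PI).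
    rewrite RInt_plus_cont, RInt_scal_cont, RInt_weight, IH; try lia;
      try (intros x; cont1).
    ring_R.
Qed.

Lemma RInt_fejer n th : RInt (fun s => fejer n (s - th)) 0 (2 * PI) = 2 * PI * INR n.
Proof.
  induction n as [|n IH].
  - simpl. rewrite RInt_period_const. ring.
  - change (RInt (fun s => fejer n (s - th) + dirichlet n (s - th)) 0 (2 * PI) = 2 * PI * INR (S n)).
    rewrite RInt_plus_cont, RInt_dirichlet, IH, S_INR; [ring_R | |]; intros x;
      [apply continuous_fejer | apply continuous_dirichlet].
Qed.

Section Fejer.
Context (g : R -> R) (th y S0 : R) (c : nat -> R).
Context (Hg : forall x, continuous g x).
Context (Hc : forall n, (0 < n)%nat ->
  Rabs (RInt (fun s => g s * cos (INR n * (s - th))) 0 (2 * PI)) <= c n).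
Context (Hsum : forall n, sum_f_R0 (fun k => c (S k)) n <= S0).

Lemma coef_bound_nonneg : 0 <= S0.
Proof.
  eapply Rle_trans; [|apply (Hsum 0)]. simpl.
  eapply Rle_trans; [apply Rabs_pos | apply (Hc 1); lia].
Qed.

Lemma dirichlet_mean n :
  Rabs (RInt (fun s => g s * dirichlet n (s - th)) 0 (2 * PI) - RInt g 0 (2 * PI)) <= 2 * S0.
Proof.
  assert (H : forall m, Rabs (RInt (fun s => g s * dirichlet (S m) (s - th)) 0 (2 * PI)
     - RInt g 0 (2 * PI)) <= 2 * sum_f_R0 (fun k => c (S k)) m).
  { assert (E : forall m, RInt (fun s => g s * dirichlet (S m) (s - th)) 0 (2 * PI) =
        RInt (fun s => g s * dirichlet m (s - th)) 0 (2 * PI) +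
        2 * RInt (fun s => g s * cos (INR (S m) * (s - th))) 0 (2 * PI)).
    { intros m. rewrite <- RInt_scal_cont, <- RInt_plus_cont.
      - apply RInt_ext. intros s _.
        change (dirichlet (S m) (s - th)) with (dirichlet m (s - th) + 2 * cos (INR (S m) * (s - th))).
        ring_R.
      - intros x. cont1.
      - intros x. cont1.
      - intros x. cont1. }
    assert (E0 : RInt (fun s => g s * dirichlet 0 (s - th)) 0 (2 * PI) = RInt g 0 (2 * PI)).
    { apply RInt_ext. intros s _. simpl. ring_R. }
    induction m as [|m IH].
    - rewrite E, E0. simpl sum_f_R0. specialize (Hc 1%nat ltac:(lia)).
      match goal with |- Rabs (?a + ?b - ?a) <= _ => replace (a + b - a) with b by ring end.
      rewrite Rabs_mult, (Rabs_right 2) by lra. lra.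
    - rewrite E. specialize (Hc (S (S m)) ltac:(lia)).
      match goal with |- Rabs (?a + ?b - ?e) <= _ => replace (a + b - e) with ((a - e) + b) by ring end.
      eapply Rle_trans; [apply Rabs_triang|].
      rewrite Rabs_mult, (Rabs_right 2) by lra. simpl sum_f_R0. lra. }
  destruct n as [|n].
  - assert (E0 : RInt (fun s => g s * dirichlet 0 (s - th)) 0 (2 * PI) = RInt g 0 (2 * PI)).
    { apply RInt_ext. intros s _. simpl. ring_R. }
    rewrite E0, Rminus_diag, Rabs_R0. assert (A := coef_bound_nonneg). lra.
  - eapply Rle_trans; [apply H|]. specialize (Hsum n). lra.
Qed.

Lemma fejer_mean n :
  Rabs (RInt (fun s => g s * fejer n (s - th)) 0 (2 * PI) - INR n * RInt g 0 (2 * PI))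
    <= 2 * S0 * INR n.
Proof.
  induction n as [|n IH].
  - simpl. rewrite (RInt_ext _ (fun _ => 0)) by (intros; ring_R).
    rewrite RInt_period_const, Rmult_0_l, !Rmult_0_r, Rminus_diag, Rabs_R0. lra.
  - assert (E : RInt (fun s => g s * fejer (S n) (s - th)) 0 (2 * PI) =
        RInt (fun s => g s * fejer n (s - th)) 0 (2 * PI) +
        RInt (fun s => g s * dirichlet n (s - th)) 0 (2 * PI)).
    { rewrite <- RInt_plus_cont.
      - apply RInt_ext. intros s _. simpl. ring_R.
      - intros x. cont1.
      - intros x. cont1. }
    rewrite E, S_INR. assert (D := dirichlet_mean n).
    match goal with |- Rabs (?a + ?b - (INR n + 1) * ?e) <= _ =>
      replace (a + b - (INR n + 1) * e) with ((a - INR n * e) + (b - e)) by ring end.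
    eapply Rle_trans; [apply Rabs_triang|]. lra.
Qed.

(** The value y at the angle th is compared with the Fejér means: these converge to y, because
    the kernel is positive with mass 2 pi N while (1 - cos) times the kernel stays bounded, and
    they differ from the mean of g by at most the sum of the other coefficients. *)
Lemma value_minus_mean_le
  (Hy : forall eps, 0 < eps -> exists K, 0 <= K /\ forall s, 0 <= s <= 2 * PI ->
     Rabs (g s - y) <= eps + K * (1 - cos (s - th))) :
  Rabs (2 * PI * y - RInt g 0 (2 * PI)) <= 2 * S0.
Proof.
  assert (P := two_PI_pos).
  apply le_epsilon. intros e He.
  destruct (Hy (e / (4 * PI)) ltac:(apply Rdiv_lt_0_compat; lra)) as [K [HK0 HK]].
  destruct (INR_unbounded (8 * PI * K / e)) as [N HN].
  assert (HNpos : 0 <= 8 * PI * K / e).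
  { apply Rmult_le_pos; [apply Rmult_le_pos; lra | left; apply Rinv_0_lt_compat, He]. }
  assert (HN0 : 0 < INR N) by lra.
  assert (Hmean := fejer_mean N).
  assert (Hy2 : Rabs (RInt (fun s => (g s - y) * fejer N (s - th)) 0 (2 * PI)) <=
     e / 2 * INR N + 4 * PI * K).
  { eapply Rle_trans.
    - apply (RInt_bound _ (fun s => e / (4 * PI) * fejer N (s - th) + 2 * K)).
      + intros x. apply continuous_mult_R; [|cont1].
        apply (continuous_minus (V := R_NormedModule) g (fun _ => y)); cont1.
      + intros x. cont1.
      + intros s Hs. rewrite Rabs_mult, (Rabs_right (fejer _ _)) by (apply Rle_ge, fejer_nonneg).
        eapply Rle_trans.
        * apply Rmult_le_compat_r; [apply fejer_nonneg | apply HK, Hs].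
        * rewrite Rmult_plus_distr_r, Rmult_assoc, fejer_closed.
          assert (B := COS_bound (INR N * (s - th))).
          assert (K * (1 - cos (INR N * (s - th))) <= K * 2) by (apply Rmult_le_compat_l; lra).
          lra.
    - rewrite RInt_plus_cont, RInt_scal_cont, RInt_fejer, RInt_period_const.
      + right. field. lra.
      + intros x. cont1.
      + intros x. cont1.
      + intros x. cont1. }
  assert (E : RInt (fun s => (g s - y) * fejer N (s - th)) 0 (2 * PI) =
     RInt (fun s => g s * fejer N (s - th)) 0 (2 * PI) - 2 * PI * y * INR N).
  { rewrite (RInt_ext _ (fun s => g s * fejer N (s - th) + (- y) * fejer N (s - th)))
      by (intros; simpl; ring_R).
    rewrite RInt_plus_cont, RInt_scal_cont, RInt_fejer.
    - ring_R.
    - intros x. cont1.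
    - intros x. cont1.
    - intros x. cont1. }
  rewrite E in Hy2.
  set (J := RInt (fun s => g s * fejer N (s - th)) 0 (2 * PI)) in *.
  set (G := RInt g 0 (2 * PI)) in *.
  apply Rmult_le_reg_l with (INR N); [exact HN0|].
  rewrite <- (Rabs_right (INR N)) at 1 by lra. rewrite <- Rabs_mult.
  replace (INR N * (2 * PI * y - G)) with ((J - INR N * G) - (J - 2 * PI * y * INR N)) by ring.
  eapply Rle_trans; [apply Rabs_triang|]. rewrite Rabs_Ropp.
  assert (8 * PI * K < INR N * e).
  { apply Rmult_lt_compat_r with (r := e) in HN; [|exact He].
    unfold Rdiv in HN. rewrite Rmult_assoc, Rinv_l, Rmult_1_r in HN by lra. lra. }
  lra.
Qed.

End Fejer.

(** * Ordinary differential inequalities on a half-line *)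

Notation eventually_inf := (Rbar_locally p_infty).

Lemma eventually_ge (T : R) : eventually_inf (fun t => T <= t).
Proof. exists T. intros t Ht. lra. Qed.

Lemma is_lim_eventually (f : R -> R) (l eps : R) : is_lim f p_infty l -> 0 < eps ->
  eventually_inf (fun t => Rabs (f t - l) < eps).
Proof.
  intros H He. apply is_lim_spec in H. exact (H (mkposreal eps He)).
Qed.

Lemma is_lim_mult' (f g : R -> R) (x : Rbar) (lf lg : R) :
  is_lim f x lf -> is_lim g x lg -> is_lim (fun y => f y * g y) x (lf * lg).
Proof. intros Hf Hg. exact (is_lim_mult f g x lf lg Hf Hg I). Qed.

Lemma is_lim_intro (f : R -> R) (l : R) :
  (forall eps, 0 < eps -> eventually_inf (fun t => Rabs (f t - l) < eps)) -> is_lim f p_infty l.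
Proof. intros H. apply is_lim_spec. intros eps. apply H, cond_pos. Qed.

Lemma monotone_limit (g : R -> R) (T B : R) :
  (forall s t, T <= s <= t -> g s <= g t) -> (forall t, T <= t -> g t <= B) ->
  exists l, l <= B /\ is_lim g p_infty l /\ forall t, T <= t -> g t <= l.
Proof.
  intros Hmono HB.
  destruct (completeness (fun z => exists t, T <= t /\ z = g t)) as [l [Hub Hlub]].
  - exists B. intros z [t [Ht ->]]. auto.
  - exists (g T), T. split; [lra | reflexivity].
  - exists l. split; [|split].
    + apply Hlub. intros z [t [Ht ->]]. auto.
    + apply is_lim_intro. intros eps He.
      destruct (classic (exists t, T <= t /\ l - eps < g t)) as [[s [Hs1 Hs2]]|Hno].
      * exists s. intros t Ht. assert (g s <= g t) by (apply Hmono; lra).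
        assert (g t <= l) by (apply Hub; exists t; split; [lra | reflexivity]).
        apply Rabs_def1; lra.
      * exfalso. assert (l <= l - eps); [|lra].
        apply Hlub. intros z [t [Ht ->]]. apply Rnot_lt_le. intros Hlt.
        apply Hno. exists t. auto.
    + intros t Ht. apply Hub. exists t. auto.
Qed.

Lemma exp_dominates (c e : R) : 0 <= c -> 0 < e -> eventually_inf (fun t => c * t <= e * exp t).
Proof.
  intros Hc He. exists (Rmax 1 (4 * c / e)). intros t Ht.
  destruct (Rmax_bounds 1 (4 * c / e)) as [H1 H2].
  assert (Hh : 1 + t / 2 <= exp (t / 2)).
  { destruct (Req_dec t 0) as [->|Hn].
    - lra.
    - left. apply exp_ineq1. lra. }
  assert (Hsq : exp t = exp (t / 2) * exp (t / 2)) by (rewrite <- exp_plus; f_equal; field).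
  assert (H3 : 4 * c < t * e).
  { apply Rmult_lt_compat_r with (r := e) in Ht; [|exact He].
    assert (4 * c / e * e = 4 * c) by (field; lra).
    assert (4 * c / e * e <= Rmax 1 (4 * c / e) * e) by (apply Rmult_le_compat_r; lra). lra. }
  assert ((t / 2) * (t / 2) <= exp t).
  { rewrite Hsq. apply Rmult_le_compat; lra. }
  assert (c * t <= e * (t / 2 * (t / 2))) by nra.
  assert (e * (t / 2 * (t / 2)) <= e * exp t) by (apply Rmult_le_compat_l; lra). lra.
Qed.

Lemma exp_neg_le (x : R) : 0 < x -> exp (- x) <= 4 / x ^ 2.
Proof.
  intros Hx.
  assert (H : x / 2 <= exp (x / 2)).
  { left. eapply Rlt_trans; [|apply exp_ineq1; lra]. lra. }
  assert (E : exp x = exp (x / 2) * exp (x / 2)) by (rewrite <- exp_plus; f_equal; field).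
  assert (Hp : (x / 2) * (x / 2) <= exp x) by (rewrite E; apply Rmult_le_compat; lra).
  rewrite exp_Ropp. replace (4 / x ^ 2) with (/ ((x / 2) * (x / 2))) by (field; lra).
  apply Rinv_le_contravar; [apply Rmult_lt_0_compat; lra | exact Hp].
Qed.

(** A solution of y'' = n^2 y + h that grows at most linearly has no e^(nt) component, which
    the small multiple of e^(nt) in the comparison function excludes; the rest of the
    comparison function absorbs the forcing term and the initial value. *)
Lemma no_growth_upper (y y' h : R -> R) (n T C C2 : R) :
  1 <= n -> 2 <= T -> 0 < C -> 0 <= C2 ->
  (forall t, T <= t -> is_derive y t (y' t)) ->
  (forall t, T <= t -> is_derive y' t (n ^ 2 * y t + h t)) ->
  (forall t, T <= t -> Rabs (h t) <= C / t ^ 2) ->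
  (forall t, T <= t -> y t <= C2 * t) ->
  forall t, T <= t -> y t <= 2 * C / (n ^ 2 * t) + C2 * T * exp (- (n * (t - T))).
Proof.
  intros Hn HT HC HC2 Hy Hy' Hh Hlin t Ht.
  apply le_epsilon. intros eps Heps.
  set (e := eps * exp (- (n * t))).
  assert (He : 0 < e) by (apply Rmult_lt_0_compat; [exact Heps | apply exp_pos]).
  destruct (exp_dominates C2 e HC2 He) as [M HM].
  set (b := Rmax (t + 1) (M + 1)).
  assert (Hb1 : t < b) by (unfold b; assert (A := Rmax_l (t + 1) (M + 1)); lra).
  assert (Hb2 : M < b) by (unfold b; assert (A := Rmax_r (t + 1) (M + 1)); lra).
  specialize (HM b Hb2).
  set (B := fun s => 2 * C / (n ^ 2 * s) + C2 * T * exp (- (n * (s - T))) + e * exp (n * s)).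
  set (B' := fun s => - (2 * C / (n ^ 2 * s ^ 2)) - n * (C2 * T * exp (- (n * (s - T))))
                      + n * (e * exp (n * s))).
  set (B'' := fun s => 4 * C / (n ^ 2 * s ^ 3) + n ^ 2 * (C2 * T * exp (- (n * (s - T))))
                      + n ^ 2 * (e * exp (n * s))).
  assert (HB : forall s, T <= s -> is_derive B s (B' s)).
  { intros s Hs. unfold B, B'. auto_derive.
    - apply Rgt_not_eq. simpl. assert (0 < n * n) by nra. nra.
    - unfold Rminus. field. lra. }
  assert (HB' : forall s, T <= s -> is_derive B' s (B'' s)).
  { intros s Hs. unfold B', B''. auto_derive.
    - assert (0 < n * n) by nra. assert (0 < s * s) by nra. apply Rgt_not_eq. nra.
    - unfold Rminus. field. lra. }
  assert (HBpos : forall s, T <= s -> 0 <= B s).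
  { intros s Hs. unfold B. assert (E1 := exp_pos (- (n * (s - T)))). assert (E2 := exp_pos (n * s)).
    assert (0 < n ^ 2 * s) by nra.
    assert (0 <= 2 * C / (n ^ 2 * s)) by (apply Rdiv_le_0_compat; lra).
    assert (0 <= C2 * T * exp (- (n * (s - T)))) by (apply Rmult_le_pos; [nra | lra]).
    assert (0 <= e * exp (n * s)) by (apply Rmult_le_pos; lra). lra. }
  assert (Hmain : y t - B t <= 0).
  { apply (max_principle (fun s => y s - B s) (fun s => y' s - B' s)
       (fun s => (n ^ 2 * y s + h s) - B'' s) T b).
    - lra.
    - intros s Hs. apply (is_derive_minus (V := R_NormedModule)); [apply Hy | apply HB]; lra.
    - intros s Hs. apply (is_derive_minus (V := R_NormedModule)); [apply Hy' | apply HB']; lra.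
    - assert (y T <= C2 * T) by (apply Hlin; lra). unfold B.
      replace (- (n * (T - T))) with 0 by ring. rewrite exp_0.
      assert (0 < n ^ 2 * T) by nra.
      assert (0 <= 2 * C / (n ^ 2 * T)) by (apply Rdiv_le_0_compat; lra).
      assert (0 <= e * exp (n * T)) by (apply Rmult_le_pos; [lra | left; apply exp_pos]). lra.
    - assert (y b <= C2 * b) by (apply Hlin; lra). unfold B.
      assert (exp b <= exp (n * b)).
      { destruct (Req_dec n 1) as [->|Hn1]; [rewrite Rmult_1_l; lra|].
        left. apply exp_increasing. nra. }
      assert (e * exp b <= e * exp (n * b)) by (apply Rmult_le_compat_l; lra).
      assert (0 < n ^ 2 * b) by nra.
      assert (0 <= 2 * C / (n ^ 2 * b)) by (apply Rdiv_le_0_compat; lra).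
      assert (0 <= C2 * T * exp (- (n * (b - T)))) by (apply Rmult_le_pos; [nra | left; apply exp_pos]).
      lra.
    - intros s Hs Hpos.
      assert (Hhs : - (C / s ^ 2) <= h s).
      { specialize (Hh s ltac:(lra)). apply Rabs_le_between in Hh. lra. }
      assert (Hs0 : 0 < s) by lra.
      assert (E : (n ^ 2 * y s + h s) - B'' s =
         n ^ 2 * (y s - B s) + (h s + C / s ^ 2) +
         C * ((2 * n ^ 2 * s ^ 2 - n ^ 2 * s - 4) / (n ^ 2 * s ^ 3))).
      { unfold B, B''. field. lra. }
      rewrite E.
      assert (0 < n ^ 2) by nra.
      assert (0 < n ^ 2 * (y s - B s)) by (apply Rmult_lt_0_compat; lra).
      assert (0 < s ^ 3) by (apply pow_lt; lra).
      assert (0 <= 2 * n ^ 2 * s ^ 2 - n ^ 2 * s - 4).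
      { assert (1 <= n ^ 2) by nra. nra. }
      assert (0 <= (2 * n ^ 2 * s ^ 2 - n ^ 2 * s - 4) / (n ^ 2 * s ^ 3)).
      { apply Rdiv_le_0_compat; [assumption | apply Rmult_lt_0_compat; assumption]. }
      assert (0 <= C * ((2 * n ^ 2 * s ^ 2 - n ^ 2 * s - 4) / (n ^ 2 * s ^ 3)))
        by (apply Rmult_le_pos; lra).
      lra.
    - lra. }
  unfold B, e in Hmain.
  assert (Ee : eps * exp (- (n * t)) * exp (n * t) = eps).
  { rewrite Rmult_assoc, <- exp_plus. replace (- (n * t) + n * t) with 0 by ring.
    rewrite exp_0. ring. }
  lra.
Qed.

Lemma no_growth_bound (y y' h : R -> R) (n T C C2 : R) :
  1 <= n -> 2 <= T -> 0 < C -> 0 <= C2 ->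
  (forall t, T <= t -> is_derive y t (y' t)) ->
  (forall t, T <= t -> is_derive y' t (n ^ 2 * y t + h t)) ->
  (forall t, T <= t -> Rabs (h t) <= C / t ^ 2) ->
  (forall t, T <= t -> Rabs (y t) <= C2 * t) ->
  forall t, 2 * T <= t -> Rabs (y t) <= (2 * C + 16 * (C2 * T)) / t * / n ^ 2.
Proof.
  intros Hn HT HC HC2 Hy Hy' Hh Hlin t Ht.
  assert (Hneg : - y t <= 2 * C / (n ^ 2 * t) + C2 * T * exp (- (n * (t - T)))).
  { apply (no_growth_upper (fun s => - y s) (fun s => - y' s) (fun s => - h s)); auto.
    - intros s Hs. apply (is_derive_opp (V := R_NormedModule)), Hy, Hs.
    - intros s Hs. replace (n ^ 2 * - y s + - h s) with (- (n ^ 2 * y s + h s)) by ring.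
      apply (is_derive_opp (V := R_NormedModule)), Hy', Hs.
    - intros s Hs. rewrite Rabs_Ropp. auto.
    - intros s Hs. specialize (Hlin s Hs). apply Rabs_le_between in Hlin. lra.
    - lra. }
  assert (Hpos : y t <= 2 * C / (n ^ 2 * t) + C2 * T * exp (- (n * (t - T)))).
  { apply (no_growth_upper y y' h); auto.
    - intros s Hs. specialize (Hlin s Hs). apply Rabs_le_between in Hlin. lra.
    - lra. }
  assert (Hn2 : 0 < n ^ 2) by nra.
  assert (Hx : 0 < n * (t - T)) by (apply Rmult_lt_0_compat; lra).
  assert (Hexp : exp (- (n * (t - T))) <= 16 / t * / n ^ 2).
  { eapply Rle_trans; [apply exp_neg_le, Hx|].
    replace (16 / t * / n ^ 2) with (4 / (n ^ 2 * (t / 4))) by (field; lra).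
    apply Rmult_le_compat_l; [lra|]. apply Rinv_le_contravar.
    - apply Rmult_lt_0_compat; lra.
    - rewrite Rpow_mult_distr. apply Rmult_le_compat_l; [lra|]. nra. }
  assert (Hm : C2 * T * exp (- (n * (t - T))) <= C2 * T * (16 / t * / n ^ 2)).
  { apply Rmult_le_compat_l; [nra | exact Hexp]. }
  replace ((2 * C + 16 * (C2 * T)) / t * / n ^ 2)
    with (2 * C / (n ^ 2 * t) + C2 * T * (16 / t * / n ^ 2)) by (field; lra).
  apply Rabs_le. lra.
Qed.

Lemma sum_inv_sq_le n : sum_f_R0 (fun k => / INR (S k) ^ 2) n <= 2.
Proof.
  assert (H : sum_f_R0 (fun k => / INR (S k) ^ 2) n <= 2 - / INR (S n)).
  { induction n as [|n IH].
    - simpl. lra.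
    - rewrite tech5. rewrite (S_INR (S n)).
      set (x := INR (S n)) in *.
      assert (Hx : 1 <= x) by (unfold x; rewrite S_INR; assert (A := pos_INR n); lra).
      assert (E : / x - / (x + 1) - / (x + 1) ^ 2 = / (x * (x + 1) ^ 2)) by (field; lra).
      assert (0 < / (x * (x + 1) ^ 2)).
      { apply Rinv_0_lt_compat. apply Rmult_lt_0_compat; [lra | apply pow_lt; lra]. }
      lra. }
  assert (0 < / INR (S n)) by (apply Rinv_0_lt_compat, lt_0_INR; lia). lra.
Qed.

Lemma quotient_limit_inf (f f' : R -> R) (T l : R) :
  (forall t, T <= t -> is_derive f t (f' t)) -> is_lim f' p_infty l ->
  is_lim (fun t => f t / t) p_infty l.
Proof.
  intros Df Hl. apply is_lim_intro. intros eps Heps.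
  assert (He2 : 0 < eps / 2) by lra.
  destruct (filter_and _ _ (is_lim_eventually _ _ (eps / 2) Hl He2) (eventually_ge T))
    as [T1 HT1].
  set (t1 := T1 + 1).
  set (K := Rabs (f t1 - l * t1) + eps / 2 * Rabs t1).
  exists (Rmax (Rmax 1 t1) (2 * K / eps)). intros t Ht.
  destruct (Rmax_bounds (Rmax 1 t1) (2 * K / eps)) as [A1 A2].
  destruct (Rmax_bounds 1 t1) as [A3 A4].
  assert (HK : 2 * K < t * eps).
  { assert (H1 : 2 * K / eps < t) by lra.
    apply Rmult_lt_compat_r with (r := eps) in H1; [|exact Heps].
    unfold Rdiv in H1. rewrite Rmult_assoc, Rinv_l in H1; lra. }
  assert (B : Rabs ((f t - l * t) - (f t1 - l * t1)) <= eps / 2 * (t - t1)).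
  { apply (increment_bound (fun t => f t - l * t) (fun t => f' t - l)); [lra | |].
    - intros x Hx. apply (is_derive_minus (V := R_NormedModule)).
      + apply Df, HT1. unfold t1 in Hx. lra.
      + auto_derive; [exact I | ring].
    - intros x Hx. left. apply HT1. unfold t1 in Hx. lra. }
  replace (f t / t - l) with ((f t - l * t) * / t) by (field; lra).
  rewrite Rabs_mult, (Rabs_right (/ t)) by (left; apply Rinv_0_lt_compat; lra).
  apply Rmult_lt_reg_r with t; [lra|]. rewrite Rmult_assoc, Rinv_l, Rmult_1_r by lra.
  replace (f t - l * t) with ((f t - l * t - (f t1 - l * t1)) + (f t1 - l * t1)) by ring.
  eapply Rle_lt_trans; [apply Rabs_triang|].
  assert (Hr := Rle_abs (- t1)). rewrite Rabs_Ropp in Hr. unfold K in HK.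
  assert (eps / 2 * - t1 <= eps / 2 * Rabs t1) by (apply Rmult_le_compat_l; lra). lra.
Qed.

Lemma nonincreasing_to_0 (f f' : R -> R) (t : R) :
  (forall x, t <= x -> is_derive f x (f' x)) -> (forall x, t <= x -> f' x <= 0) ->
  is_lim f p_infty 0 -> 0 <= f t.
Proof.
  intros Df Hf' Hl. apply Rnot_lt_le. intros Hlt.
  destruct (is_lim_eventually _ _ _ Hl (Ropp_0_gt_lt_contravar _ Hlt)) as [T2 HT2].
  set (b := Rmax t (T2 + 1)).
  destruct (Rmax_bounds t (T2 + 1)) as [B1 B2]. fold b in B1, B2.
  specialize (HT2 b ltac:(lra)). apply Rabs_def2 in HT2.
  assert (I := increment_le f (fun _ => 0) f' (fun _ => 0) t b B1
     (fun x Hx => Df x (proj1 Hx)) (fun x _ => is_derive_const 0 x)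
     (fun x Hx => Hf' x (proj1 Hx))). lra.
Qed.

(** Multiplying a'' ~ s^2 e^(2a) by a' and integrating from infinity, where a' and e^a vanish,
    gives a'^2 ~ s^2 e^(2a). As a' <= 0, the derivative of e^(-a) tends to s. *)
Lemma exp_ode_asymptotics (a a' a'' : R -> R) (T s : R) :
  0 < s ->
  (forall t, T <= t -> is_derive a t (a' t)) ->
  (forall t, T <= t -> is_derive a' t (a'' t)) ->
  (forall t, T <= t -> a' t <= 0) ->
  is_lim a' p_infty 0 ->
  is_lim (fun t => exp (a t)) p_infty 0 ->
  is_lim (fun t => a'' t * exp (- (2 * a t))) p_infty (s ^ 2) ->
  is_lim (fun t => t * exp (a t)) p_infty (/ s).
Proof.
  intros Hs Ha Ha' Hneg Hlim Hexp Hk.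
  assert (Eexp : forall t, exp (2 * a t) = exp (a t) * exp (a t)).
  { intros t. rewrite <- exp_plus. f_equal. ring. }
  assert (Dexp : forall c t, T <= t ->
     is_derive (fun t => a' t ^ 2 - c * exp (2 * a t)) t (2 * a' t * (a'' t - c * exp (2 * a t)))).
  { intros c t Ht. auto_derive.
    - split; [eexists; apply Ha', Ht | split; [eexists; apply Ha, Ht | exact I]].
    - change (Derive (fun x => a' x) t) with (Derive a' t).
      change (Derive (fun x => a x) t) with (Derive a t).
      rewrite (is_derive_unique _ _ _ (Ha t Ht)), (is_derive_unique _ _ _ (Ha' t Ht)).
      simpl. ring. }
  assert (Lexp : forall c, is_lim (fun t => a' t ^ 2 - c * exp (2 * a t)) p_infty 0).
  { intros c. replace (Finite 0) with (Finite (0 * 0 - c * (0 * 0))) by (f_equal; ring).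
    apply (is_lim_ext (fun t => a' t * a' t - c * (exp (a t) * exp (a t)))).
    - intros t. rewrite Eexp. ring.
    - apply is_lim_minus'.
      + apply is_lim_mult'; assumption.
      + apply is_lim_mult'; [apply is_lim_const | apply is_lim_mult'; assumption]. }
  (* - a' e^(-a) is the derivative of e^(-a) *)
  assert (Hq : forall d, 0 < d < s -> eventually_inf (fun t =>
     s - d <= - a' t * exp (- a t) <= s + d)).
  { intros d Hd.
    assert (Hev : eventually_inf (fun t => T <= t /\
        (s - d) ^ 2 * exp (2 * a t) <= a'' t <= (s + d) ^ 2 * exp (2 * a t))).
    { assert (Hp : 0 < d * s) by nra.
      apply filter_and; [apply eventually_ge|].
      eapply filter_imp; [|exact (is_lim_eventually _ _ (d * s) Hk Hp)].
      intros t Ht. apply Rabs_def2 in Ht.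
      assert (E : a'' t = a'' t * exp (- (2 * a t)) * exp (2 * a t)).
      { rewrite Rmult_assoc, <- exp_plus. replace (- (2 * a t) + 2 * a t) with 0 by ring.
        rewrite exp_0. ring. }
      assert (P := exp_pos (2 * a t)).
      rewrite E. split; apply Rmult_le_compat_r; nra. }
    destruct Hev as [T1 HT1]. exists T1. intros t Ht.
    assert (HT : T <= t) by apply (HT1 t Ht).
    assert (Hsign : forall x, t <= x -> a' x <= 0 /\
        (s - d) ^ 2 * exp (2 * a x) <= a'' x <= (s + d) ^ 2 * exp (2 * a x)).
    { intros x Hx. destruct (HT1 x ltac:(lra)) as [A B]. auto. }
    assert (Hlow : 0 <= a' t ^ 2 - (s - d) ^ 2 * exp (2 * a t)).
    { apply (nonincreasing_to_0 _ _ t (fun x Hx => Dexp _ x ltac:(lra))); [|apply Lexp].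
      intros x Hx. destruct (Hsign x Hx). nra. }
    assert (Hup : 0 <= - (a' t ^ 2 - (s + d) ^ 2 * exp (2 * a t))).
    { apply (nonincreasing_to_0 (fun t => - (a' t ^ 2 - (s + d) ^ 2 * exp (2 * a t))) _ t
        (fun x Hx => is_derive_opp _ _ _ (Dexp _ x ltac:(lra)))).
      - intros x Hx. destruct (Hsign x Hx). unfold opp; simpl. nra.
      - rewrite <- Ropp_0. apply (is_lim_opp _ p_infty 0), Lexp. }
    specialize (Hneg t HT). rewrite Eexp in Hlow, Hup.
    assert (P := exp_pos (a t)).
    rewrite exp_Ropp.
    assert (Hl : (s - d) * exp (a t) <= - a' t).
    { apply Rsqr_incr_0_var; [unfold Rsqr; nra | lra]. }
    assert (Hu : - a' t <= (s + d) * exp (a t)).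
    { apply Rsqr_incr_0_var; [unfold Rsqr; nra | nra]. }
    split.
    - apply Rmult_le_reg_r with (exp (a t)); [exact P|]. rewrite Rmult_assoc, Rinv_l; lra.
    - apply Rmult_le_reg_r with (exp (a t)); [exact P|]. rewrite Rmult_assoc, Rinv_l; lra. }
  assert (Dq : forall t, T <= t -> is_derive (fun t => exp (- a t)) t (- a' t * exp (- a t))).
  { intros t Ht. auto_derive; [eexists; apply Ha, Ht|].
    change (Derive (fun x => a x) t) with (Derive a t).
    rewrite (is_derive_unique _ _ _ (Ha t Ht)). ring. }
  assert (Hquot : is_lim (fun t => exp (- a t) / t) p_infty s).
  { apply (quotient_limit_inf _ _ T s Dq). apply is_lim_intro. intros eps Heps.
    set (d := Rmin (eps / 2) (s / 2)).
    destruct (Rmin_bounds (eps / 2) (s / 2)) as [A B].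
    assert (Hd : 0 < d) by (apply Rmin_pos; lra). fold d in A, B.
    assert (Hds : 0 < d < s) by lra.
    eapply filter_imp; [|exact (Hq d Hds)].
    intros t Ht. apply Rabs_def1; lra. }
  apply (is_lim_ext_loc (fun t => / (exp (- a t) / t))).
  - exists 1. intros t Ht. rewrite exp_Ropp. field. split; [|lra]. apply Rgt_not_eq, exp_pos.
  - apply (is_lim_inv (fun t => exp (- a t) / t) p_infty s).
    + exact Hquot.
    + intros E. injection E. lra.
Qed.

(** * The curvature equation on a half-cylinder *)

Lemma angle_exists (x y : R) : x ^ 2 + y ^ 2 = 1 ->
  exists phi, 0 <= phi <= 2 * PI /\ x = cos phi /\ y = sin phi.
Proof.
  intros H. assert (Hx : -1 <= x <= 1) by nra.
  assert (B := acos_bound x). assert (P := PI_RGT_0).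
  assert (Hs : sin (acos x) = Rabs y).
  { rewrite sin_acos by exact Hx. rewrite <- sqrt_Rsqr_abs. f_equal. unfold Rsqr. nra. }
  destruct (Rle_or_lt 0 y) as [Hy|Hy].
  - exists (acos x). rewrite cos_acos by exact Hx. rewrite Hs, Rabs_right by lra.
    repeat split; lra.
  - exists (2 * PI - acos x). rewrite cos_minus, sin_minus, cos_2PI, sin_2PI, cos_acos, Hs by exact Hx.
    rewrite Rabs_left by exact Hy. repeat split; lra.
Qed.

Lemma polar_exists (x y : R) : 0 < x ^ 2 + y ^ 2 ->
  exists phi, x = sqrt (x ^ 2 + y ^ 2) * cos phi /\ y = sqrt (x ^ 2 + y ^ 2) * sin phi.
Proof.
  intros H. assert (Hs := sqrt_lt_R0 _ H). assert (E := sqrt_sqrt _ (Rlt_le _ _ H)).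
  set (r := sqrt (x ^ 2 + y ^ 2)) in *.
  destruct (angle_exists (x / r) (y / r)) as [phi [_ [H1 H2]]].
  - replace ((x / r) ^ 2 + (y / r) ^ 2) with ((x ^ 2 + y ^ 2) / (r * r)) by (field; lra).
    rewrite E. field. lra.
  - exists phi. rewrite <- H1, <- H2. split; field; lra.
Qed.

Lemma pol_reduce (phi : R) : exists psi, 0 <= psi <= 2 * PI /\
  forall f p q r, pol f p q r phi = pol f p q r psi.
Proof.
  destruct (angle_exists (cos phi) (sin phi)) as [psi [H [H1 H2]]].
  - assert (E := sin2_cos2 phi). unfold Rsqr in E. simpl. lra.
  - exists psi. split; [exact H|]. intros. unfold pol. rewrite H1, H2. reflexivity.
Qed.

Lemma sqr_circle (r phi : R) : (0 + r * cos phi) ^ 2 + (0 + r * sin phi) ^ 2 = r ^ 2.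
Proof. assert (E := sin2_cos2 phi). unfold Rsqr in E. nra. Qed.

Definition punctured (R0 x y : R) : Prop := 0 < x ^ 2 + y ^ 2 < R0 ^ 2.

Lemma open_punctured R0 : open_2d (punctured R0).
Proof.
  intros x y [H1 H2].
  assert (Hc : continuity_2d_pt (fun x y => x ^ 2 + y ^ 2) x y).
  { apply (continuity_2d_pt_ext (fun x y => x * x + y * y)); [intros; ring|].
    apply continuity_2d_pt_plus; apply continuity_2d_pt_mult;
      first [apply continuity_2d_pt_id1 | apply continuity_2d_pt_id2]. }
  set (e := Rmin (x ^ 2 + y ^ 2) (R0 ^ 2 - (x ^ 2 + y ^ 2))).
  assert (He : 0 < e) by (apply Rmin_pos; lra).
  destruct (Hc (mkposreal e He)) as [d Hd]. exists d. intros a b Ha Hb.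
  specialize (Hd a b Ha Hb). simpl pos in Hd. apply Rabs_def2 in Hd.
  destruct (Rmin_bounds (x ^ 2 + y ^ 2) (R0 ^ 2 - (x ^ 2 + y ^ 2))) as [A B].
  unfold e in Hd. unfold punctured. lra.
Qed.

Section Cylinder.
Context (R0 m M k0 : R) (u ux uy uxx uxy uyx uyy k : R -> R -> R).
Context (HR0 : 0 < R0) (Hm : 0 < m) (Hk0 : 0 < k0).
Local Notation D := (punctured R0).
Context (Hu : C2_on D u ux uy uxx uxy uyx uyy).
Context (Heq : forall x y, D x y -> uxx x y + uyy x y = k x y * exp (2 * u x y)).
Context (Hk : forall x y, D x y -> m <= k x y <= M).
Context (Hlim : forall eps, 0 < eps -> exists d, 0 < d /\ forall x y, D x y ->
  x ^ 2 + y ^ 2 < d ^ 2 -> Rabs (k x y - k0) < eps).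

Local Notation HD := (open_punctured R0).
Local Notation lap := (fun x y => uxx x y + uyy x y).

Lemma circles_punctured : on_circles D 0 0 0 R0.
Proof.
  intros r phi Hr. unfold punctured. rewrite sqr_circle. split; [apply pow_lt; lra | nra].
Qed.

Lemma exp_radius t : - ln R0 < t -> 0 < exp (- t) < R0.
Proof.
  intros Ht. split; [apply exp_pos|].
  rewrite <- (exp_ln R0) by exact HR0. apply exp_increasing. lra.
Qed.

(** In the coordinates z = exp(-t + i phi) the metric becomes exp(U) |dw| with
    U = u - t, and U solves the same equation on a half-cylinder. *)
Definition cyl (t phi : R) : R := pol u 0 0 (exp (- t)) phi - t.

Definition cyl_t (t phi : R) : R := - exp (- t) * pol_r ux uy 0 0 (exp (- t)) phi - 1.

Definition cyl_tt (t phi : R) : R :=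
  exp (- t) ^ 2 * pol_rr uxx uxy uyx uyy 0 0 (exp (- t)) phi
  + exp (- t) * pol_r ux uy 0 0 (exp (- t)) phi.

Definition source (t phi : R) : R := exp (- t) ^ 2 * pol lap 0 0 (exp (- t)) phi.

Lemma cyl_equation t phi : - ln R0 < t ->
  source t phi = pol k 0 0 (exp (- t)) phi * exp (2 * cyl t phi).
Proof.
  intros Ht. assert (Hd := circles_punctured _ phi (exp_radius t Ht)).
  unfold source, cyl, pol. rewrite (Heq _ _ Hd).
  replace (2 * (u (0 + exp (- t) * cos phi) (0 + exp (- t) * sin phi) - t))
    with (2 * u (0 + exp (- t) * cos phi) (0 + exp (- t) * sin phi) + - t + - t) by ring.
  rewrite !exp_plus. ring.
Qed.

Lemma is_derive_comp_exp (g g' : R -> R) t :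
  is_derive g (exp (- t)) (g' (exp (- t))) ->
  is_derive (fun s => g (exp (- s))) t (- exp (- t) * g' (exp (- t))).
Proof.
  intros H. apply (is_derive_comp g (fun s => exp (- s))); [exact H|].
  auto_derive; [exact I | ring].
Qed.

Lemma is_derive_cyl t phi : - ln R0 < t -> is_derive (fun s => cyl s phi) t (cyl_t t phi).
Proof.
  intros Ht. unfold cyl, cyl_t.
  apply (is_derive_minus (V := R_NormedModule) (fun s => pol u 0 0 (exp (- s)) phi) (fun s => s)).
  - apply (is_derive_comp_exp (fun r => pol u 0 0 r phi) (fun r => pol_r ux uy 0 0 r phi)).
    apply (is_derive_pol_r D u); [exact HD | apply Hu | apply circles_punctured, exp_radius, Ht].
  - apply (is_derive_id (K := R_AbsRing)).
Qed.

Lemma is_derive_cyl_t t phi : - ln R0 < t -> is_derive (fun s => cyl_t s phi) t (cyl_tt t phi).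
Proof.
  intros Ht.
  assert (H := is_derive_comp_exp (fun r => pol_r ux uy 0 0 r phi)
     (fun r => pol_rr uxx uxy uyx uyy 0 0 r phi) t
     (is_derive_pol_r_r D u ux uy uxx uxy uyx uyy 0 0 _ phi HD Hu
        (circles_punctured _ phi (exp_radius t Ht)))).
  assert (E : is_derive (fun s => - exp (- s)) t (exp (- t))) by (auto_derive; [exact I | ring]).
  assert (P := is_derive_mult (fun s => - exp (- s)) _ t _ _ E H Rmult_comm).
  assert (Q := is_derive_minus _ _ _ _ _ P (is_derive_const 1 t)).
  derive_as Q.
  unfold minus, plus, opp, mult, zero; simpl. unfold cyl_tt. ring.
Qed.

Lemma cyl_laplacian t phi :
  cyl_tt t phi + pol_pp ux uy uxx uxy uyx uyy 0 0 (exp (- t)) phi = source t phi.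
Proof. unfold cyl_tt, source. apply pol_laplacian. Qed.

Lemma cyl_continuity t phi : - ln R0 < t -> continuity_2d_pt cyl t phi.
Proof.
  intros Ht. unfold cyl. apply continuity_2d_pt_minus; [|apply continuity_2d_pt_id1].
  apply (continuity_2d_pt_comp2 (pol u 0 0) (fun t _ => exp (- t)) (fun _ phi => phi)).
  - apply pol_continuity. apply (C2_cont1 D u ux uy uxx uxy uyx uyy HD Hu), circles_punctured, exp_radius, Ht.
  - apply (continuity_1d_2d_pt_comp exp (fun t _ => - t)).
    + eapply is_derive_continuity_pt, is_derive_exp.
    + apply continuity_2d_pt_opp, continuity_2d_pt_id1.
  - apply continuity_2d_pt_id2.
Qed.

(** Ahlfors' lemma for a strip: the comparison metric (pi/L) / (sqrt m sin (pi (s-T)/L)) of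
    constant curvature -m blows up at both ends of the strip T < s < T + L, so the quotient has
    an interior maximum, where the two Laplacians can be compared. *)
Lemma cyl_upper T t phi : - ln R0 < T -> T < t ->
  exp (cyl t phi) <= PI / (2 * sqrt m * (t - T)).
Proof.
  intros HT Ht. assert (P := PI_RGT_0). assert (Sm := sqrt_lt_R0 m Hm).
  set (L := 2 * (t - T)). assert (HL : 0 < L) by (unfold L; lra).
  set (w := fun s => PI * (s - T) / L).
  set (E := fun s psi => exp (cyl s psi) * sin (w s)).
  assert (Hw : forall s, T <= s <= T + L -> 0 <= w s <= PI).
  { intros s Hs. unfold w. split.
    - apply Rdiv_le_0_compat; [nra | exact HL].
    - apply Rmult_le_reg_r with L; [exact HL|]. unfold Rdiv. rewrite Rmult_assoc, Rinv_l by lra. nra. }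
  destruct (continuity_2d_max E T (T + L) 0 (2 * PI)) as [s0 [psi0 [Hs0 [Hpsi0 Hmax]]]].
  { lra. } { lra. }
  { intros s psi Hs _. unfold E. apply continuity_2d_pt_mult.
    - apply (continuity_1d_2d_pt_comp exp cyl).
      + eapply is_derive_continuity_pt, is_derive_exp.
      + apply cyl_continuity. lra.
    - apply (continuity_1d_2d_pt_comp sin (fun s _ => w s)); [apply continuity_sin|].
      unfold w. apply continuity_2d_pt_mult; [|apply continuity_2d_pt_const].
      apply continuity_2d_pt_mult; [apply continuity_2d_pt_const|].
      apply continuity_2d_pt_minus; [apply continuity_2d_pt_id1 | apply continuity_2d_pt_const]. }
  destruct (pol_reduce phi) as [psi [Hpsi Ered]].
  assert (Et : E t psi = exp (cyl t phi)).
  { unfold E, w. replace (PI * (t - T) / L) with (PI / 2) by (unfold L; field; lra).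
    rewrite sin_PI2, Rmult_1_r. unfold cyl. rewrite Ered. reflexivity. }
  assert (Hle := Hmax t psi ltac:(unfold L in *; lra) Hpsi). rewrite Et in Hle.
  eapply Rle_trans; [exact Hle|].
  replace (PI / (2 * sqrt m * (t - T))) with (PI / L / sqrt m) by (unfold L; field; lra).
  assert (Hpos : 0 < E s0 psi0) by (assert (A := exp_pos (cyl t phi)); lra).
  assert (Hsin : 0 < sin (w s0)).
  { unfold E in Hpos. assert (A := exp_pos (cyl s0 psi0)). nra. }
  assert (Hs0' : T < s0 < T + L).
  { split.
    - destruct (Req_dec s0 T) as [EE|]; [|lra]. exfalso. unfold w in Hsin. rewrite EE in Hsin.
      replace (PI * (T - T) / L) with 0 in Hsin by (field; lra). rewrite sin_0 in Hsin. lra.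
    - destruct (Req_dec s0 (T + L)) as [EE|]; [|lra]. exfalso. unfold w in Hsin. rewrite EE in Hsin.
      replace (PI * (T + L - T) / L) with PI in Hsin by (field; lra). rewrite sin_PI in Hsin. lra. }
  assert (Hwi : forall s, T < s < T + L -> 0 < sin (w s)).
  { intros s Hs. apply sin_gt_0; unfold w.
    - apply Rdiv_lt_0_compat; [nra | exact HL].
    - apply Rmult_lt_reg_r with L; [exact HL|]. unfold Rdiv. rewrite Rmult_assoc, Rinv_l by lra. nra. }
  set (d := Rmin (s0 - T) (T + L - s0)).
  assert (Hd : 0 < d) by (apply Rmin_pos; lra).
  destruct (Rmin_bounds (s0 - T) (T + L - s0)) as [Hd1 Hd2].
  fold d in Hd1, Hd2.
  assert (Htt : cyl_tt s0 psi0 + - (PI / L) ^ 2 / sin (w s0) ^ 2 <= 0).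
  { apply (second_derivative_at_max (fun s => cyl s psi0 + ln (sin (w s)))
       (fun s => cyl_t s psi0 + PI / L * cos (w s) / sin (w s)) s0 _ d Hd).
    - intros s Hs. apply Rabs_def2 in Hs.
      apply (is_derive_plus (V := R_NormedModule) (fun s => cyl s psi0)).
      + apply is_derive_cyl. lra.
      + assert (A := Hwi s ltac:(lra)). unfold w in *. auto_derive; [exact A |].
        unfold Rminus, Rdiv in *. field. split; lra.
    - apply (is_derive_plus (V := R_NormedModule) (fun s => cyl_t s psi0)).
      + apply is_derive_cyl_t. lra.
      + assert (A := Hsin). unfold w in *.
        assert (S2 := sin2_cos2 (PI * (s0 - T) / L)). unfold Rsqr in S2.
        auto_derive; [apply Rgt_not_eq; exact A |].
        unfold Rdiv, Rminus in *.
        set (th := PI * (s0 + - T) * / L) in *.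
        assert (C2 : cos th * cos th = 1 - sin th * sin th) by lra.
        field_simplify; [|lra|lra].
        replace (cos th ^ 2) with (1 - sin th ^ 2) by (simpl; lra).
        field. lra.
    - intros s Hs. apply Rabs_def2 in Hs. assert (A := Hwi s ltac:(lra)).
      rewrite <- (ln_exp (cyl s psi0)), <- (ln_exp (cyl s0 psi0)), <- !ln_mult by
        (first [apply exp_pos | assumption]).
      assert (B := Hmax s psi0 ltac:(lra) Hpsi0). unfold E in B.
      destruct (Req_dec (exp (cyl s psi0) * sin (w s)) (exp (cyl s0 psi0) * sin (w s0))) as [EE|NE].
      + rewrite EE. lra.
      + left. apply ln_increasing; [|lra]. apply Rmult_lt_0_compat; [apply exp_pos | exact A]. }
  assert (Hpp : pol_pp ux uy uxx uxy uyx uyy 0 0 (exp (- s0)) psi0 <= 0).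
  { assert (Dc : forall psi, D (0 + exp (- s0) * cos psi) (0 + exp (- s0) * sin psi)).
    { intros x. apply circles_punctured, exp_radius. lra. }
    apply (second_derivative_at_max (pol u 0 0 (exp (- s0))) (pol_phi ux uy 0 0 (exp (- s0))) psi0 _ 1
       Rlt_0_1).
    - intros x _. apply (is_derive_pol_phi D u); [exact HD | apply Hu | apply Dc].
    - apply (is_derive_pol_phi_phi D u); [exact HD | exact Hu | apply Dc].
    - intros x _. destruct (pol_reduce x) as [x' [Hx' Ex]]. rewrite Ex.
      assert (B := Hmax s0 x' Hs0 Hx'). unfold E in B.
      apply Rmult_le_reg_r in B; [|exact Hsin].
      apply Rnot_lt_le. intros Hlt. apply (Rlt_not_le _ _ (exp_increasing (cyl s0 psi0) (cyl s0 x') ltac:(unfold cyl; lra))).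
      exact B. }
  assert (Hsrc : source s0 psi0 <= (PI / L) ^ 2 / sin (w s0) ^ 2).
  { rewrite <- cyl_laplacian. unfold Rdiv in *. lra. }
  rewrite cyl_equation in Hsrc by lra.
  assert (Hkm : m <= pol k 0 0 (exp (- s0)) psi0).
  { apply Hk, circles_punctured, exp_radius. lra. }
  replace (exp (2 * cyl s0 psi0)) with (exp (cyl s0 psi0) * exp (cyl s0 psi0)) in Hsrc
    by (rewrite <- exp_plus; f_equal; ring).
  assert (He := exp_pos (cyl s0 psi0)). set (e := exp (cyl s0 psi0)) in *.
  assert (H2 : m * (e * e) <= (PI / L) ^ 2 / sin (w s0) ^ 2).
  { eapply Rle_trans; [|exact Hsrc]. apply Rmult_le_compat_r; nra. }
  assert (H3 : m * (e * e) * (sin (w s0) * sin (w s0)) <= (PI / L) ^ 2).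
  { apply Rmult_le_compat_r with (r := sin (w s0) * sin (w s0)) in H2; [|nra].
    eapply Rle_trans; [exact H2|]. right. field. lra. }
  unfold E. fold e.
  apply Rmult_le_reg_r with (sqrt m); [exact Sm|].
  unfold Rdiv at 1. rewrite (Rmult_assoc (PI / L)), Rinv_l, Rmult_1_r by lra.
  assert (HPL : 0 < PI / L) by (apply Rdiv_lt_0_compat; lra).
  apply Rsqr_incr_0_var; [|lra]. unfold Rsqr.
  assert (Sq := sqrt_sqrt m (Rlt_le _ _ Hm)).
  replace (e * sin (w s0) * sqrt m * (e * sin (w s0) * sqrt m))
    with ((sqrt m * sqrt m) * (e * e) * (sin (w s0) * sin (w s0))) by ring.
  rewrite Sq. simpl in H3. lra.
Qed.

Lemma far_bounds : exists T C, 2 <= T /\ - ln R0 < T /\ 0 < C /\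
  forall t phi, T <= t ->
    exp (cyl t phi) <= C / t /\ cyl t phi <= 0 /\ 0 <= source t phi <= C / t ^ 2.
Proof.
  assert (P := PI_RGT_0). assert (Sm := sqrt_lt_R0 m Hm).
  assert (HM : m <= M).
  { assert (Dp : D (0 + R0 / 2 * cos 0) (0 + R0 / 2 * sin 0)) by (apply circles_punctured; lra).
    specialize (Hk _ _ Dp). lra. }
  set (C0 := PI / sqrt m). assert (HC0 : 0 < C0) by (apply Rdiv_lt_0_compat; lra).
  set (T1 := Rmax (1 - ln R0) 1).
  destruct (Rmax_bounds (1 - ln R0) 1) as [A1 A2]. fold T1 in A1, A2.
  set (T := Rmax (2 * T1) C0).
  destruct (Rmax_bounds (2 * T1) C0) as [A3 A4]. fold T in A3, A4.
  assert (HMC : 0 < M * C0 ^ 2) by (apply Rmult_lt_0_compat; [lra | apply pow_lt; lra]).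
  exists T, (C0 + M * C0 ^ 2). split; [lra|]. split; [lra|]. split; [lra|].
  intros t phi Ht.
  assert (He : exp (cyl t phi) <= C0 / t).
  { eapply Rle_trans; [apply (cyl_upper T1); lra|].
    replace (C0 / t) with (PI * / (2 * sqrt m * (t / 2))) by (unfold C0; field; lra).
    apply Rmult_le_compat_l; [lra|]. apply Rinv_le_contravar; [nra|].
    apply Rmult_le_compat_l; lra. }
  assert (Hit : 0 < / t) by (apply Rinv_0_lt_compat; lra).
  assert (Hp := exp_pos (cyl t phi)).
  split; [|split].
  - eapply Rle_trans; [exact He|]. apply Rmult_le_compat_r; lra.
  - assert (exp (cyl t phi) <= exp 0).
    { rewrite exp_0. eapply Rle_trans; [exact He|].
      apply Rmult_le_reg_r with t; [lra|]. unfold Rdiv. rewrite Rmult_assoc, Rinv_l; lra. }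
    apply Rnot_lt_le. intros Hlt. assert (X := exp_increasing _ _ Hlt). lra.
  - rewrite cyl_equation by lra.
    assert (Hkk := Hk _ _ (circles_punctured (exp (- t)) phi (exp_radius t ltac:(lra)))).
    fold (pol k 0 0 (exp (- t)) phi) in Hkk.
    assert (E2 : exp (2 * cyl t phi) = exp (cyl t phi) * exp (cyl t phi))
      by (rewrite <- exp_plus; f_equal; ring).
    rewrite E2. split.
    + apply Rmult_le_pos; [lra | nra].
    + apply Rle_trans with (M * (C0 / t * (C0 / t))).
      * apply Rmult_le_compat; [lra | nra | lra |]. apply Rmult_le_compat; lra.
      * replace ((C0 + M * C0 ^ 2) / t ^ 2) with (M * (C0 / t * (C0 / t)) + C0 / t ^ 2) by (field; lra).
        assert (0 < C0 / t ^ 2) by (apply Rdiv_lt_0_compat; [lra | apply pow_lt; lra]). lra.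
Qed.

Lemma continuity_u x y : D x y -> continuity_2d_pt u x y.
Proof. intros Hd. apply (C2_cont1 D u ux uy uxx uxy uyx uyy HD Hu _ _ Hd). Qed.

Lemma continuity_lap x y : D x y -> continuity_2d_pt lap x y.
Proof.
  intros Hd. apply continuity_2d_pt_plus; apply (C2_cont2 D u ux uy uxx uxy uyx uyy Hu _ _ Hd).
Qed.

Lemma continuous_pol_D f t phi : - ln R0 < t ->
  (forall x y, D x y -> continuity_2d_pt f x y) -> continuous (pol f 0 0 (exp (- t))) phi.
Proof.
  intros Ht Hf. apply (continuity_2d_slice (pol f 0 0)), pol_continuity, Hf, circles_punctured, exp_radius, Ht.
Qed.

Lemma continuous_cyl t phi : - ln R0 < t -> continuous (cyl t) phi.
Proof. intros Ht. apply (continuity_2d_slice cyl), cyl_continuity, Ht. Qed.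

Lemma continuous_source t phi : - ln R0 < t -> continuous (source t) phi.
Proof.
  intros Ht. unfold source. apply continuous_scal_R, continuous_pol_D; [exact Ht | exact continuity_lap].
Qed.

Definition slice_mode (n : nat) (th t : R) : R := mode u 0 0 n th (exp (- t)).

Definition slice_mode_t (n : nat) (th t : R) : R :=
  - exp (- t) * mode_r ux uy 0 0 n th (exp (- t)).

Definition slice_source (n : nat) (th t : R) : R :=
  RInt (fun phi => source t phi * cos (INR n * (phi - th))) 0 (2 * PI).

Lemma slice_source_mode n th t : - ln R0 < t ->
  slice_source n th t = exp (- t) ^ 2 * mode lap 0 0 n th (exp (- t)).
Proof.
  intros Ht. unfold slice_source, mode. rewrite <- RInt_scal_cont.
  - apply RInt_ext. intros x _. unfold source. ring_R.
  - intros x. apply continuous_mult_R; [|cont1].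
    apply continuous_pol_D; [exact Ht | exact continuity_lap].
Qed.

Lemma is_derive_slice_mode n th t : - ln R0 < t ->
  is_derive (slice_mode n th) t (slice_mode_t n th t).
Proof.
  intros Ht. unfold slice_mode, slice_mode_t.
  apply (is_derive_comp_exp (mode u 0 0 n th) (mode_r ux uy 0 0 n th)).
  apply (is_derive_mode D u ux uy uxx uxy uyx uyy HD Hu 0 0 0 R0 circles_punctured).
  apply exp_radius, Ht.
Qed.

Lemma is_derive_slice_mode_t n th t : - ln R0 < t ->
  is_derive (slice_mode_t n th) t (INR n ^ 2 * slice_mode n th t + slice_source n th t).
Proof.
  intros Ht.
  assert (H := is_derive_comp_exp _ _ t
    (is_derive_mode_r D u ux uy uxx uxy uyx uyy HD Hu 0 0 0 R0 circles_punctured n th _ (exp_radius t Ht))).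
  assert (E : is_derive (fun s => - exp (- s)) t (exp (- t))) by (auto_derive; [exact I | ring]).
  assert (P := is_derive_mult (fun s => - exp (- s)) _ t _ _ E H Rmult_comm).
  derive_as P.
  rewrite slice_source_mode by exact Ht. unfold slice_mode.
  rewrite <- (mode_equation D u ux uy uxx uxy uyx uyy HD Hu 0 0 0 R0 circles_punctured n th _ (exp_radius t Ht)).
  unfold plus, mult; simpl. ring.
Qed.

(** U is u - t, whence the last term; the modes of positive order of U and u agree. *)
Definition mean (t : R) : R := / (2 * PI) * slice_mode 0 0 t - t.
Definition mean_t (t : R) : R := / (2 * PI) * slice_mode_t 0 0 t - 1.
Definition mean_tt (t : R) : R := / (2 * PI) * RInt (source t) 0 (2 * PI).

Lemma cos_weight_0 (phi th : R) : cos (INR 0 * (phi - th)) = 1.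
Proof. simpl. rewrite Rmult_0_l. apply cos_0. Qed.

Lemma slice_mode_0 t : slice_mode 0 0 t = RInt (pol u 0 0 (exp (- t))) 0 (2 * PI).
Proof. apply RInt_ext. intros x _. rewrite cos_weight_0. ring_R. Qed.

Lemma is_derive_mean t : - ln R0 < t -> is_derive mean t (mean_t t).
Proof.
  intros Ht. apply (is_derive_minus (V := R_NormedModule) (fun s => / (2 * PI) * slice_mode 0 0 s)).
  - apply is_derive_scal, is_derive_slice_mode, Ht.
  - apply (is_derive_id (K := R_AbsRing)).
Qed.

Lemma is_derive_mean_t t : - ln R0 < t -> is_derive mean_t t (mean_tt t).
Proof.
  intros Ht. unfold mean_tt.
  replace (/ (2 * PI) * RInt (source t) 0 (2 * PI))
    with (/ (2 * PI) * (INR 0 ^ 2 * slice_mode 0 0 t + slice_source 0 0 t) - 0).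
  - apply (is_derive_minus (V := R_NormedModule) (fun s => / (2 * PI) * slice_mode_t 0 0 s)).
    + apply is_derive_scal, is_derive_slice_mode_t, Ht.
    + apply (is_derive_const (V := R_NormedModule)).
  - unfold slice_source. rewrite (RInt_ext _ (source t)).
    + simpl. ring_R.
    + intros x _. rewrite cos_weight_0. ring_R.
Qed.

Lemma mean_integral t : - ln R0 < t -> RInt (cyl t) 0 (2 * PI) = 2 * PI * mean t.
Proof.
  intros Ht. assert (P := PI_RGT_0). unfold mean. rewrite slice_mode_0.
  rewrite (RInt_ext (cyl t) (fun phi => pol u 0 0 (exp (- t)) phi + - t)) by (intros; reflexivity).
  rewrite RInt_plus_cont, RInt_period_const.
  - eq_R. field. lra.
  - intros x. apply continuous_pol_D; [exact Ht | exact continuity_u].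
  - intros x. cont1.
Qed.

Section Far.
Context (T C : R) (HT2 : 2 <= T) (HT0 : - ln R0 < T) (HC : 0 < C).
Context (Hfar : forall t phi, T <= t ->
    exp (cyl t phi) <= C / t /\ cyl t phi <= 0 /\ 0 <= source t phi <= C / t ^ 2).

Lemma mean_nonpos t : T <= t -> mean t <= 0.
Proof.
  intros Ht. assert (P := PI_RGT_0).
  assert (H : RInt (cyl t) 0 (2 * PI) <= RInt (fun _ => 0) 0 (2 * PI)).
  { apply RInt_le; [lra | | |].
    - apply ex_RInt_cont. intros x. apply continuous_cyl. lra.
    - apply ex_RInt_cont. intros x. apply continuous_const.
    - intros x _. apply Hfar, Ht. }
  rewrite mean_integral, RInt_period_const in H by lra. nra.
Qed.

Lemma mean_tt_nonneg t : T <= t -> 0 <= mean_tt t.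
Proof.
  intros Ht. assert (P := PI_RGT_0).
  apply Rmult_le_pos; [left; apply Rinv_0_lt_compat; lra|].
  apply RInt_ge_0; [lra | apply ex_RInt_cont; intros x; apply continuous_source; lra|].
  intros x _. apply Hfar, Ht.
Qed.

Lemma mean_t_mono s t : T <= s <= t -> mean_t s <= mean_t t.
Proof.
  intros Hst.
  assert (H := increment_le (fun _ => 0) mean_t (fun _ => 0) mean_tt s t ltac:(lra)
    (fun x _ => is_derive_const 0 x) (fun x Hx => is_derive_mean_t x ltac:(lra))
    (fun x Hx => mean_tt_nonneg x ltac:(lra))). lra.
Qed.

(** A convex function with a positive slope somewhere is unbounded above, but the mean of U is
    nonpositive. *)
Lemma mean_t_nonpos t : T <= t -> mean_t t <= 0.
Proof.
  intros Ht. apply Rnot_lt_le. intros Hpos.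
  set (b := t + (1 - mean t) / mean_t t).
  assert (Hb : 0 < (1 - mean t) / mean_t t).
  { apply Rdiv_lt_0_compat; [|exact Hpos]. assert (A := mean_nonpos t Ht). lra. }
  assert (H := increment_le (fun s => mean_t t * s) mean (fun _ => mean_t t) mean_t t b
    ltac:(unfold b; lra) (fun x _ => is_derive_linear _ x) (fun x Hx => is_derive_mean x ltac:(lra))
    (fun x Hx => mean_t_mono t x ltac:(lra))).
  cbv beta in H.
  assert (E : mean_t t * b - mean_t t * t = 1 - mean t) by (unfold b; field; lra).
  assert (N := mean_nonpos b ltac:(unfold b; lra)). lra.
Qed.

Lemma mean_linear_bound : exists C2, 0 <= C2 /\ forall t, T <= t -> - (2 * PI * mean t) <= C2 * t.
Proof.
  assert (P := PI_RGT_0).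
  exists (2 * PI * (- mean T - mean_t T)).
  assert (N1 := mean_nonpos T ltac:(lra)). assert (N2 := mean_t_nonpos T ltac:(lra)).
  split; [nra|]. intros t Ht.
  assert (H := increment_le (fun s => mean_t T * s) mean (fun _ => mean_t T) mean_t T t Ht
    (fun x _ => is_derive_linear _ x) (fun x Hx => is_derive_mean x ltac:(lra))
    (fun x Hx => mean_t_mono T x ltac:(lra))).
  cbv beta in H.
  assert (- mean t <= (- mean T - mean_t T) * t) by nra. nra.
Qed.

(** As U has a sign, the mode of order 0 is up to sign its L^1 norm, which bounds every mode. *)
Lemma slice_mode_bound n th t : (0 < n)%nat -> T <= t ->
  Rabs (slice_mode n th t) <= - (2 * PI * mean t).
Proof.
  intros Hn Ht.
  assert (Cu : forall x, continuous (cyl t) x) by (intros x; apply continuous_cyl; lra).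
  assert (E : slice_mode n th t = RInt (fun phi => cyl t phi * cos (INR n * (phi - th))) 0 (2 * PI)).
  { unfold slice_mode, mode.
    rewrite (RInt_ext _ (fun phi => cyl t phi * cos (INR n * (phi - th)) + t * cos (INR n * (phi - th)))).
    2: { intros x _. unfold cyl. ring_R. }
    rewrite RInt_plus_cont, RInt_scal_cont, RInt_weight by
      first [exact Hn | intros x; first [ apply continuous_weight
        | apply continuous_scal_R, continuous_weight
        | apply continuous_mult_R; [apply Cu | apply continuous_weight]]].
    ring_R. }
  rewrite E.
  replace (- (2 * PI * mean t)) with (RInt (fun phi => (-1) * cyl t phi) 0 (2 * PI)).
  - apply RInt_bound.
    + intros x. cont1.
    + intros x. cont1.
    + intros x _. destruct (Hfar t x Ht) as [_ [N _]]. assert (B := COS_bound (INR n * (x - th))).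
      rewrite Rabs_mult, (Rabs_left1 (cyl t x)) by exact N.
      assert (Rabs (cos (INR n * (x - th))) <= 1) by (apply Rabs_le; lra).
      replace (-1 * cyl t x) with (- cyl t x * 1) by ring. apply Rmult_le_compat_l; lra.
  - rewrite RInt_scal_cont, mean_integral by first [lra | exact Cu]. ring_R.
Qed.

Lemma slice_source_bound n th t : T <= t -> Rabs (slice_source n th t) <= 2 * PI * C / t ^ 2.
Proof.
  intros Ht.
  replace (2 * PI * C / t ^ 2) with (RInt (fun _ => C / t ^ 2) 0 (2 * PI)).
  - apply RInt_bound.
    + intros x. apply continuous_mult_R; [apply continuous_source; lra | apply continuous_weight].
    + intros x. cont1.
    + intros x _. destruct (Hfar t x Ht) as [_ [_ N]]. assert (B := COS_bound (INR n * (x - th))).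
      rewrite Rabs_mult, (Rabs_right (source t x)) by lra.
      assert (Rabs (cos (INR n * (x - th))) <= 1) by (apply Rabs_le; lra).
      rewrite <- (Rmult_1_r (C / t ^ 2)). apply Rmult_le_compat; [lra | apply Rabs_pos | lra | lra].
  - rewrite RInt_period_const. eq_R. field. lra.
Qed.

(** Continuity at the angle th in the form that [value_minus_mean_le] asks for: away from th the
    difference is bounded and 1 - cos is bounded below. *)
Lemma pol_close t th eps : - ln R0 < t -> 0 < eps -> exists K, 0 <= K /\
  forall s, 0 <= s <= 2 * PI ->
    Rabs (pol u 0 0 (exp (- t)) s - pol u 0 0 (exp (- t)) th) <= eps + K * (1 - cos (s - th)).
Proof.
  intros Ht Heps. set (r := exp (- t)). assert (Hr := exp_radius t Ht). fold r in Hr.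
  assert (Cu : forall phi, continuity_2d_pt u (0 + r * cos phi) (0 + r * sin phi)).
  { intros phi. apply (C2_cont1 D u ux uy uxx uxy uyx uyy HD Hu), circles_punctured, Hr. }
  destruct (Cu th (mkposreal eps Heps)) as [d Hd]. simpl in Hd.
  destruct (continuity_2d_bounded (fun x y => pol u 0 0 r y) 0 0 0 (2 * PI)) as [B [HB0 HB]].
  { intros x y _ _. apply (continuity_2d_pt_comp2 (pol u 0 0) (fun _ _ => r) (fun _ y => y)).
    - apply pol_continuity, Cu.
    - apply continuity_2d_pt_const.
    - apply continuity_2d_pt_id2. }
  set (v := pol u 0 0 r th).
  assert (Hd0 := cond_pos d).
  assert (Hd2 : 0 < d ^ 2) by (apply pow_lt; exact Hd0).
  assert (HK : 0 <= (B + Rabs v) / d ^ 2 * (2 * r ^ 2)).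
  { assert (A := Rabs_pos v). apply Rmult_le_pos; [apply Rdiv_le_0_compat; lra | nra]. }
  exists ((B + Rabs v) / d ^ 2 * (2 * r ^ 2)). split; [exact HK|].
  intros s Hs.
  set (a := r * cos s - r * cos th). set (b := r * sin s - r * sin th).
  (* the chord between the angles s and th *)
  assert (Hch : a ^ 2 + b ^ 2 = 2 * r ^ 2 * (1 - cos (s - th))).
  { unfold a, b. rewrite cos_minus.
    assert (E1 := sin2_cos2 s). assert (E2 := sin2_cos2 th). unfold Rsqr in E1, E2.
    replace (2 * r ^ 2 * (1 - (cos s * cos th + sin s * sin th)))
      with (r ^ 2 * ((sin s * sin s + cos s * cos s) + (sin th * sin th + cos th * cos th)
            - 2 * (cos s * cos th + sin s * sin th))) by (rewrite E1, E2; ring).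
    ring. }
  assert (Hc1 : 0 <= 1 - cos (s - th)) by (assert (X := COS_bound (s - th)); lra).
  assert (Hnn : 0 <= (B + Rabs v) / d ^ 2 * (2 * r ^ 2) * (1 - cos (s - th))) by (apply Rmult_le_pos; lra).
  destruct (Rlt_or_le (a ^ 2 + b ^ 2) (d ^ 2)) as [Hin|Hout].
  - assert (Rabs (pol u 0 0 r s - v) < eps); [|lra].
    apply Hd.
    + replace (0 + r * cos s - (0 + r * cos th)) with a by (unfold a; ring).
      rewrite <- (Rabs_right d) by lra; apply Rsqr_lt_abs_0; unfold Rsqr; nra.
    + replace (0 + r * sin s - (0 + r * sin th)) with b by (unfold b; ring).
      rewrite <- (Rabs_right d) by lra; apply Rsqr_lt_abs_0; unfold Rsqr; nra.
  - assert (H1 : Rabs (pol u 0 0 r s - v) <= B + Rabs v).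
    { eapply Rle_trans; [apply Rabs_triang|]. rewrite Rabs_Ropp.
      assert (X := HB 0 s ltac:(lra) Hs). lra. }
    assert (H2 : B + Rabs v <= (B + Rabs v) / d ^ 2 * (2 * r ^ 2) * (1 - cos (s - th))).
    { rewrite Rmult_assoc, <- Hch. unfold Rdiv. rewrite Rmult_assoc.
      rewrite <- (Rmult_1_r (B + Rabs v)) at 1.
      apply Rmult_le_compat_l; [assert (X := Rabs_pos v); lra|].
      apply Rmult_le_reg_l with (d ^ 2); [exact Hd2|].
      rewrite <- Rmult_assoc, Rinv_r, Rmult_1_l, Rmult_1_r by lra. exact Hout. }
    lra.
Qed.

(** The modes of U grow at most linearly and are forced by terms of size O(1 / t^2), so they are
    O(1 / (n^2 t)), which is summable over n. *)
Lemma oscillation : exists C', 0 < C' /\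
  forall t phi, 2 * T <= t -> Rabs (cyl t phi - mean t) <= C' / t.
Proof.
  assert (P := PI_RGT_0). destruct mean_linear_bound as [C2 [HC2 Hlin]].
  assert (HPC : 0 < 2 * PI * C) by nra.
  set (C3 := 2 * (2 * PI * C) + 16 * (C2 * T)).
  assert (HC3 : 0 < C3) by (unfold C3; nra).
  exists (4 * C3 / (2 * PI)). split; [apply Rdiv_lt_0_compat; lra|].
  intros t phi Ht.
  assert (Hmodes : forall n, (0 < n)%nat -> Rabs (slice_mode n phi t) <= C3 / t * / INR n ^ 2).
  { intros n Hn.
    apply (no_growth_bound (slice_mode n phi) (slice_mode_t n phi) (slice_source n phi)
       (INR n) T (2 * PI * C) C2); try assumption.
    - replace 1 with (INR 1) by reflexivity. apply le_INR. lia.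
    - intros s Hs. apply is_derive_slice_mode. lra.
    - intros s Hs. apply is_derive_slice_mode_t. lra.
    - intros s Hs. apply slice_source_bound, Hs.
    - intros s Hs. eapply Rle_trans; [apply slice_mode_bound; assumption | apply Hlin, Hs]. }
  assert (HF := value_minus_mean_le (pol u 0 0 (exp (- t))) phi (pol u 0 0 (exp (- t)) phi)
    (2 * (C3 / t)) (fun n => C3 / t * / INR n ^ 2)).
  assert (Hgoal : Rabs (2 * PI * pol u 0 0 (exp (- t)) phi - RInt (pol u 0 0 (exp (- t))) 0 (2 * PI))
     <= 2 * (2 * (C3 / t))).
  { apply HF.
    - intros x. apply continuous_pol_D; [lra | exact continuity_u].
    - exact Hmodes.
    - intros n. rewrite (sum_eq _ (fun k => / INR (S k) ^ 2 * (C3 / t))) by (intros; ring).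
      rewrite <- scal_sum, (Rmult_comm 2). apply Rmult_le_compat_l.
      + left. apply Rdiv_lt_0_compat; lra.
      + apply sum_inv_sq_le.
    - intros eps Heps. apply pol_close; [lra | exact Heps]. }
  rewrite <- slice_mode_0 in Hgoal.
  unfold cyl, mean.
  replace (pol u 0 0 (exp (- t)) phi - t - (/ (2 * PI) * slice_mode 0 0 t - t))
    with (/ (2 * PI) * (2 * PI * pol u 0 0 (exp (- t)) phi - slice_mode 0 0 t)) by (field; lra).
  assert (Hi : 0 < / (2 * PI)) by (apply Rinv_0_lt_compat; lra).
  rewrite Rabs_mult, (Rabs_right (/ (2 * PI))) by lra.
  replace (4 * C3 / (2 * PI) / t) with (/ (2 * PI) * (2 * (2 * (C3 / t)))) by (field; lra).
  apply Rmult_le_compat_l; lra.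
Qed.

Lemma mean_t_limit : exists gamma, 0 <= gamma /\ is_lim mean_t p_infty (- gamma) /\
  forall t, T <= t -> mean_t t <= - gamma.
Proof.
  destruct (monotone_limit mean_t T 0 mean_t_mono mean_t_nonpos) as [l [H1 [H2 H3]]].
  exists (- l). rewrite Ropp_involutive. split; [lra | auto].
Qed.

Context (C' : R) (HC' : 0 < C').
Context (Hosc : forall t phi, 2 * T <= t -> Rabs (cyl t phi - mean t) <= C' / t).

Lemma is_lim_const_div c : is_lim (fun t => c / t) p_infty 0.
Proof.
  replace (Finite 0) with (Rbar_mult c (Finite 0)) by (simpl; f_equal; ring).
  apply (is_lim_scal_l (fun t => / t) c p_infty 0).
  apply (is_lim_inv (fun t => t) p_infty p_infty); [apply is_lim_id | discriminate].
Qed.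

Lemma exp_mean_limit : is_lim (fun t => exp (mean t)) p_infty 0.
Proof.
  apply (is_lim_le_le_loc (fun _ => 0) (fun t => (C * exp C') / t)).
  - exists (2 * T). intros t Ht. split; [left; apply exp_pos|].
    destruct (Hfar t 0 ltac:(lra)) as [H _]. assert (H2 := Hosc t 0 ltac:(lra)).
    apply Rabs_le_between in H2.
    assert (H3 : C' / t <= C').
    { rewrite <- (Rmult_1_r C') at 2. apply Rmult_le_compat_l; [lra|].
      rewrite <- Rinv_1. apply Rinv_le_contravar; lra. }
    replace (mean t) with (cyl t 0 + (mean t - cyl t 0)) by ring. rewrite exp_plus.
    replace (C * exp C' / t) with (C / t * exp C') by (field; lra).
    apply Rmult_le_compat; [left; apply exp_pos | left; apply exp_pos | exact H |].
    apply exp_le_compat. lra.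
  - apply is_lim_const.
  - apply is_lim_const_div.
Qed.

(** The second derivative of the mean is the mean of k e^(2U), where k tends to k0 and the
    difference of U and its mean tends to 0. *)
Lemma mean_tt_asymptotics : is_lim (fun t => mean_tt t * exp (- (2 * mean t))) p_infty k0.
Proof.
  assert (P := PI_RGT_0). apply is_lim_intro. intros eps Heps.
  assert (Hcont : exists eta, 0 < eta /\ forall w, Rabs w < eta ->
     Rabs (exp (2 * w) - 1) < Rmin 1 (eps / (4 * k0))).
  { assert (Hc : continuity_pt (fun w => exp (2 * w)) 0).
    { apply (is_derive_continuity_pt _ _ (2 * exp (2 * 0))). auto_derive; [exact I | ring]. }
    assert (He : 0 < Rmin 1 (eps / (4 * k0))).
    { apply Rmin_pos; [lra | apply Rdiv_lt_0_compat; lra]. }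
    destruct (proj1 (continuity_pt_locally _ _) Hc (mkposreal _ He)) as [d Hd]. exists d. split; [apply cond_pos|].
    intros w Hw. specialize (Hd w). simpl in Hd. rewrite Rmult_0_r, exp_0 in Hd. apply Hd.
    unfold ball; simpl; unfold AbsRing_ball, abs, minus, plus, opp; simpl.
    replace (w + - 0) with w by ring. exact Hw. }
  destruct Hcont as [eta [Heta Hexp]].
  destruct (Hlim (eps / 8) ltac:(lra)) as [d [Hd Hkd]].
  assert (Hsmall : eventually_inf (fun t => Rabs (C' / t - 0) < eta)).
  { apply is_lim_eventually; [apply is_lim_const_div | exact Heta]. }
  assert (Hev : eventually_inf (fun t => - ln d < t)) by (exists (- ln d); auto).
  eapply filter_imp; [|exact (filter_and _ _ Hsmall (filter_and _ _ Hev (eventually_ge (2 * T))))].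
  intros t [H1 [H2 H3]].
  rewrite Rminus_0_r, Rabs_right in H1 by (apply Rle_ge, Rlt_le, Rdiv_lt_0_compat; lra).
  assert (Hpt : forall phi, Rabs (source t phi * exp (- (2 * mean t)) - k0) <= eps / 2).
  { intros phi. rewrite cyl_equation by lra.
    set (kk := pol k 0 0 (exp (- t)) phi). set (w := cyl t phi - mean t).
    assert (Dp := circles_punctured (exp (- t)) phi (exp_radius t ltac:(lra))).
    assert (Hkk : Rabs (kk - k0) < eps / 8).
    { apply Hkd; [exact Dp|]. rewrite sqr_circle.
      assert (exp (- t) < d) by (rewrite <- (exp_ln d) by exact Hd; apply exp_increasing; lra).
      assert (X := exp_pos (- t)). nra. }
    assert (Hw : Rabs (exp (2 * w) - 1) < Rmin 1 (eps / (4 * k0))).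
    { apply Hexp. eapply Rle_lt_trans; [apply Hosc; lra | exact H1]. }
    destruct (Rmin_bounds 1 (eps / (4 * k0))) as [M1 M2].
    assert (E : kk * exp (2 * cyl t phi) * exp (- (2 * mean t)) - k0 =
       (kk - k0) * exp (2 * w) + k0 * (exp (2 * w) - 1)).
    { replace (2 * w) with (2 * cyl t phi + - (2 * mean t)) by (unfold w; ring).
      rewrite exp_plus. ring. }
    rewrite E. eapply Rle_trans; [apply Rabs_triang|]. rewrite !Rabs_mult.
    assert (X := exp_pos (2 * w)). rewrite (Rabs_right (exp (2 * w))), (Rabs_right k0) by lra.
    assert (Hw' := Hw). apply Rabs_def2 in Hw'.
    assert (Rabs (kk - k0) * exp (2 * w) <= eps / 8 * 2).
    { apply Rmult_le_compat; [apply Rabs_pos | lra | lra | lra]. }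
    assert (k0 * Rabs (exp (2 * w) - 1) <= k0 * (eps / (4 * k0))).
    { apply Rmult_le_compat_l; lra. }
    replace (k0 * (eps / (4 * k0))) with (eps / 4) in * by (field; lra). lra. }
  assert (Cs : forall x, continuous (source t) x) by (intros x; apply continuous_source; lra).
  assert (E : mean_tt t * exp (- (2 * mean t)) - k0 =
    / (2 * PI) * RInt (fun phi => exp (- (2 * mean t)) * source t phi + - k0) 0 (2 * PI)).
  { rewrite RInt_plus_cont, RInt_scal_cont, RInt_period_const.
    - unfold mean_tt. eq_R. field. lra.
    - exact Cs.
    - intros x. cont1.
    - intros x. apply continuous_const. }
  rewrite E.
  assert (HB : Rabs (RInt (fun phi => exp (- (2 * mean t)) * source t phi + - k0) 0 (2 * PI))
     <= RInt (fun _ => eps / 2) 0 (2 * PI)).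
  { apply RInt_bound.
    - intros x. cont1.
    - intros x. cont1.
    - intros x _. rewrite (Rmult_comm (exp _)). apply Hpt. }
  rewrite RInt_period_const in HB.
  assert (Hi : 0 < / (2 * PI)) by (apply Rinv_0_lt_compat; lra).
  rewrite Rabs_mult, (Rabs_right (/ (2 * PI))) by lra.
  apply Rmult_le_compat_l with (r := / (2 * PI)) in HB; [|lra].
  replace (/ (2 * PI) * (2 * PI * (eps / 2))) with (eps / 2) in HB by (field; lra).
  lra.
Qed.

Lemma scaled_mean_limit_0 : is_lim mean_t p_infty 0 ->
  is_lim (fun t => t * exp (mean t)) p_infty (/ sqrt k0).
Proof.
  intros H0. apply (exp_ode_asymptotics mean mean_t mean_tt T).
  - apply sqrt_lt_R0, Hk0.
  - intros t Ht. apply is_derive_mean. lra.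
  - intros t Ht. apply is_derive_mean_t. lra.
  - exact mean_t_nonpos.
  - exact H0.
  - exact exp_mean_limit.
  - rewrite pow2_sqrt by lra. exact mean_tt_asymptotics.
Qed.

Lemma scaled_mean_limit_pos gamma : 0 < gamma -> (forall t, T <= t -> mean_t t <= - gamma) ->
  is_lim (fun t => t * exp (mean t)) p_infty 0.
Proof.
  intros Hg Hle.
  set (A := exp (mean T + gamma * T)). assert (HA : 0 < A) by apply exp_pos.
  apply (is_lim_le_le_loc (fun _ => 0) (fun t => (4 * A / gamma ^ 2) / t)).
  - exists T. intros t Ht.
    split; [apply Rmult_le_pos; [lra | left; apply exp_pos]|].
    assert (I := increment_le mean (fun s => - gamma * s) mean_t (fun _ => - gamma) T t ltac:(lra)
      (fun x Hx => is_derive_mean x ltac:(lra)) (fun x _ => is_derive_linear _ x) (fun x Hx => Hle x ltac:(lra))).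
    cbv beta in I.
    assert (H1 : exp (mean t) <= A * exp (- (gamma * t))).
    { unfold A. rewrite <- exp_plus. apply exp_le_compat. lra. }
    assert (H2 := exp_neg_le (gamma * t) ltac:(nra)).
    apply Rle_trans with (t * (A * (4 / (gamma * t) ^ 2))).
    + apply Rmult_le_compat_l; [lra|]. eapply Rle_trans; [exact H1|]. apply Rmult_le_compat_l; lra.
    + right. field. lra.
  - apply is_lim_const.
  - apply is_lim_const_div.
Qed.

End Far.

Theorem cylinder_asymptotics : exists gamma T C, 0 <= gamma /\ - ln R0 < T /\ 0 < T /\ 0 < C /\
  (forall t phi, T <= t -> Rabs (cyl t phi - mean t) <= C / t /\ exp (cyl t phi) <= C / t) /\
  is_lim mean_t p_infty (- gamma) /\
  (gamma = 0 -> is_lim (fun t => t * exp (mean t)) p_infty (/ sqrt k0)) /\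
  (0 < gamma -> is_lim (fun t => t * exp (mean t)) p_infty 0).
Proof.
  destruct far_bounds as [T [C [HT2 [HT0 [HC Hfar]]]]].
  destruct (oscillation T C HT2 HT0 HC Hfar) as [C' [HC' Hosc]].
  destruct (mean_t_limit T C HT0 Hfar) as [gamma [Hg [Hl Hle]]].
  exists gamma, (2 * T), (C + C').
  split; [exact Hg|]. split; [lra|]. split; [lra|]. split; [lra|]. split; [|split; [exact Hl | split]].
  - intros t phi Ht. assert (Hi : 0 < / t) by (apply Rinv_0_lt_compat; lra). split.
    + eapply Rle_trans; [apply Hosc, Ht|]. apply Rmult_le_compat_r; lra.
    + destruct (Hfar t phi ltac:(lra)) as [H _]. eapply Rle_trans; [exact H|].
      apply Rmult_le_compat_r; lra.
  - intros E. rewrite E, Ropp_0 in Hl.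
    eapply scaled_mean_limit_0; eassumption.
  - intros Hpos. eapply scaled_mean_limit_pos; eassumption.
Qed.

End Cylinder.

(** * Interior estimates for first and second derivatives *)

Lemma Rpower_le_base x y b : 0 < x <= y -> 0 <= b -> Rpower x b <= Rpower y b.
Proof. intros Hx Hb. apply Rle_Rpower_l; lra. Qed.

(** With b = a / r^n the mode equation reads (r^(2n+1) b')' = r^(n+1) f, so that b' is
    controlled by f all the way down to r = 0. *)
Lemma mode_quotient (a a' a'' f : R -> R) (j : nat) (beta N R1 : R) :
  0 < R1 -> 0 < beta -> 0 <= beta + INR j - 1 -> 0 <= N ->
  (forall r, 0 <= r <= R1 -> is_derive a r (a' r)) ->
  (forall r, 0 <= r <= R1 -> is_derive a' r (a'' r)) ->
  (forall r, 0 <= r <= R1 -> r ^ 2 * a'' r + r * a' r - INR (S j) ^ 2 * a r = r ^ 2 * f r) ->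
  (forall r, 0 < r <= R1 -> Rabs (f r) <= N * Rpower r (beta + INR j - 1)) ->
  forall h, 0 < h <= R1 ->
  Rabs (a R1 / R1 ^ S j - a h / h ^ S j) <= N / beta * Rpower R1 beta.
Proof.
  intros HR Hb Hbj HN Ha Ha' Heq Hf h Hh.
  set (n := INR (S j)) in *.
  set (H := fun r => r ^ S (S j) * a' r - n * r ^ S j * a r).
  assert (DH : forall r, 0 <= r <= R1 -> is_derive H r (r ^ S (S j) * f r)).
  { intros r Hr.
    replace (r ^ S (S j) * f r) with (r ^ j * (r ^ 2 * f r)) by (simpl; ring).
    rewrite <- Heq by exact Hr. unfold H.
    auto_derive.
    - split; [eexists; apply Ha', Hr | split; [eexists; apply Ha, Hr | exact I]].
    - change (Derive (fun x => a' x) r) with (Derive a' r).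
      change (Derive (fun x => a x) r) with (Derive a r).
      rewrite (is_derive_unique _ _ _ (Ha r Hr)), (is_derive_unique _ _ _ (Ha' r Hr)).
      change (match j with O => 1 | S _ => INR j + 1 end) with n.
      assert (E : INR (S j) = n) by reflexivity.
      replace (n + 1) with (INR (S (S j))) by (rewrite S_INR; reflexivity).
      rewrite (S_INR (S j)), E. simpl. ring. }
  assert (H0 : H 0 = 0) by (unfold H; simpl; ring).
  assert (HH : forall r, 0 < r <= R1 -> Rabs (H r) <= N * Rpower r (beta + INR j - 1) * r ^ S (S (S j))).
  { intros r Hr.
    assert (B := increment_bound H (fun r => r ^ S (S j) * f r) 0 r
       (N * Rpower r (beta + INR j - 1) * r ^ S (S j)) ltac:(lra) (fun x Hx => DH x ltac:(lra))).
    rewrite H0, !Rminus_0_r in B. eapply Rle_trans; [apply B|].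
    - intros x Hx. rewrite Rabs_mult, <- RPow_abs, (Rabs_right x) by lra.
      destruct (Req_dec x 0) as [->|Hx0].
      + simpl. rewrite !Rmult_0_l.
        apply Rmult_le_pos; [apply Rmult_le_pos; [exact HN | left; apply exp_pos]|].
        apply Rmult_le_pos; [lra | apply Rmult_le_pos; [lra | apply pow_le; lra]].
      + rewrite Rmult_comm. apply Rmult_le_compat; [apply Rabs_pos | apply pow_le; lra | |].
        * eapply Rle_trans; [apply Hf; lra|]. apply Rmult_le_compat_l; [exact HN|].
          apply Rpower_le_base; lra.
        * apply pow_incr. lra.
    - right. simpl. ring. }
  set (b := fun r => a r / r ^ S j).
  assert (Db : forall r, 0 < r <= R1 -> is_derive b r (H r / r ^ (2 * S j + 1))).
  { intros r Hr. assert (Hp : 0 < r ^ j) by (apply pow_lt; lra).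
    unfold b, H. auto_derive.
    - split; [eexists; apply Ha; lra | split; [|exact I]].
      apply Rgt_not_eq. apply (pow_lt r (S j)). lra.
    - change (Derive (fun x => a x) r) with (Derive a r).
      rewrite (is_derive_unique _ _ _ (Ha r ltac:(lra))).
      change (match j with O => 1 | S _ => INR j + 1 end) with n.
      replace (r ^ (2 * S j + 1)) with (r * r * r * (r ^ j) * (r ^ j)).
      2: { replace (2 * S j + 1)%nat with (S (S (S (j + j)))) by lia.
           rewrite <- !tech_pow_Rmult, pow_add. ring. }
      rewrite <- !tech_pow_Rmult. field. lra. }
  assert (Dpow : forall c r, 0 < r -> is_derive (fun r => c * Rpower r beta) r
             (c * (beta * Rpower r (beta - 1)))).
  { intros c r Hr. apply is_derive_scal. apply is_derive_Reals, derivable_pt_lim_power, Hr. }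
  assert (Hbound : forall r, 0 < r <= R1 ->
     Rabs (H r / r ^ (2 * S j + 1)) <= N / beta * (beta * Rpower r (beta - 1))).
  { intros r Hr. unfold Rdiv at 1. rewrite Rabs_mult.
    assert (Hp : 0 < r ^ (2 * S j + 1)) by (apply pow_lt; lra).
    rewrite (Rabs_right (/ _)) by (left; apply Rinv_0_lt_compat, Hp).
    apply Rmult_le_reg_r with (r ^ (2 * S j + 1)); [exact Hp|].
    rewrite Rmult_assoc, Rinv_l, Rmult_1_r by lra.
    eapply Rle_trans; [apply HH, Hr|].
    right.
    replace (N / beta * (beta * Rpower r (beta - 1))) with (N * Rpower r (beta - 1)) by (field; lra).
    replace (beta + INR j - 1) with (beta - 1 + INR j) by ring.
    rewrite Rpower_plus, Rpower_pow by lra.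
    replace (r ^ (2 * S j + 1)) with (r ^ j * r ^ S (S (S j))).
    - ring.
    - rewrite <- pow_add. f_equal. lia. }
  change (Rabs (b R1 - b h) <= N / beta * Rpower R1 beta).
  assert (U1 := increment_le b (fun r => N / beta * Rpower r beta) _ _ h R1 ltac:(lra)
    (fun r Hr => Db r ltac:(lra)) (fun r Hr => Dpow (N / beta) r ltac:(lra))
    (fun r Hr => Rle_trans _ _ _ (Rle_abs _) (Hbound r ltac:(lra)))).
  assert (U2 := increment_le (fun r => - (N / beta) * Rpower r beta) b _ _ h R1 ltac:(lra)
    (fun r Hr => Dpow (- (N / beta)) r ltac:(lra)) (fun r Hr => Db r ltac:(lra))).
  assert (U3 : forall x, h <= x <= R1 ->
     - (N / beta) * (beta * Rpower x (beta - 1)) <= H x / x ^ (2 * S j + 1)).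
  { intros x Hx. specialize (Hbound x ltac:(lra)). apply Rabs_le_between in Hbound. lra. }
  specialize (U2 U3). cbv beta in U1, U2.
  assert (Hnn : 0 <= N / beta * Rpower h beta).
  { apply Rmult_le_pos; [apply Rdiv_le_0_compat; lra | left; apply exp_pos]. }
  apply Rabs_le. lra.
Qed.

Lemma quotient_limit_1 (a a' : R -> R) (eta : R) : 0 < eta -> is_derive a 0 (a' 0) -> a 0 = 0 ->
  exists d, 0 < d /\ forall h, 0 < h < d -> Rabs (a h / h ^ 1 - a' 0) <= eta.
Proof.
  intros He Ha H0. apply is_derive_Reals in Ha. destruct (Ha eta He) as [d Hd].
  exists d. split; [apply cond_pos|]. intros h Hh.
  specialize (Hd h ltac:(lra) ltac:(rewrite Rabs_right; lra)).
  rewrite Rplus_0_l, H0, Rminus_0_r in Hd. rewrite pow_1. left. exact Hd.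
Qed.

Lemma quotient_limit_2 (a a' a'' : R -> R) (eta R1 : R) : 0 < eta -> 0 < R1 ->
  (forall r, 0 <= r <= R1 -> is_derive a r (a' r)) ->
  is_derive a' 0 (a'' 0) -> a 0 = 0 -> a' 0 = 0 ->
  exists d, 0 < d /\ forall h, 0 < h < d -> Rabs (a h / h ^ 2 - a'' 0 / 2) <= eta.
Proof.
  intros He HR Ha Ha' H0 H0'. apply is_derive_Reals in Ha'. destruct (Ha' eta He) as [d Hd].
  assert (Hd0 := cond_pos d).
  exists (Rmin d R1). split; [apply Rmin_pos; lra|]. intros h Hh.
  destruct (Rmin_bounds d R1) as [A1 A2].
  assert (B := increment_bound (fun r => a r - a'' 0 / 2 * r ^ 2) (fun r => a' r - a'' 0 * r) 0 h
    (eta * h) ltac:(lra)).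
  assert (Hfin : Rabs (a h - a'' 0 / 2 * h ^ 2 - (a 0 - a'' 0 / 2 * 0 ^ 2)) <= eta * h * (h - 0)).
  { apply B.
    - intros x Hx. apply (is_derive_minus (V := R_NormedModule)); [apply Ha; lra|].
      auto_derive; [exact I | field].
    - intros x Hx. destruct (Req_dec x 0) as [->|Hx0].
      + rewrite H0', Rmult_0_r, Rminus_0_r, Rabs_R0. nra.
      + specialize (Hd x Hx0 ltac:(rewrite Rabs_right; lra)).
        rewrite Rplus_0_l, H0', Rminus_0_r in Hd.
        replace (a' x - a'' 0 * x) with ((a' x / x - a'' 0) * x) by (field; exact Hx0).
        rewrite Rabs_mult, (Rabs_right x) by lra.
        apply Rmult_le_compat; [apply Rabs_pos | lra | lra | lra]. }
  replace (a h / h ^ 2 - a'' 0 / 2)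
    with ((a h - a'' 0 / 2 * h ^ 2 - (a 0 - a'' 0 / 2 * 0 ^ 2)) * / h ^ 2) by (rewrite H0; field; lra).
  assert (Hp : 0 < h ^ 2) by (apply pow_lt; lra).
  rewrite Rabs_mult, (Rabs_right (/ _)) by (left; apply Rinv_0_lt_compat, Hp).
  apply Rmult_le_reg_r with (h ^ 2); [exact Hp|]. rewrite Rmult_assoc, Rinv_l, Rmult_1_r by lra.
  eapply Rle_trans; [exact Hfin|]. right. ring.
Qed.

Lemma pol_0 f p q phi : pol f p q 0 phi = f p q.
Proof. unfold pol. rewrite !Rmult_0_l, !Rplus_0_r. reflexivity. Qed.

Lemma RInt_gradient_1 (A B th : R) :
  RInt (fun phi => (A * cos phi + B * sin phi) * cos (INR 1 * (phi - th))) 0 (2 * PI) =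
  PI * (A * cos th + B * sin th).
Proof.
  apply is_RInt_unique.
  set (F := fun phi => A * cos th * ((phi + sin phi * cos phi) / 2)
     + (A * sin th + B * cos th) * (sin phi ^ 2 / 2) + B * sin th * ((phi - sin phi * cos phi) / 2)).
  replace (PI * (A * cos th + B * sin th)) with (minus (F (2 * PI)) (F 0)).
  - apply (is_RInt_derive (V := R_CompleteNormedModule) F).
    + intros x _. unfold F. auto_derive; [exact I|].
      replace (INR 1 * (x - th)) with (x - th) by (simpl; ring). rewrite cos_minus.
      assert (E := sin2_cos2 x). unfold Rsqr in E.
      transitivity (A * cos th * ((sin x * sin x + cos x * cos x + (cos x * cos x - sin x * sin x)) / 2)
        + (A * sin th + B * cos th) * (sin x * cos x)
        + B * sin th * ((sin x * sin x + cos x * cos x - (cos x * cos x - sin x * sin x)) / 2)).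
      * rewrite E. field.
      * field.
    + intros x _. apply continuous_mult_R; [|apply continuous_weight].
      apply continuous_plus_R; apply continuous_scal_R, continuity_pt_filterlim;
        [apply continuity_cos | apply continuity_sin].
  - unfold minus, plus, opp; simpl. unfold F. rewrite cos_2PI, sin_2PI, cos_0, sin_0. field.
Qed.

Lemma RInt_hessian_2 (A B E th : R) :
  RInt (fun phi => ((A * cos phi + B * sin phi) * cos phi + E * sin phi * sin phi)
     * cos (INR 2 * (phi - th))) 0 (2 * PI) =
  PI / 2 * ((A - E) * cos (2 * th) + B * sin (2 * th)).
Proof.
  apply is_RInt_unique.
  set (C := cos (2 * th)). set (S := sin (2 * th)).
  set (F := fun phi => (A + E) / 2 * (sin (2 * phi) / 2 * C - cos (2 * phi) / 2 * S)
     + ((A - E) / 2 * C + B / 2 * S) * (phi / 2)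
     + ((A - E) / 2 * C - B / 2 * S) * (sin (2 * phi) * cos (2 * phi) / 4)
     + ((A - E) / 2 * S + B / 2 * C) * (sin (2 * phi) ^ 2 / 4)).
  replace (PI / 2 * ((A - E) * C + B * S)) with (minus (F (2 * PI)) (F 0)).
  - apply (is_RInt_derive (V := R_CompleteNormedModule) F).
    + intros x _. unfold F. auto_derive; [exact I|].
      replace (INR 2 * (x - th)) with (2 * x - 2 * th) by (simpl; ring).
      rewrite cos_minus. fold C S.
      assert (E1 := sin2_cos2 x). unfold Rsqr in E1.
      assert (E2 := sin2_cos2 (2 * x)). unfold Rsqr in E2.
      rewrite cos_2a in *. rewrite sin_2a in *.
      set (c := cos x) in *. set (s := sin x) in *.
      (* both sides are made homogeneous of degree 4 in (cos x, sin x) *)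
      assert (H1 : (A + E) / 2 = (A + E) / 2 * (s * s + c * c)) by (rewrite E1; ring).
      assert (H2 : ((A - E) / 2 * C + B / 2 * S) * (1 / 2) =
                   ((A - E) / 2 * C + B / 2 * S) * ((s * s + c * c) * (s * s + c * c) / 2))
        by (rewrite E1; field).
      match goal with |- ?l = ?r => transitivity
        ((A + E) / 2 * (s * s + c * c) * ((c * c - s * s) * C + 2 * s * c * S)
         + ((A - E) / 2 * C + B / 2 * S) * ((s * s + c * c) * (s * s + c * c) / 2)
         + ((A - E) / 2 * C - B / 2 * S) * (((c * c - s * s) ^ 2 - (2 * s * c) ^ 2) / 2)
         + ((A - E) / 2 * S + B / 2 * C) * (2 * s * c * (c * c - s * s))) end.
      * rewrite <- H1, <- H2. unfold Rdiv. field.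
      * field.
    + intros x _. apply continuous_mult_R; [|apply continuous_weight].
      assert (Cc : continuous cos x) by apply continuity_pt_filterlim, continuity_cos.
      assert (Cs : continuous sin x) by apply continuity_pt_filterlim, continuity_sin.
      apply continuous_plus_R; apply continuous_mult_R; try assumption.
      * apply continuous_plus_R; apply continuous_scal_R; assumption.
      * apply continuous_scal_R, Cs.
  - unfold minus, plus, opp; simpl. unfold F.
    replace (2 * (2 * PI)) with (0 + 2 * INR 2 * PI) by (simpl; ring).
    rewrite cos_period, sin_period, Rmult_0_r, cos_0, sin_0. field.
Qed.

Section Interior.
Context (D : R -> R -> Prop) (f fx fy fxx fxy fyx fyy : R -> R -> R).
Context (HD : open_2d D) (Hf : C2_on D f fx fy fxx fxy fyx fyy).
Context (p q R1 R2 : R) (HR : 0 < R1 < R2) (Hcirc : on_circles D p q (- R2) R2).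
Local Notation lap := (fun x y => fxx x y + fyy x y).
Context (B : R) (HB : forall r phi, 0 <= r <= R1 -> Rabs (pol f p q r phi) <= B).

Lemma continuous_pol g r phi : - R2 < r < R2 -> (forall x y, D x y -> continuity_2d_pt g x y) ->
  continuous (pol g p q r) phi.
Proof.
  intros Hr Hg. apply (continuity_2d_slice (pol g p q)), pol_continuity, Hg, Hcirc, Hr.
Qed.

Lemma continuous_lap x y : D x y -> continuity_2d_pt lap x y.
Proof.
  intros Hd. apply continuity_2d_pt_plus; apply (C2_cont2 D f fx fy fxx fxy fyx fyy Hf _ _ Hd).
Qed.

Lemma mode_bound g n th r K : - R2 < r < R2 -> (forall x y, D x y -> continuity_2d_pt g x y) ->
  (forall phi, Rabs (pol g p q r phi) <= K) -> Rabs (mode g p q n th r) <= 2 * PI * K.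
Proof.
  intros Hr Hg HK. rewrite <- RInt_period_const. apply RInt_bound.
  - intros x. apply continuous_mult_R; [apply continuous_pol; assumption | apply continuous_weight].
  - intros x. apply continuous_const.
  - intros x _. assert (Hc := COS_bound (INR n * (x - th))).
    rewrite Rabs_mult, <- (Rmult_1_r K).
    apply Rmult_le_compat; [apply Rabs_pos | apply Rabs_pos | apply HK | apply Rabs_le; lra].
Qed.

Lemma derive_modes n th r : - R2 < r < R2 ->
  is_derive (mode f p q n th) r (mode_r fx fy p q n th r) /\
  is_derive (mode_r fx fy p q n th) r (mode_rr fxx fxy fyx fyy p q n th r).
Proof.
  intros Hr. split.
  - exact (is_derive_mode D f fx fy fxx fxy fyx fyy HD Hf p q (- R2) R2 Hcirc n th r Hr).
  - exact (is_derive_mode_r D f fx fy fxx fxy fyx fyy HD Hf p q (- R2) R2 Hcirc n th r Hr).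
Qed.

Lemma mode_at_0 n th : (0 < n)%nat -> mode f p q n th 0 = 0.
Proof.
  intros Hn. unfold mode. rewrite (RInt_ext _ (fun phi => f p q * cos (INR n * (phi - th)))).
  - rewrite RInt_scal_cont, RInt_weight by (first [lia | intros x; apply continuous_weight]). ring_R.
  - intros x _. rewrite pol_0. reflexivity.
Qed.

(** The limit L will be a derivative of f at the centre. The quotient of the mode by r^n varies
    little down to r = 0, and at r = R1 it is controlled by the size of f. *)
Lemma mode_limit_bound j th beta N L : 0 < beta -> 0 <= beta + INR j - 1 -> 0 <= N ->
  (forall r, 0 < r <= R1 -> Rabs (mode lap p q (S j) th r) <= N * Rpower r (beta + INR j - 1)) ->
  (forall eta, 0 < eta -> exists d, 0 < d /\ forall h, 0 < h < d ->
     Rabs (mode f p q (S j) th h / h ^ S j - L) <= eta) ->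
  Rabs L <= 2 * PI * B / R1 ^ S j + N / beta * Rpower R1 beta.
Proof.
  intros Hb Hbj HN Hlap Hlim. set (a := mode f p q (S j) th) in *.
  assert (HaR : Rabs (a R1 / R1 ^ S j) <= 2 * PI * B / R1 ^ S j).
  { assert (Hp : 0 < / R1 ^ S j) by (apply Rinv_0_lt_compat, pow_lt; lra).
    unfold Rdiv. rewrite Rabs_mult, (Rabs_right (/ R1 ^ S j)) by lra.
    apply Rmult_le_compat_r; [lra|].
    apply mode_bound; [lra | | intros phi; apply HB; lra].
    intros x y Hd. apply (C2_cont1 D f fx fy fxx fxy fyx fyy HD Hf _ _ Hd). }
  apply le_epsilon. intros eps Heps. destruct (Hlim eps Heps) as [d [Hd Hl]].
  set (h := Rmin (d / 2) R1).
  destruct (Rmin_bounds (d / 2) R1) as [Hh1 Hh2].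
  assert (Hh0 : 0 < h) by (apply Rmin_pos; lra). fold h in Hh1, Hh2.
  assert (Q : Rabs (a R1 / R1 ^ S j - a h / h ^ S j) <= N / beta * Rpower R1 beta).
  { apply (mode_quotient a (mode_r fx fy p q (S j) th) (mode_rr fxx fxy fyx fyy p q (S j) th)
      (mode lap p q (S j) th) j); try assumption; try lra.
    - intros r Hr. exact (proj1 (derive_modes (S j) th r ltac:(lra))).
    - intros r Hr. exact (proj2 (derive_modes (S j) th r ltac:(lra))).
    - intros r Hr.
      exact (mode_equation D f fx fy fxx fxy fyx fyy HD Hf p q (- R2) R2 Hcirc (S j) th r ltac:(lra)). }
  specialize (Hl h ltac:(lra)).
  replace L with (a R1 / R1 ^ S j + - (a R1 / R1 ^ S j - a h / h ^ S j) + - (a h / h ^ S j - L)) by ring.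
  eapply Rle_trans; [apply Rabs_triang|]. rewrite Rabs_Ropp.
  eapply Rle_trans; [apply Rplus_le_compat_r, Rabs_triang|]. rewrite Rabs_Ropp. lra.
Qed.

(** Divided by the radius, the first mode tends to the gradient at the centre as the radius
    shrinks. *)
Lemma gradient_estimate F th : 0 <= F ->
  (forall r phi, 0 <= r <= R1 -> Rabs (pol lap p q r phi) <= F) ->
  Rabs (fx p q * cos th + fy p q * sin th) <= 2 * B / R1 + 2 * F * R1.
Proof.
  intros HF Hlap. assert (P := PI_RGT_0).
  assert (H : Rabs (PI * (fx p q * cos th + fy p q * sin th)) <=
     2 * PI * B / R1 ^ 1 + 2 * PI * F / 1 * Rpower R1 1).
  { apply (mode_limit_bound 0 th); [lra | simpl; lra | nra | |].
    - intros r Hr. simpl INR. replace (1 + 0 - 1) with 0 by ring. rewrite Rpower_O, Rmult_1_r by lra.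
      apply mode_bound; [lra | exact continuous_lap | intros phi; apply Hlap; lra].
    - intros eta Heta.
      replace (PI * (fx p q * cos th + fy p q * sin th)) with (mode_r fx fy p q 1 th 0).
      + apply (quotient_limit_1 (mode f p q 1 th) (mode_r fx fy p q 1 th)); [exact Heta | exact (proj1 (derive_modes 1 th 0 ltac:(lra))) | apply mode_at_0; lia].
      + rewrite <- RInt_gradient_1. unfold mode_r. apply RInt_ext. intros x _.
        unfold pol_r. rewrite !pol_0. reflexivity. }
  rewrite Rabs_mult, (Rabs_right PI), Rpower_1, pow_1 in H by lra.
  apply Rmult_le_reg_l with PI; [exact P|].
  eapply Rle_trans; [exact H|]. right. field. lra.
Qed.

(** Divided by the square of the radius, the second mode tends to the trace-free part of the
    Hessian. Subtracting from the Laplacian its value at the centre does not change this mode,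
    so that a Hölder bound at the centre makes the differential equation integrable at 0. *)
Lemma hessian_estimate N beta th : 0 <= N -> 0 < beta ->
  (forall r phi, 0 < r <= R1 -> Rabs (pol lap p q r phi - lap p q) <= N * Rpower r beta) ->
  Rabs ((fxx p q - fyy p q) * cos (2 * th) + (fxy p q + fyx p q) * sin (2 * th))
    <= 8 * B / R1 ^ 2 + 8 * N / beta * Rpower R1 beta.
Proof.
  intros HN Hbeta Hlap. assert (P := PI_RGT_0).
  assert (Hr0 : mode_r fx fy p q 2 th 0 = 0).
  { unfold mode_r.
    rewrite (RInt_ext _ (fun phi => / 2 * (fx p q * cos (phi - 2 * th) - fy p q * sin (phi - 2 * th)
        + (fx p q * cos (3 * phi - 2 * th) + fy p q * sin (3 * phi - 2 * th))))).
    2: { intros x _. unfold pol_r. rewrite !pol_0.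
         replace (INR 2 * (x - th)) with (2 * x - 2 * th) by (simpl; ring).
         set (y := 2 * x - 2 * th).
         replace (x - 2 * th) with (y - x) by (unfold y; ring).
         replace (3 * x - 2 * th) with (y + x) by (unfold y; ring).
         rewrite cos_minus, cos_plus, sin_minus, sin_plus.
         eq_R. field. }
    apply is_RInt_unique.
    set (G := fun phi => / 2 * (fx p q * sin (phi - 2 * th) + fy p q * cos (phi - 2 * th)
        + (fx p q * (sin (3 * phi - 2 * th) / 3) - fy p q * (cos (3 * phi - 2 * th) / 3)))).
    replace 0 with (minus (G (2 * PI)) (G 0)) at 2.
    - apply (is_RInt_derive (V := R_CompleteNormedModule) G).
      + intros x _. unfold G. auto_derive; [exact I|].
        unfold Rminus. field.
      + intros x _. apply continuity_pt_filterlim.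
        eapply is_derive_continuity_pt. auto_derive; [exact I | reflexivity].
    - unfold minus, plus, opp; simpl. unfold G.
      replace (2 * PI - 2 * th) with ((0 - 2 * th) + 2 * INR 1 * PI) by (simpl; ring).
      replace (3 * (2 * PI) - 2 * th) with ((3 * 0 - 2 * th) + 2 * INR 3 * PI) by (simpl; ring).
      rewrite !cos_period, !sin_period. ring. }
  set (X := (fxx p q - fyy p q) * cos (2 * th) + (fxy p q + fyx p q) * sin (2 * th)).
  assert (Hrr : mode_rr fxx fxy fyx fyy p q 2 th 0 = PI / 2 * X).
  { unfold X. rewrite <- RInt_hessian_2. unfold mode_rr. apply RInt_ext. intros x _.
    unfold pol_rr, pol_r. rewrite !pol_0. ring_R. }
  assert (H : Rabs (PI / 2 * X / 2) <= 2 * PI * B / R1 ^ 2 + 2 * PI * N / beta * Rpower R1 beta).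
  { apply (mode_limit_bound 1 th); [lra | simpl; lra | nra | |].
    - intros r Hr. simpl INR. replace (beta + 1 - 1) with beta by ring.
      assert (E : mode lap p q 2 th r = mode (fun x y => lap x y - lap p q) p q 2 th r).
      { unfold mode.
        rewrite (RInt_ext (fun phi => pol (fun x y => lap x y - lap p q) p q r phi * cos (INR 2 * (phi - th)))
          (fun phi => pol lap p q r phi * cos (INR 2 * (phi - th)) + - lap p q * cos (INR 2 * (phi - th)))).
        - rewrite RInt_plus_cont, RInt_scal_cont, RInt_weight by
            first [lia | intros x; first [apply continuous_weight
              | apply continuous_scal_R, continuous_weight
              | apply continuous_mult_R; [apply continuous_pol; [lra | exact continuous_lap]
                                         | apply continuous_weight]]].
          rewrite Rmult_0_r, Rplus_0_r. reflexivity.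
        - intros x _. unfold pol. cbv beta. ring_R. }
      rewrite E, Rmult_assoc. apply mode_bound; [lra | |].
      + intros x y Hxy. apply continuity_2d_pt_minus; [apply continuous_lap, Hxy | apply continuity_2d_pt_const].
      + intros phi. apply (Hlap r phi Hr).
    - intros eta Heta. rewrite <- Hrr.
      apply (quotient_limit_2 (mode f p q 2 th) (mode_r fx fy p q 2 th) (mode_rr fxx fxy fyx fyy p q 2 th) eta R1); [exact Heta | lra | | | | exact Hr0].
      + intros r Hr. exact (proj1 (derive_modes 2 th r ltac:(lra))).
      + exact (proj2 (derive_modes 2 th 0 ltac:(lra))).
      + apply mode_at_0. lia. }
  replace (PI / 2 * X / 2) with (PI / 4 * X) in H by field.
  rewrite Rabs_mult, (Rabs_right (PI / 4)) in H by lra.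
  apply Rmult_le_reg_l with (PI / 4); [lra|].
  eapply Rle_trans; [exact H|]. right. field. lra.
Qed.

End Interior.

(** * Asymptotics of the derivatives at the puncture *)

Lemma C1_on_comb D f fx fy g gx gy a :
  C1_on D f fx fy -> C1_on D g gx gy ->
  C1_on D (fun x y => f x y + a * g x y) (fun x y => fx x y + a * gx x y)
    (fun x y => fy x y + a * gy x y).
Proof.
  intros Hf Hg x y Hd. destruct (Hf x y Hd) as [F1 [F2 [F3 F4]]].
  destruct (Hg x y Hd) as [G1 [G2 [G3 G4]]]. split; [|split; [|split]].
  - apply (is_derive_plus (V := R_NormedModule) (fun s => f s y)); [exact F1 | apply is_derive_scal, G1].
  - apply (is_derive_plus (V := R_NormedModule) (fun s => f x s)); [exact F2 | apply is_derive_scal, G2].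
  - apply continuity_2d_pt_plus; [exact F3|].
    apply continuity_2d_pt_mult; [apply continuity_2d_pt_const | exact G3].
  - apply continuity_2d_pt_plus; [exact F4|].
    apply continuity_2d_pt_mult; [apply continuity_2d_pt_const | exact G4].
Qed.

Lemma C1_on_shift D f fx fy c : C1_on D f fx fy -> C1_on D (fun x y => f x y - c) fx fy.
Proof.
  intros Hf x y Hd. destruct (Hf x y Hd) as [F1 [F2 [F3 F4]]].
  split; [|split; [|split]]; [| | exact F3 | exact F4].
  - rewrite <- (Rminus_0_r (fx x y)).
    apply (is_derive_minus (V := R_NormedModule) (fun s => f s y) (fun _ => c)); [exact F1 |].
    apply (is_derive_const (V := R_NormedModule)).
  - rewrite <- (Rminus_0_r (fy x y)).
    apply (is_derive_minus (V := R_NormedModule) (fun s => f x s) (fun _ => c)); [exact F2 |].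
    apply (is_derive_const (V := R_NormedModule)).
Qed.

(** log |z| in real coordinates. *)
Definition lg (x y : R) : R := / 2 * ln (x ^ 2 + y ^ 2).
Definition lgx (x y : R) : R := x / (x ^ 2 + y ^ 2).
Definition lgy (x y : R) : R := y / (x ^ 2 + y ^ 2).
Definition lgxx (x y : R) : R := (y ^ 2 - x ^ 2) / (x ^ 2 + y ^ 2) ^ 2.
Definition lgxy (x y : R) : R := - (2 * x * y) / (x ^ 2 + y ^ 2) ^ 2.
Definition lgyy (x y : R) : R := (x ^ 2 - y ^ 2) / (x ^ 2 + y ^ 2) ^ 2.

Lemma C2_lg R0 : C2_on (punctured R0) lg lgx lgy lgxx lgxy lgxy lgyy.
Proof.
  assert (Hs : forall x y, punctured R0 x y -> x ^ 2 + y ^ 2 <> 0) by (intros x y [H _]; lra).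
  assert (Cq : forall g : R -> R -> R, (forall x y, continuity_2d_pt g x y) ->
      forall n x y, punctured R0 x y -> continuity_2d_pt (fun x y => g x y / (x ^ 2 + y ^ 2) ^ n) x y).
  { intros g Hg n x y Hd. apply continuity_2d_pt_mult; [apply Hg|].
    apply continuity_2d_pt_inv; [|apply pow_nonzero, Hs, Hd].
    induction n as [|n IH]; simpl; cont2. }
  assert (Cq1 : forall g : R -> R -> R, (forall x y, continuity_2d_pt g x y) ->
      forall x y, punctured R0 x y -> continuity_2d_pt (fun x y => g x y / (x ^ 2 + y ^ 2)) x y).
  { intros g Hg x y Hd. apply (continuity_2d_pt_ext (fun x y => g x y / (x ^ 2 + y ^ 2) ^ 1)).
    - intros a b. rewrite pow_1. reflexivity.
    - apply Cq; assumption. }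
  split; [|split]; intros x y Hd; assert (Hn := Hs x y Hd); destruct Hd as [Hp Hlt];
    (split; [|split; [|split]]).
  - unfold lg, lgx. auto_derive; [exact Hp | field; exact Hn].
  - unfold lg, lgy. auto_derive; [exact Hp | field; exact Hn].
  - apply (Cq1 (fun x _ => x)); [intros; cont2 | split; assumption].
  - apply (Cq1 (fun _ y => y)); [intros; cont2 | split; assumption].
  - unfold lgx, lgxx. auto_derive; [exact Hn | field; exact Hn].
  - unfold lgx, lgxy. auto_derive; [exact Hn | field; exact Hn].
  - apply (Cq (fun x y => y ^ 2 - x ^ 2)); [intros; simpl; cont2 | split; assumption].
  - apply (Cq (fun x y => - (2 * x * y))); [intros; cont2 | split; assumption].
  - unfold lgy, lgxy. auto_derive; [exact Hn | field; exact Hn].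
  - unfold lgy, lgyy. auto_derive; [exact Hn | field; exact Hn].
  - apply (Cq (fun x y => - (2 * x * y))); [intros; cont2 | split; assumption].
  - apply (Cq (fun x y => x ^ 2 - y ^ 2)); [intros; simpl; cont2 | split; assumption].
Qed.

Definition radius (x y : R) : R := sqrt (x ^ 2 + y ^ 2).

(** One-sided, since F is always a nonnegative quantity. *)
Definition vanishing (R0 : R) (F : R -> R -> R) : Prop :=
  forall eps, 0 < eps -> exists d, 0 < d <= R0 /\
    forall x y, 0 < x ^ 2 + y ^ 2 -> radius x y < d -> F x y <= eps.

Lemma radius_sq x y : radius x y ^ 2 = x ^ 2 + y ^ 2.
Proof. unfold radius. apply pow2_sqrt. nra. Qed.

Lemma radius_pos x y : 0 < x ^ 2 + y ^ 2 -> 0 < radius x y.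
Proof. apply sqrt_lt_R0. Qed.

Lemma radius_pol p q r phi : 0 < p ^ 2 + q ^ 2 -> 0 <= r <= radius p q ->
  radius p q - r <= radius (p + r * cos phi) (q + r * sin phi) <= radius p q + r.
Proof.
  intros Hpq Hr. assert (E := radius_sq p q). assert (Hp := radius_pos p q Hpq).
  set (R := radius p q) in *.
  assert (E1 := sin2_cos2 phi). unfold Rsqr in E1.
  set (c := cos phi) in *. set (s := sin phi) in *.
  assert (Hcs : (p * c + q * s) ^ 2 <= R ^ 2).
  { rewrite E. assert (0 <= (p * s - q * c) ^ 2) by apply pow2_ge_0.
    assert (p ^ 2 + q ^ 2 = (p ^ 2 + q ^ 2) * (s * s + c * c)) by (rewrite E1; ring). nra. }
  assert (Hcs' : - R <= p * c + q * s <= R) by nra.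
  assert (E2 : (p + r * c) ^ 2 + (q + r * s) ^ 2 = R ^ 2 + 2 * r * (p * c + q * s) + r ^ 2).
  { rewrite E. replace (r ^ 2) with (r ^ 2 * (s * s + c * c)) by (rewrite E1; ring). ring. }
  unfold radius. rewrite E2. split.
  - rewrite <- (sqrt_pow2 (R - r)) by lra. apply sqrt_le_1_alt. nra.
  - rewrite <- (sqrt_pow2 (R + r)) by lra. apply sqrt_le_1_alt. nra.
Qed.

Section Puncture.
Context (R0 m M : R) (u ux uy uxx uxy uyx uyy k : R -> R -> R).
Context (HR0 : 0 < R0 <= 1) (Hm : 0 < m).
Local Notation D := (punctured R0).
Context (Hu : C2_on D u ux uy uxx uxy uyx uyy).
Context (Heq : forall x y, D x y -> uxx x y + uyy x y = k x y * exp (2 * u x y)).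
Context (Hk : forall x y, D x y -> m <= k x y <= M).
Context (gamma T C : R) (HT0 : - ln R0 < T) (HT : 0 < T) (HC : 0 < C).
Context (Hcyl : forall t phi, T <= t ->
  Rabs (cyl u t phi - mean u t) <= C / t /\ exp (cyl u t phi) <= C / t).
Context (Hslope : is_lim (mean_t ux uy) p_infty (- gamma)).

Lemma cartesian x y : 0 < x ^ 2 + y ^ 2 -> exists phi,
  forall f, f x y = pol f 0 0 (exp (- - ln (radius x y))) phi.
Proof.
  intros H. destruct (polar_exists x y H) as [phi [Hx Hy]]. exists phi. intros f.
  rewrite Ropp_involutive, exp_ln by (apply radius_pos, H).
  unfold pol. rewrite !Rplus_0_l. unfold radius. rewrite <- Hx, <- Hy. reflexivity.
Qed.

(** The disk of half the modulus about a point has bounded size in the coordinate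
    t = - log |z|. *)
Lemma half_disk_log r0 r : 0 < r0 -> r0 / 2 <= r <= r0 + r0 / 2 -> Rabs (- ln r - - ln r0) <= 1.
Proof.
  intros H0 Hr.
  assert (E2 : 2 <= exp 1) by (left; assert (X := exp_ineq1 1 ltac:(lra)); lra).
  assert (A : ln r <= ln r0 + 1).
  { rewrite <- (ln_exp 1), <- ln_mult by (first [lra | apply exp_pos]).
    apply ln_le; [lra|]. assert (r0 * 2 <= r0 * exp 1) by (apply Rmult_le_compat_l; lra). lra. }
  assert (B : ln r0 <= ln r + 1).
  { rewrite <- (ln_exp 1), <- ln_mult by (first [lra | apply exp_pos]).
    apply ln_le; [lra|]. assert (r * 2 <= r * exp 1) by (apply Rmult_le_compat_l; lra). lra. }
  apply Rabs_le. lra.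
Qed.

(** On a window of fixed length U is close to a linear function of slope - gamma: its mean is,
    because the slope converges, and U is close to its mean. *)
Lemma slope_small eps : 0 < eps -> exists T', T + 1 <= T' /\ forall t0 t phi, T' <= t0 ->
  Rabs (t - t0) <= 1 ->
  Rabs (cyl u t phi + gamma * t - (mean u t0 + gamma * t0)) <= eps.
Proof.
  intros Heps.
  destruct (is_lim_eventually _ _ (eps / 2) Hslope ltac:(lra)) as [T1 HT1].
  set (T' := Rmax (T + 1) (Rmax (T1 + 2) (2 * C / eps + 1))).
  destruct (Rmax_bounds (T + 1) (Rmax (T1 + 2) (2 * C / eps + 1))) as [A1 A2].
  destruct (Rmax_bounds (T1 + 2) (2 * C / eps + 1)) as [A3 A4].
  fold T' in A1, A2. exists T'. split; [exact A1|].
  intros t0 t phi Ht0 Ht. apply Rabs_le_between in Ht.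
  assert (H1 : Rabs (cyl u t phi - mean u t) <= eps / 2).
  { destruct (Hcyl t phi ltac:(lra)) as [H _]. eapply Rle_trans; [exact H|].
    assert (Hp : 0 < 2 * C / eps) by (apply Rdiv_lt_0_compat; lra).
    apply Rmult_le_reg_r with t; [lra|]. unfold Rdiv at 1. rewrite Rmult_assoc, Rinv_l, Rmult_1_r by lra.
    replace C with (eps / 2 * (2 * C / eps)) at 1 by (field; lra).
    apply Rmult_le_compat_l; lra. }
  assert (Dm : forall x, T' - 1 <= x -> is_derive (fun t => mean u t + gamma * t) x (mean_t ux uy x + gamma)).
  { intros x Hx. apply (is_derive_plus (V := R_NormedModule) (mean u)).
    - apply (is_derive_mean R0 u ux uy uxx uxy uyx uyy ltac:(lra) Hu). lra.
    - auto_derive; [exact I | ring]. }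
  assert (Bm : forall x, T' - 1 <= x -> Rabs (mean_t ux uy x + gamma) <= eps / 2).
  { intros x Hx. left. specialize (HT1 x ltac:(lra)).
    replace (mean_t ux uy x + gamma) with (mean_t ux uy x - - gamma) by ring. exact HT1. }
  assert (H2 : Rabs (mean u t + gamma * t - (mean u t0 + gamma * t0)) <= eps / 2).
  { destruct (Rle_or_lt t0 t) as [Hle|Hlt].
    - assert (B := increment_bound (fun t => mean u t + gamma * t) _ t0 t (eps / 2) Hle
        (fun x Hx => Dm x ltac:(lra)) (fun x Hx => Bm x ltac:(lra))). cbv beta in B. nra.
    - assert (B := increment_bound (fun t => mean u t + gamma * t) _ t t0 (eps / 2) ltac:(lra)
        (fun x Hx => Dm x ltac:(lra)) (fun x Hx => Bm x ltac:(lra))). cbv beta in B.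
      rewrite Rabs_minus_sym. nra. }
  replace (cyl u t phi + gamma * t - (mean u t0 + gamma * t0))
    with ((cyl u t phi - mean u t) + (mean u t + gamma * t - (mean u t0 + gamma * t0))) by ring.
  eapply Rle_trans; [apply Rabs_triang|]. lra.
Qed.

Lemma density_bound x y : 0 < x ^ 2 + y ^ 2 -> T <= - ln (radius x y) ->
  radius x y * exp (u x y) <= C / (- ln (radius x y)).
Proof.
  intros H Ht. destruct (cartesian x y H) as [phi E]. rewrite (E u).
  destruct (Hcyl _ phi Ht) as [_ B]. unfold cyl in B. unfold Rminus in B. rewrite exp_plus in B.
  replace (exp (- - ln (radius x y))) with (radius x y) in B at 2
    by (rewrite Ropp_involutive, exp_ln by (apply radius_pos, H); reflexivity).
  rewrite Rmult_comm. exact B.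
Qed.

Let alpha := 1 - gamma.

(** u without its logarithmic singularity; the constant c makes it small near a given point. *)
Definition regular_part (al c : R) (x y : R) : R := u x y + al * lg x y - c.

Lemma C2_regular_part c : C2_on D (regular_part alpha c)
  (fun x y => ux x y + alpha * lgx x y) (fun x y => uy x y + alpha * lgy x y)
  (fun x y => uxx x y + alpha * lgxx x y) (fun x y => uxy x y + alpha * lgxy x y)
  (fun x y => uyx x y + alpha * lgxy x y) (fun x y => uyy x y + alpha * lgyy x y).
Proof.
  destruct Hu as [H1 [H2 H3]]. destruct (C2_lg R0) as [L1 [L2 L3]].
  split; [|split].
  - apply C1_on_shift, C1_on_comb; assumption.
  - apply C1_on_comb; assumption.
  - apply C1_on_comb; assumption.
Qed.

(** All that is used of a point (p, q) near the puncture, on the disk of half its modulus; the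
    number om measures the regular part, normalized at the centre. *)
Definition near_data (p q om : R) : Prop :=
  exists t0, t0 = - ln (radius p q) /\ T + 1 <= t0 /\
  on_circles D p q (- (3 / 4 * radius p q)) (3 / 4 * radius p q) /\
  (forall r phi, 0 <= r <= radius p q / 2 ->
    0 < (p + r * cos phi) ^ 2 + (q + r * sin phi) ^ 2 /\
    radius p q / 2 <= radius (p + r * cos phi) (q + r * sin phi) /\
    Rabs (- ln (radius (p + r * cos phi) (q + r * sin phi)) - t0) <= 1) /\
  forall r phi, 0 <= r <= radius p q / 2 ->
    Rabs (pol (regular_part alpha (mean u t0 + gamma * t0)) p q r phi) <= om.

Lemma near_data_exists om : 0 < om -> forall T1, exists d, 0 < d <= R0 /\
  forall p q, 0 < p ^ 2 + q ^ 2 -> radius p q < d -> near_data p q om /\ T1 <= - ln (radius p q).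
Proof.
  intros Hom T1. destruct (slope_small om Hom) as [T' [HT' Hs]].
  set (T2 := Rmax T' T1). destruct (Rmax_bounds T' T1) as [A1 A2]. fold T2 in A1, A2.
  set (d := Rmin (R0 / 2) (exp (- T2))).
  destruct (Rmin_bounds (R0 / 2) (exp (- T2))) as [B1 B2]. fold d in B1, B2.
  assert (Hd : 0 < d) by (apply Rmin_pos; [lra | apply exp_pos]).
  exists d. split; [lra|]. intros p q Hpq Hr.
  assert (Hp := radius_pos p q Hpq).
  assert (Ht0 : T2 <= - ln (radius p q)).
  { assert (ln (radius p q) < ln (exp (- T2))) by (apply ln_increasing; lra). rewrite ln_exp in H. lra. }
  assert (Hin : forall r phi, 0 <= r <= radius p q / 2 ->
    0 < (p + r * cos phi) ^ 2 + (q + r * sin phi) ^ 2 /\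
    radius p q / 2 <= radius (p + r * cos phi) (q + r * sin phi) /\
    Rabs (- ln (radius (p + r * cos phi) (q + r * sin phi)) - - ln (radius p q)) <= 1).
  { intros r phi Hrr. assert (B := radius_pol p q r phi Hpq ltac:(lra)).
    split; [|split; [lra|]].
    - rewrite <- radius_sq. apply pow_lt. lra.
    - apply half_disk_log; lra. }
  split; [|lra].
  exists (- ln (radius p q)). split; [reflexivity|]. split; [lra|]. split; [|split; [exact Hin|]].
  - intros r phi Hrr. unfold punctured.
    assert (Hab : exists r' phi', 0 <= r' <= 3 / 4 * radius p q /\
       p + r * cos phi = p + r' * cos phi' /\ q + r * sin phi = q + r' * sin phi').
    { destruct (Rle_or_lt 0 r) as [H0|H0].
      - exists r, phi. repeat split; lra.
      - exists (- r), (phi + PI). rewrite neg_cos, neg_sin. repeat split; lra. }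
    destruct Hab as [r' [phi' [Hr' [-> ->]]]].
    assert (B := radius_pol p q r' phi' Hpq ltac:(lra)).
    rewrite <- radius_sq. split.
    + apply pow_lt. lra.
    + apply Rlt_le_trans with ((2 * radius p q) ^ 2); [|].
      * assert (0 <= radius (p + r' * cos phi') (q + r' * sin phi')) by apply sqrt_pos. nra.
      * apply pow_incr. lra.
  - intros r phi Hrr. destruct (Hin r phi Hrr) as [H1 [_ H3]].
    unfold pol. set (x := p + r * cos phi) in *. set (y := q + r * sin phi) in *.
    unfold regular_part. destruct (cartesian x y H1) as [psi E]. rewrite (E u).
    assert (El : lg x y = ln (radius x y)).
    { unfold lg. rewrite <- radius_sq. simpl pow. rewrite Rmult_1_r, ln_mult by (apply radius_pos, H1). field. }
    rewrite El. set (t := - ln (radius x y)) in *.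
    replace (ln (radius x y)) with (- t) by (unfold t; ring).
    replace (pol u 0 0 (exp (- t)) psi + alpha * - t - (mean u (- ln (radius p q)) + gamma * - ln (radius p q)))
      with (cyl u t psi + gamma * t - (mean u (- ln (radius p q)) + gamma * - ln (radius p q)))
      by (unfold cyl, alpha; ring).
    apply Hs; [lra | exact H3].
Qed.

Lemma lap_regular_part x y : D x y ->
  (uxx x y + alpha * lgxx x y) + (uyy x y + alpha * lgyy x y) = k x y * exp (2 * u x y).
Proof.
  intros Hd. rewrite <- Heq by exact Hd. destruct Hd as [H _].
  unfold lgxx, lgyy. field. lra.
Qed.

(** On the disk |z| is comparable with its value at the centre, so the bound e^U <= C / t becomes
    a uniform bound for e^(2u). *)
Lemma near_density p q om r phi : near_data p q om -> 0 <= r <= radius p q / 2 ->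
  D (p + r * cos phi) (q + r * sin phi) /\
  exp (2 * u (p + r * cos phi) (q + r * sin phi)) <=
    4 * C ^ 2 / ((- ln (radius p q) - 1) ^ 2 * radius p q ^ 2).
Proof.
  intros [t0 [Et [Ht0 [Hcirc [Hin _]]]]] Hr. destruct (Hin r phi Hr) as [H1 [H2 H3]].
  assert (Hrp : 0 < radius p q).
  { destruct (Rle_lt_or_eq_dec 0 (radius p q) (sqrt_pos _)) as [H|H]; [exact H|].
    exfalso. rewrite <- H in *. assert (Hr0 : r = 0) by lra. subst r.
    rewrite !Rmult_0_l, !Rplus_0_r in H1. assert (X := radius_pos p q H1). lra. }
  split; [apply Hcirc; lra|].
  set (x := p + r * cos phi) in *. set (y := q + r * sin phi) in *.
  apply Rabs_le_between in H3.
  assert (B := density_bound x y H1 ltac:(lra)).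
  rewrite <- Et. set (t := - ln (radius x y)) in *.
  assert (He : exp (u x y) <= 2 * C / ((t0 - 1) * radius p q)).
  { apply Rmult_le_reg_l with (radius p q / 2); [lra|].
    apply Rle_trans with (C / (t0 - 1)).
    - apply Rle_trans with (radius x y * exp (u x y)).
      + apply Rmult_le_compat_r; [left; apply exp_pos | exact H2].
      + eapply Rle_trans; [exact B|]. apply Rmult_le_compat_l; [lra|]. apply Rinv_le_contravar; lra.
    - right. field. lra. }
  replace (2 * u x y) with (u x y + u x y) by ring. rewrite exp_plus.
  replace (4 * C ^ 2 / ((t0 - 1) ^ 2 * radius p q ^ 2))
    with (2 * C / ((t0 - 1) * radius p q) * (2 * C / ((t0 - 1) * radius p q))) by (field; lra).
  apply Rmult_le_compat; [left; apply exp_pos | left; apply exp_pos | exact He | exact He].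
Qed.

Lemma near_lap_bound p q om r phi : near_data p q om -> 0 <= r <= radius p q / 2 ->
  Rabs (pol (fun x y => (uxx x y + alpha * lgxx x y) + (uyy x y + alpha * lgyy x y)) p q r phi) <=
    M * (4 * C ^ 2 / ((- ln (radius p q) - 1) ^ 2 * radius p q ^ 2)).
Proof.
  intros Hn Hr. destruct (near_density p q om r phi Hn Hr) as [Hd He].
  unfold pol. rewrite lap_regular_part by exact Hd.
  assert (Hkk := Hk _ _ Hd). assert (X := exp_pos (2 * u (p + r * cos phi) (q + r * sin phi))).
  rewrite Rabs_right by nra. apply Rmult_le_compat; lra.
Qed.

Lemma M_pos : 0 < M.
Proof.
  assert (Dp : D (0 + R0 / 2 * cos 0) (0 + R0 / 2 * sin 0)) by (apply circles_punctured; lra).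
  specialize (Hk _ _ Dp). lra.
Qed.

Lemma near_gradient p q om th : near_data p q om -> 0 < radius p q -> 0 <= om ->
  radius p q * Rabs ((ux p q + alpha * lgx p q) * cos th + (uy p q + alpha * lgy p q) * sin th)
   <= 4 * om + 4 * M * C ^ 2 / (- ln (radius p q) - 1) ^ 2.
Proof.
  intros Hn Hr Hom. assert (Hn' := Hn). destruct Hn' as [t0 [Et [Ht0 [Hcirc [Hin Hv]]]]].
  assert (HM := M_pos).
  assert (G := gradient_estimate D _ _ _ _ _ _ _ (open_punctured R0)
     (C2_regular_part (mean u t0 + gamma * t0)) p q (radius p q / 2) (3 / 4 * radius p q)
     ltac:(lra) Hcirc om Hv (M * (4 * C ^ 2 / ((t0 - 1) ^ 2 * radius p q ^ 2))) th).
  cbv beta in G. rewrite <- Et.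
  apply Rle_trans with (radius p q * (2 * om / (radius p q / 2) +
     2 * (M * (4 * C ^ 2 / ((t0 - 1) ^ 2 * radius p q ^ 2))) * (radius p q / 2))).
  - apply Rmult_le_compat_l; [lra|]. apply G.
    + apply Rmult_le_pos; [lra|]. apply Rdiv_le_0_compat; [nra|].
      apply Rmult_lt_0_compat; apply pow_lt; lra.
    + intros r phi Hrr. rewrite Et. apply (near_lap_bound p q om); assumption.
  - right. field. lra.
Qed.

Lemma quadratic_decay A eps : 0 < eps -> exists T1, 1 < T1 /\
  forall t, T1 <= t -> A / (t - 1) ^ 2 <= eps.
Proof.
  intros He. exists (2 + Rabs A / eps). assert (HA := Rabs_pos A).
  assert (Hq : 0 <= Rabs A / eps) by (apply Rdiv_le_0_compat; lra).
  split; [lra|]. intros t Ht.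
  assert (H1 : 1 <= t - 1) by lra.
  apply Rmult_le_reg_r with ((t - 1) ^ 2); [apply pow_lt; lra|].
  unfold Rdiv. rewrite Rmult_assoc, Rinv_l, Rmult_1_r by (apply pow_nonzero; lra).
  assert (H2 : Rabs A <= eps * (t - 1)).
  { replace (Rabs A) with (eps * (Rabs A / eps)) by (field; lra). apply Rmult_le_compat_l; lra. }
  assert (H3 := Rle_abs A). nra.
Qed.

Theorem gradient_asymptotics : vanishing R0 (fun x y =>
  radius x y * (Rabs (ux x y + alpha * lgx x y) + Rabs (uy x y + alpha * lgy x y))).
Proof.
  intros eps He.
  destruct (quadratic_decay (4 * M * C ^ 2) (eps / 4) ltac:(lra)) as [T1 [_ HT1]].
  destruct (near_data_exists (eps / 16) ltac:(lra) T1) as [d [Hd Hnear]].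
  exists d. split; [exact Hd|]. intros p q Hpq Hr.
  destruct (Hnear p q Hpq Hr) as [Hn Ht]. specialize (HT1 _ Ht).
  assert (Hp := radius_pos p q Hpq).
  assert (G1 := near_gradient p q (eps / 16) 0 Hn Hp ltac:(lra)).
  assert (G2 := near_gradient p q (eps / 16) (PI / 2) Hn Hp ltac:(lra)).
  rewrite cos_0, sin_0, Rmult_0_r, Rmult_1_r, Rplus_0_r in G1.
  rewrite cos_PI2, sin_PI2, Rmult_0_r, Rmult_1_r, Rplus_0_l in G2.
  rewrite Rmult_plus_distr_l. lra.
Qed.

Context (beta K : R) (Hbeta : 0 < beta <= 1) (HK : 0 <= K).
Context (Hhol : forall x y x' y', D x y -> D x' y' -> 0 < (x - x') ^ 2 + (y - y') ^ 2 ->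
  Rabs (k x y - k x' y') <= K * Rpower (radius (x - x') (y - y')) beta).

(** Hölder bound for the right-hand side at a point near the puncture, in the scale of that
    point: the gradient bound gives it for e^(2u), and k is Hölder by assumption. *)
Lemma near_lap_holder p q om G : near_data p q om -> 0 < radius p q <= 1 ->
  (forall r phi, 0 <= r <= radius p q / 2 ->
     let x := p + r * cos phi in let y := q + r * sin phi in
     radius x y * Rabs (ux x y) <= G /\ radius x y * Rabs (uy x y) <= G) ->
  0 <= G -> forall r phi, 0 < r <= radius p q / 2 ->
  let lp := fun x y => (uxx x y + alpha * lgxx x y) + (uyy x y + alpha * lgyy x y) in
  Rabs (pol lp p q r phi - lp p q) <=
  (4 * C ^ 2 * (K + 8 * M * G)) / ((- ln (radius p q) - 1) ^ 2 * radius p q ^ 2)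
    * Rpower (radius p q) (- beta) * Rpower r beta.
Proof.
  intros Hn Hrp HG HG0 r phi Hr lp. assert (HM := M_pos).
  set (rho := radius p q) in *.
  set (E := 4 * C ^ 2 / ((- ln rho - 1) ^ 2 * rho ^ 2)).
  assert (HE : forall s, 0 <= s <= r -> exp (2 * u (p + s * cos phi) (q + s * sin phi)) <= E /\
     D (p + s * cos phi) (q + s * sin phi)).
  { intros s Hs. destruct (near_density p q om s phi Hn ltac:(unfold rho in *; lra)) as [A B].
    split; assumption. }
  assert (HE0 : 0 < E) by (eapply Rlt_le_trans; [apply exp_pos | apply (HE 0); lra]).
  destruct (HE r ltac:(lra)) as [He Hd]. destruct (HE 0 ltac:(lra)) as [He0 Hd0].
  rewrite !Rmult_0_l, !Rplus_0_r in He0, Hd0.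
  set (x := p + r * cos phi) in *. set (y := q + r * sin phi) in *.
  assert (Elp : pol lp p q r phi - lp p q =
     (k x y - k p q) * exp (2 * u x y) + k p q * (exp (2 * u x y) - exp (2 * u p q))).
  { unfold pol, lp. fold x y. rewrite !lap_regular_part by assumption. ring. }
  rewrite Elp.
  (* the ratio (r / rho)^beta dominates both r^beta and r / rho *)
  set (X := Rpower rho (- beta) * Rpower r beta).
  assert (HX1 : Rpower r beta <= X).
  { unfold X. rewrite <- (Rmult_1_l (Rpower r beta)) at 1.
    apply Rmult_le_compat_r; [left; apply exp_pos|].
    rewrite Rpower_Ropp, <- Rinv_1. apply Rinv_le_contravar; [apply exp_pos|].
    apply Rle_trans with (Rpower 1 beta); [apply Rpower_le_base; lra|].
    unfold Rpower. rewrite ln_1, Rmult_0_r, exp_0. lra. }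
  assert (HX2 : r / rho <= X).
  { assert (EX : X = Rpower (r / rho) beta).
    { unfold X, Rpower. rewrite <- exp_plus. f_equal. unfold Rdiv.
      rewrite ln_mult, ln_Rinv by (first [lra | apply Rinv_0_lt_compat; lra]). ring. }
    rewrite EX.
    assert (Hq : 0 < r / rho <= 1).
    { split; [apply Rdiv_lt_0_compat; lra|].
      apply Rmult_le_reg_r with rho; [lra|]. unfold Rdiv. rewrite Rmult_assoc, Rinv_l; lra. }
    rewrite <- (Rpower_1 (r / rho)) at 1 by lra.
    unfold Rpower.
    assert (Hln : ln (r / rho) <= 0).
    { rewrite <- ln_1. apply ln_le; lra. }
    apply exp_le_compat. nra. }
  assert (HX0 : 0 < X) by (apply Rmult_lt_0_compat; apply exp_pos).
  assert (Hk1 : Rabs (k x y - k p q) <= K * X).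
  { assert (Hds : (x - p) ^ 2 + (y - q) ^ 2 = r ^ 2).
    { unfold x, y. assert (E1 := sin2_cos2 phi). unfold Rsqr in E1. nra. }
    eapply Rle_trans; [apply Hhol; [exact Hd | exact Hd0 |]|].
    - rewrite Hds. apply pow_lt. lra.
    - unfold radius. rewrite Hds, sqrt_pow2 by lra. apply Rmult_le_compat_l; lra. }
  assert (He1 : Rabs (exp (2 * u x y) - exp (2 * u p q)) <= 8 * G * E * (r / rho)).
  { assert (B := increment_bound (fun s => exp (2 * pol u p q s phi))
      (fun s => 2 * pol_r ux uy p q s phi * exp (2 * pol u p q s phi)) 0 r (8 * G * E / rho) ltac:(lra)).
    cbv beta in B. rewrite Rminus_0_r, pol_0 in B.
    change (pol u p q r phi) with (u x y) in B.
    replace (8 * G * E * (r / rho)) with (8 * G * E / rho * r) by (field; lra).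
    apply B.
    - intros s Hs.
      assert (Dp := is_derive_pol_r D u ux uy p q s phi (open_punctured R0) (proj1 Hu)
         (proj2 (HE s ltac:(lra)))).
      assert (De : is_derive (fun z => exp (2 * z)) (pol u p q s phi) (2 * exp (2 * pol u p q s phi)))
        by (auto_derive; [exact I | ring]).
      assert (Dc := is_derive_comp (fun z => exp (2 * z)) (fun s => pol u p q s phi) s _ _ De Dp).
      match type of Dc with is_derive _ _ ?v => match goal with |- is_derive _ _ ?w =>
        replace w with v; [exact Dc |] end end.
      unfold scal; simpl; unfold mult; simpl. ring.
    - intros s Hs. destruct (HE s ltac:(lra)) as [Hes Hds].
      assert (Hrs : 0 <= s <= rho / 2) by lra.
      destruct (HG s phi Hrs) as [G1 G2].
      destruct Hn as [t0 [_ [_ [_ [Hin _]]]]]. destruct (Hin s phi Hrs) as [_ [Hrad _]].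
      fold rho in Hrad.
      unfold pol_r, pol. set (a := p + s * cos phi) in *. set (b := q + s * sin phi) in *.
      assert (G1' : Rabs (ux a b) <= 2 * G / rho).
      { apply Rmult_le_reg_l with (rho / 2); [lra|]. replace (rho / 2 * (2 * G / rho)) with G by (field; lra).
        eapply Rle_trans; [|exact G1]. apply Rmult_le_compat_r; [apply Rabs_pos | lra]. }
      assert (G2' : Rabs (uy a b) <= 2 * G / rho).
      { apply Rmult_le_reg_l with (rho / 2); [lra|]. replace (rho / 2 * (2 * G / rho)) with G by (field; lra).
        eapply Rle_trans; [|exact G2]. apply Rmult_le_compat_r; [apply Rabs_pos | lra]. }
      assert (Bc : Rabs (cos phi) <= 1) by (apply Rabs_le; assert (Z := COS_bound phi); lra).
      assert (Bs : Rabs (sin phi) <= 1) by (apply Rabs_le; assert (Z := SIN_bound phi); lra).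
      rewrite !Rabs_mult, (Rabs_right 2), (Rabs_right (exp _)) by (first [lra | left; apply exp_pos]).
      assert (Hgr : Rabs (ux a b * cos phi + uy a b * sin phi) <= 4 * G / rho).
      { eapply Rle_trans; [apply Rabs_triang|]. rewrite !Rabs_mult.
        assert (Rabs (ux a b) * Rabs (cos phi) <= 2 * G / rho * 1)
          by (apply Rmult_le_compat; [apply Rabs_pos | apply Rabs_pos | exact G1' | exact Bc]).
        assert (Rabs (uy a b) * Rabs (sin phi) <= 2 * G / rho * 1)
          by (apply Rmult_le_compat; [apply Rabs_pos | apply Rabs_pos | exact G2' | exact Bs]).
        replace (4 * G / rho) with (2 * G / rho * 1 + 2 * G / rho * 1) by (field; lra). lra. }
      replace (8 * G * E / rho) with (2 * (4 * G / rho) * E) by (field; lra).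
      apply Rmult_le_compat; [| left; apply exp_pos | | exact Hes].
      + apply Rmult_le_pos; [lra | apply Rabs_pos].
      + apply Rmult_le_compat_l; [lra | exact Hgr]. }
  assert (Hkp := Hk p q Hd0).
  assert (HGE : 0 <= 8 * G * E) by nra.
  eapply Rle_trans; [apply Rabs_triang|]. rewrite !Rabs_mult.
  rewrite (Rabs_right (exp _)), (Rabs_right (k p q)) by (first [lra | left; apply exp_pos]).
  assert (T1 : Rabs (k x y - k p q) * exp (2 * u x y) <= K * X * E).
  { apply Rmult_le_compat; [apply Rabs_pos | left; apply exp_pos | exact Hk1 | exact He]. }
  assert (T2 : k p q * Rabs (exp (2 * u x y) - exp (2 * u p q)) <= M * (8 * G * E * X)).
  { apply Rmult_le_compat; [lra | apply Rabs_pos | lra |].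
    eapply Rle_trans; [exact He1|]. apply Rmult_le_compat_l; lra. }
  replace (4 * C ^ 2 * (K + 8 * M * G) / ((- ln rho - 1) ^ 2 * rho ^ 2) * Rpower rho (- beta) * Rpower r beta)
    with (E * (K + 8 * M * G) * X) by (unfold E, X, Rdiv; ring).
  replace (E * (K + 8 * M * G) * X) with (K * X * E + M * (8 * G * E * X)) by ring. lra.
Qed.

Lemma radius_ge_abs x y : Rabs x <= radius x y /\ Rabs y <= radius x y.
Proof.
  unfold radius. rewrite <- !sqrt_Rsqr_abs. split; apply sqrt_le_1_alt; unfold Rsqr; nra.
Qed.

Lemma lgx_bound x y : 0 < x ^ 2 + y ^ 2 ->
  radius x y * Rabs (lgx x y) <= 1 /\ radius x y * Rabs (lgy x y) <= 1.
Proof.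
  intros H. assert (Hp := radius_pos x y H). destruct (radius_ge_abs x y) as [A B].
  unfold lgx, lgy. rewrite <- radius_sq. unfold Rdiv.
  assert (Hi : 0 < / radius x y ^ 2) by (apply Rinv_0_lt_compat, pow_lt, Hp).
  rewrite !Rabs_mult, (Rabs_right (/ _)) by lra.
  assert (E : radius x y * (radius x y * / radius x y ^ 2) = 1) by (field; lra).
  rewrite <- E. split; (apply Rmult_le_compat_l; [lra|]); apply Rmult_le_compat_r; lra.
Qed.

Theorem hessian_asymptotics : vanishing R0 (fun x y => radius x y ^ 2 *
  (Rabs ((uxx x y + alpha * lgxx x y) - (uyy x y + alpha * lgyy x y)) +
   Rabs ((uxy x y + alpha * lgxy x y) + (uyx x y + alpha * lgxy x y)))).
Proof.
  intros eps He. assert (HM := M_pos).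
  destruct (gradient_asymptotics 1 Rlt_0_1) as [d1 [Hd1 HG1]].
  set (G := 1 + Rabs alpha). assert (HG0 : 0 <= G) by (unfold G; assert (A := Rabs_pos alpha); lra).
  assert (Htri : forall r v l, 0 <= r -> r * Rabs (v + alpha * l) <= 1 -> r * Rabs l <= 1 -> r * Rabs v <= G).
  { intros r v l Hr H1 H2. replace v with ((v + alpha * l) + - (alpha * l)) by ring.
    assert (Ha := Rabs_pos alpha).
    apply Rle_trans with (r * (Rabs (v + alpha * l) + Rabs alpha * Rabs l)).
    - apply Rmult_le_compat_l; [lra|]. rewrite <- Rabs_mult, <- (Rabs_Ropp (alpha * l)). apply Rabs_triang.
    - unfold G. nra. }
  assert (HG : forall x y, 0 < x ^ 2 + y ^ 2 -> radius x y < d1 ->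
     radius x y * Rabs (ux x y) <= G /\ radius x y * Rabs (uy x y) <= G).
  { intros x y Hxy Hr. assert (A := HG1 x y Hxy Hr). destruct (lgx_bound x y Hxy) as [A' B'].
    assert (Hp := radius_pos x y Hxy). rewrite Rmult_plus_distr_l in A.
    assert (P1 : 0 <= radius x y * Rabs (ux x y + alpha * lgx x y))
      by (apply Rmult_le_pos; [lra | apply Rabs_pos]).
    assert (P2 : 0 <= radius x y * Rabs (uy x y + alpha * lgy x y))
      by (apply Rmult_le_pos; [lra | apply Rabs_pos]).
    split; [apply (Htri _ _ (lgx x y)) | apply (Htri _ _ (lgy x y))]; lra. }
  set (A := 4 * C ^ 2 * (K + 8 * M * G)).
  assert (HA : 0 <= A).
  { unfold A. apply Rmult_le_pos; [nra|]. apply Rplus_le_le_0_compat; [lra | nra]. }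
  destruct (quadratic_decay (8 * A / beta) (eps / 4) ltac:(lra)) as [T1 [HT1 Hdec]].
  destruct (near_data_exists (eps / 128) ltac:(lra) T1) as [d2 [Hd2 Hnear]].
  exists (Rmin (d1 / 2) d2).
  destruct (Rmin_bounds (d1 / 2) d2) as [B1 B2].
  split; [split; [apply Rmin_pos; lra | lra]|].
  intros p q Hpq Hr. assert (Hp := radius_pos p q Hpq).
  destruct (Hnear p q Hpq ltac:(lra)) as [Hn Ht]. specialize (Hdec _ Ht).
  set (rho := radius p q) in *.
  set (N := A / ((- ln rho - 1) ^ 2 * rho ^ 2) * Rpower rho (- beta)).
  assert (HN : 0 <= N).
  { unfold N. apply Rmult_le_pos; [|left; apply exp_pos].
    apply Rdiv_le_0_compat; [exact HA|]. apply Rmult_lt_0_compat; apply pow_lt; lra. }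
  assert (Hmain : forall th, rho ^ 2 * Rabs
     (((uxx p q + alpha * lgxx p q) - (uyy p q + alpha * lgyy p q)) * cos (2 * th) +
      ((uxy p q + alpha * lgxy p q) + (uyx p q + alpha * lgxy p q)) * sin (2 * th)) <= eps / 2).
  { intros th. assert (Hn' := Hn). destruct Hn' as [t0 [Et [Ht0 [Hcirc [Hin Hv]]]]].
    assert (Hs := hessian_estimate D _ _ _ _ _ _ _ (open_punctured R0)
      (C2_regular_part (mean u t0 + gamma * t0)) p q (rho / 2) (3 / 4 * rho)
      ltac:(lra) Hcirc (eps / 128) Hv N beta th HN ltac:(lra)). cbv beta in Hs.
    assert (Hlap : forall r phi, 0 < r <= rho / 2 ->
      Rabs (pol (fun x y => uxx x y + alpha * lgxx x y + (uyy x y + alpha * lgyy x y)) p q r phi -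
        (uxx p q + alpha * lgxx p q + (uyy p q + alpha * lgyy p q))) <= N * Rpower r beta).
    { intros r phi Hrr.
      refine (near_lap_holder p q (eps / 128) G Hn _ _ HG0 r phi Hrr).
      - fold rho. lra.
      - intros s psi Hss. cbv zeta. destruct (Hin s psi Hss) as [P1 _]. apply HG; [exact P1|].
        assert (X := radius_pol p q s psi Hpq ltac:(unfold rho in *; lra)). unfold rho in *. lra. }
    specialize (Hs Hlap).
    apply Rle_trans with (rho ^ 2 * (8 * (eps / 128) / (rho / 2) ^ 2 + 8 * N / beta * Rpower (rho / 2) beta)).
    - apply Rmult_le_compat_l; [apply pow2_ge_0 | exact Hs].
    - assert (HR : Rpower rho (- beta) * Rpower (rho / 2) beta <= 1).
      { rewrite Rpower_Ropp. apply Rmult_le_reg_l with (Rpower rho beta); [apply exp_pos|].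
        rewrite <- Rmult_assoc, Rinv_r, Rmult_1_l, Rmult_1_r by (apply Rgt_not_eq, exp_pos).
        apply Rpower_le_base; lra. }
      assert (EN : rho ^ 2 * (8 * N / beta * Rpower (rho / 2) beta) =
        8 * A / beta / (- ln rho - 1) ^ 2 * (Rpower rho (- beta) * Rpower (rho / 2) beta)).
      { unfold N. field. repeat split; lra. }
      rewrite Rmult_plus_distr_l, EN.
      replace (rho ^ 2 * (8 * (eps / 128) / (rho / 2) ^ 2)) with (eps / 4) by (field; lra).
      assert (Hq : 0 <= 8 * A / beta / (- ln rho - 1) ^ 2).
      { apply Rdiv_le_0_compat; [apply Rdiv_le_0_compat; lra | apply pow_lt; lra]. }
      assert (8 * A / beta / (- ln rho - 1) ^ 2 * (Rpower rho (- beta) * Rpower (rho / 2) beta) <=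
        8 * A / beta / (- ln rho - 1) ^ 2 * 1) by (apply Rmult_le_compat_l; lra). lra. }
  assert (H1 := Hmain 0). assert (H2 := Hmain (PI / 4)).
  rewrite Rmult_0_r, cos_0, sin_0, Rmult_0_r, Rmult_1_r, Rplus_0_r in H1.
  replace (2 * (PI / 4)) with (PI / 2) in H2 by field.
  rewrite cos_PI2, sin_PI2, Rmult_0_r, Rmult_1_r, Rplus_0_l in H2.
  rewrite Rmult_plus_distr_l. lra.
Qed.

End Puncture.

(** * A neighbourhood of an isolated boundary point *)

Lemma locally_C_2d (P : C -> Prop) (x y : R) :
  locally ((x, y) : C) P -> locally_2d (fun a b => P (a, b)) x y.
Proof.
  intros [e He]. exists e. intros a b Ha Hb. apply He. split; assumption.
Qed.

(** The indicator function of P has derivative 0. *)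
Lemma interval_connected (P : R -> Prop) :
  (forall s, 0 <= s <= 1 -> locally s P \/ locally s (fun t => ~ P t)) -> P 0 -> P 1.
Proof.
  intros Hloc H0. apply NNPP. intros H1.
  set (f := fun s => if excluded_middle_informative (P s) then 0 else 1).
  assert (Df : forall s, 0 <= s <= 1 -> is_derive f s 0).
  { intros s Hs. destruct (Hloc s Hs) as [L|L].
    - apply (is_derive_ext_loc (fun _ => 0)).
      + eapply filter_imp; [|exact L]. intros t Ht. unfold f.
        destruct (excluded_middle_informative (P t)); [reflexivity | contradiction].
      + apply (is_derive_const (V := R_NormedModule)).
    - apply (is_derive_ext_loc (fun _ => 1)).
      + eapply filter_imp; [|exact L]. intros t Ht. unfold f.
        destruct (excluded_middle_informative (P t)); [contradiction | reflexivity].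
      + apply (is_derive_const (V := R_NormedModule)). }
  assert (I := increment_bound f (fun _ => 0) 0 1 0 ltac:(lra) Df
    (fun x _ => Req_le _ _ Rabs_R0)).
  unfold f in I. destruct (excluded_middle_informative (P 0)) as [_|]; [|contradiction].
  destruct (excluded_middle_informative (P 1)) as [|_]; [contradiction|].
  rewrite Rabs_right in I; lra.
Qed.

Lemma locally_2d_path (P : R -> R -> Prop) (X Y : R -> R) s :
  continuity_pt X s -> continuity_pt Y s -> locally_2d P (X s) (Y s) ->
  locally s (fun t => P (X t) (Y t)).
Proof.
  intros HX HY [d Hd].
  assert (LX := proj1 (continuity_pt_locally _ _) HX d).
  assert (LY := proj1 (continuity_pt_locally _ _) HY d).
  eapply filter_imp; [|exact (filter_and _ _ LX LY)]. intros t [A B]. apply Hd; assumption.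
Qed.

(** A punctured disk is path connected, in polar coordinates. *)
Lemma punctured_connected R0 (P : R -> R -> Prop) :
  0 < R0 ->
  (forall x y, punctured R0 x y -> locally_2d P x y \/ locally_2d (fun a b => ~ P a b) x y) ->
  forall x y x' y', punctured R0 x y -> punctured R0 x' y' -> P x y -> P x' y'.
Proof.
  intros HR Hloc x y x' y' Hd Hd' HP.
  assert (Hr : forall a b, punctured R0 a b -> 0 < radius a b < R0).
  { intros a b [H1 H2]. split; [apply radius_pos, H1|].
    rewrite <- (sqrt_pow2 R0) by lra. apply sqrt_lt_1_alt. lra. }
  destruct (polar_exists x y (proj1 Hd)) as [phi [Ex Ey]].
  destruct (polar_exists x' y' (proj1 Hd')) as [phi' [Ex' Ey']].
  assert (R1 := Hr x y Hd). assert (R2 := Hr x' y' Hd').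
  fold (radius x y) in Ex, Ey. fold (radius x' y') in Ex', Ey'.
  set (r := radius x y) in *. set (r' := radius x' y') in *.
  set (rs := fun s => r + s * (r' - r)). set (ps := fun s => phi + s * (phi' - phi)).
  set (X := fun s => 0 + rs s * cos (ps s)). set (Y := fun s => 0 + rs s * sin (ps s)).
  assert (Hrs : forall s, 0 <= s <= 1 -> 0 < rs s < R0) by
    (intros s Hs; unfold rs; destruct (Rle_or_lt r r'); nra).
  assert (CX : forall s, continuity_pt X s).
  { intros s. eapply is_derive_continuity_pt. unfold X, rs, ps. auto_derive; [exact I | reflexivity]. }
  assert (CY : forall s, continuity_pt Y s).
  { intros s. eapply is_derive_continuity_pt. unfold Y, rs, ps. auto_derive; [exact I | reflexivity]. }
  assert (E1 : P (X 1) (Y 1)).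
  { apply (interval_connected (fun s => P (X s) (Y s))).
    - intros s Hs.
      destruct (Hloc (X s) (Y s) (circles_punctured R0 (rs s) (ps s) (Hrs s Hs))) as [L|L].
      + left. apply locally_2d_path; auto.
      + right. apply (locally_2d_path (fun a b => ~ P a b)); auto.
    - unfold X, Y, rs, ps. rewrite !Rmult_0_l, !Rplus_0_r, !Rplus_0_l, <- Ex, <- Ey. exact HP. }
  unfold X, Y, rs, ps in E1.
  replace (r + 1 * (r' - r)) with r' in E1 by ring.
  replace (phi + 1 * (phi' - phi)) with phi' in E1 by ring.
  rewrite !Rplus_0_l, <- Ex', <- Ey' in E1. exact E1.
Qed.

Lemma radius_lt_abs x y d : radius x y < d -> Rabs x < d /\ Rabs y < d.
Proof. intros H. destruct (radius_ge_abs x y). split; lra. Qed.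

Lemma radius_lt x y d : 0 < d -> x ^ 2 + y ^ 2 < d ^ 2 -> radius x y < d.
Proof.
  intros Hd H. rewrite <- (sqrt_pow2 d) by lra. apply sqrt_lt_1_alt. nra.
Qed.

Lemma ball_C_0 (e x y : R) : ball (RtoC 0 : C) e ((x, y) : C) -> Rabs x < e /\ Rabs y < e.
Proof.
  intros [Hx Hy]. simpl in Hx, Hy. unfold ball in Hx, Hy; simpl in Hx, Hy.
  unfold AbsRing_ball, abs, minus, plus, opp in Hx, Hy; simpl in Hx, Hy.
  rewrite Ropp_0, Rplus_0_r in Hx, Hy. auto.
Qed.

Lemma nonzero_C x y : ((x, y) : C) <> RtoC 0 -> 0 < x ^ 2 + y ^ 2.
Proof.
  intros Hne. destruct (Req_dec x 0) as [Ex|Ex]; [|nra]. destruct (Req_dec y 0) as [Ey|Ey]; [|nra].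
  exfalso. apply Hne. rewrite Ex, Ey. reflexivity.
Qed.

(** Every point of a small punctured disk is interior to Omega or to its complement, so by
    connectedness the punctured disk lies in one of them. It does not lie in the complement: 0 is
    in the closure of Omega, but not in Omega, which is open. *)
Lemma isolated_punctured (Omega : C -> Prop) :
  open Omega -> isolated_boundary_point Omega (RtoC 0) ->
  exists R0, 0 < R0 /\ forall x y, punctured R0 x y -> Omega (x, y).
Proof.
  intros HO [[Hb1 Hb2] Hiso].
  assert (H0 : ~ Omega (RtoC 0)) by (intros H; exact (Hb2 (HO _ H))).
  destruct (locally_C_2d _ _ _ Hiso) as [R0 HR0].
  assert (Hp := cond_pos R0). exists R0. split; [exact Hp|].
  assert (Hin : forall x y, punctured R0 x y -> ~ boundary Omega (x, y)).
  { intros x y [H1 H2]. destruct (radius_lt_abs x y R0 (radius_lt x y R0 Hp H2)) as [A B].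
    apply HR0; [rewrite Rminus_0_r; exact A | rewrite Rminus_0_r; exact B |].
    intros E. apply (f_equal fst) in E as E1. apply (f_equal snd) in E as E2. simpl in E1, E2.
    rewrite E1, E2 in H1. simpl in H1. lra. }
  assert (Hdich : forall x y, punctured R0 x y ->
     locally_2d (fun a b => Omega (a, b)) x y \/ locally_2d (fun a b => ~ Omega (a, b)) x y).
  { intros x y Hd. specialize (Hin x y Hd). unfold boundary in Hin.
    destruct (classic (locally ((x, y) : C) Omega)) as [L|L].
    - left. apply (locally_C_2d Omega), L.
    - right. apply (locally_C_2d (fun z => ~ Omega z)). apply NNPP. intros N. apply Hin. auto. }
  assert (Hex : exists x y, punctured R0 x y /\ Omega (x, y)).
  { apply NNPP. intros N. apply Hb1. exists (mkposreal (R0 / 2) ltac:(lra)).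
    intros [x y] Hb HOm. apply N. exists x, y. split; [|exact HOm].
    apply ball_C_0 in Hb. destruct Hb as [Hx Hy]. simpl in Hx, Hy.
    apply Rabs_def2 in Hx. apply Rabs_def2 in Hy. split; [|nra].
    apply nonzero_C. intros E. apply H0. rewrite <- E. exact HOm. }
  destruct Hex as [x0 [y0 [Hd0 HO0]]]. intros x y Hd.
  exact (punctured_connected R0 (fun a b => Omega (a, b)) Hp Hdich x0 y0 x y Hd0 Hd HO0).
Qed.

(** * Translation between functions on C and functions of two real variables *)

Lemma dx_dy_C1 D (F : C -> R) f fx fy : open_2d D ->
  (forall x y, D x y -> F (x, y) = f x y) -> C1_on D f fx fy ->
  forall x y, D x y -> dx F (x, y) = fx x y /\ dy F (x, y) = fy x y.
Proof.
  intros HD HF Hf x y Hd. destruct (Hf x y Hd) as [H1 [H2 _]].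
  assert (HL := HD x y Hd). unfold dx, dy; simpl. split.
  - rewrite (Derive_ext_loc _ (fun s => f s y)).
    + apply is_derive_unique, H1.
    + eapply filter_imp; [|exact (locally_2d_1d_const_y _ _ _ HL)].
      intros t Ht. apply HF, Ht.
  - rewrite (Derive_ext_loc _ (fun s => f x s)).
    + apply is_derive_unique, H2.
    + eapply filter_imp; [|exact (locally_2d_1d_const_x _ _ _ HL)].
      intros t Ht. apply HF, Ht.
Qed.

Lemma continuous_C_2d (F : C -> R) x y :
  continuous F ((x, y) : C) -> continuity_2d_pt (fun a b => F (a, b)) x y.
Proof.
  intros H eps. assert (L := H _ (locally_ball (F (x, y)) eps)).
  exact (locally_C_2d _ _ _ L).
Qed.

Lemma class_C1_on (A : C -> Prop) D (F : C -> R) n :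
  class_C (S n) A F -> class_C 0 A (dx F) -> class_C 0 A (dy F) ->
  (forall x y, D x y -> A (x, y)) ->
  C1_on D (fun x y => F (x, y)) (fun x y => dx F (x, y)) (fun x y => dy F (x, y)).
Proof.
  intros [_ [He _]] [Hx _] [Hy _] HA x y Hd. assert (Ha := HA x y Hd).
  destruct (He _ Ha) as [E1 E2]. split; [|split; [|split]].
  - apply (Derive_correct (fun t => F (t, y)) x), E1.
  - apply (Derive_correct (fun t => F (x, t)) y), E2.
  - apply (continuous_C_2d (dx F)), Hx, Ha.
  - apply (continuous_C_2d (dy F)), Hy, Ha.
Qed.

Lemma class_C0 n A F : class_C n A F -> class_C 0 A F.
Proof. destruct n; intros [H _]; split; auto. Qed.

Lemma class_C2_on (A : C -> Prop) D (F : C -> R) :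
  class_C 2 A F -> (forall x y, D x y -> A (x, y)) ->
  C2_on D (fun x y => F (x, y)) (fun x y => dx F (x, y)) (fun x y => dy F (x, y))
    (fun x y => dx (dx F) (x, y)) (fun x y => dy (dx F) (x, y))
    (fun x y => dx (dy F) (x, y)) (fun x y => dy (dy F) (x, y)).
Proof.
  intros H HA. assert (H' := H). destruct H' as [_ [_ [Hx Hy]]].
  assert (Hx' := Hx). destruct Hx' as [_ [_ [Hxx Hxy]]].
  assert (Hy' := Hy). destruct Hy' as [_ [_ [Hyx Hyy]]].
  split; [|split].
  - apply (class_C1_on A D F 1 H); [apply (class_C0 1), Hx | apply (class_C0 1), Hy | exact HA].
  - apply (class_C1_on A D (dx F) 0 Hx); assumption.
  - apply (class_C1_on A D (dy F) 0 Hy); assumption.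
Qed.

Lemma C1_on_ln D f fx fy : open_2d D -> (forall x y, D x y -> 0 < f x y) -> C1_on D f fx fy ->
  C1_on D (fun x y => ln (f x y)) (fun x y => fx x y / f x y) (fun x y => fy x y / f x y).
Proof.
  intros HD Hpos Hf x y Hd. assert (P := Hpos x y Hd).
  assert (Cf := C1_continuity D f fx fy x y HD Hf Hd).
  destruct (Hf x y Hd) as [F1 [F2 [F3 F4]]].
  assert (Dl := is_derive_ln (f x y) P).
  split; [|split; [|split]].
  - assert (Q := is_derive_comp ln (fun s => f s y) x _ _ Dl F1).
    exact Q.
  - assert (Q := is_derive_comp ln (fun s => f x s) y _ _ Dl F2).
    exact Q.
  - apply continuity_2d_pt_mult; [exact F3 | apply continuity_2d_pt_inv; [exact Cf | lra]].
  - apply continuity_2d_pt_mult; [exact F4 | apply continuity_2d_pt_inv; [exact Cf | lra]].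
Qed.

Lemma C1_on_quotient D f fx fy g gx gy : open_2d D -> (forall x y, D x y -> 0 < g x y) ->
  C1_on D f fx fy -> C1_on D g gx gy ->
  C1_on D (fun x y => f x y / g x y)
    (fun x y => (fx x y * g x y - f x y * gx x y) / g x y ^ 2)
    (fun x y => (fy x y * g x y - f x y * gy x y) / g x y ^ 2).
Proof.
  intros HD Hpos Hf Hg x y Hd. assert (P := Hpos x y Hd).
  assert (Cf := C1_continuity D f fx fy x y HD Hf Hd).
  assert (Cg := C1_continuity D g gx gy x y HD Hg Hd).
  destruct (Hf x y Hd) as [F1 [F2 [F3 F4]]]. destruct (Hg x y Hd) as [G1 [G2 [G3 G4]]].
  assert (Cg2 : continuity_2d_pt (fun x y => / g x y ^ 2) x y).
  { apply continuity_2d_pt_inv; [|apply pow_nonzero; lra]. simpl.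
    apply continuity_2d_pt_mult; [exact Cg|].
    apply continuity_2d_pt_mult; [exact Cg | apply continuity_2d_pt_const]. }
  split; [|split; [|split]].
  - apply (is_derive_div (fun s => f s y) (fun s => g s y)); [exact F1 | exact G1 | lra].
  - apply (is_derive_div (fun s => f x s) (fun s => g x s)); [exact F2 | exact G2 | lra].
  - apply continuity_2d_pt_mult; [|exact Cg2].
    apply continuity_2d_pt_minus; apply continuity_2d_pt_mult; assumption.
  - apply continuity_2d_pt_mult; [|exact Cg2].
    apply continuity_2d_pt_minus; apply continuity_2d_pt_mult; assumption.
Qed.

(** The Wirtinger operators are taken apart here, so that only real partial derivatives of the
    logarithm of the density occur elsewhere. *)
Lemma log_density_C2 (A : C -> Prop) R0 (lam : C -> R) :
  regular_metric A lam -> (forall x y, punctured R0 x y -> A (x, y)) ->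
  exists ux uy uxx uxy uyx uyy,
    C2_on (punctured R0) (fun x y => ln (lam (x, y))) ux uy uxx uxy uyx uyy /\
    forall x y, punctured R0 x y ->
      laplacian (fun w => ln (lam w)) (x, y) = uxx x y + uyy x y /\
      connection lam (x, y) = (ux x y, - uy x y) /\
      schwarzian lam (x, y) =
        ((uxx x y - uyy x y) / 2 - (ux x y ^ 2 - uy x y ^ 2) / 2,
         - (uxy x y + uyx x y) / 2 + ux x y * uy x y).
Proof.
  intros [Hpos HC2] HA.
  assert (HD := open_punctured R0).
  destruct (class_C2_on A (punctured R0) lam HC2 HA) as [L1 [L2 L3]].
  assert (Hp : forall x y, punctured R0 x y -> 0 < lam (x, y)) by (intros; apply Hpos, HA; assumption).
  assert (U1 := C1_on_ln _ _ _ _ HD Hp L1).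
  assert (U2 := C1_on_quotient _ _ _ _ _ _ _ HD Hp L2 L1).
  assert (U3 := C1_on_quotient _ _ _ _ _ _ _ HD Hp L3 L1).
  cbv beta in U1, U2, U3.
  match type of U1 with C1_on _ _ ?a ?b => set (ux := a) in *; set (uy := b) in * end.
  match type of U2 with C1_on _ _ ?a ?b => set (uxx := a) in *; set (uxy := b) in * end.
  match type of U3 with C1_on _ _ ?a ?b => set (uyx := a) in *; set (uyy := b) in * end.
  exists ux, uy, uxx, uxy, uyx, uyy. split; [split; [exact U1 | split; assumption]|].
  assert (V1 := dx_dy_C1 _ (fun w => ln (lam w)) _ _ _ HD (fun x y _ => eq_refl) U1).
  assert (V2 := dx_dy_C1 _ (dx (fun w => ln (lam w))) _ _ _ HD (fun x y Hd => proj1 (V1 x y Hd)) U2).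
  assert (V3 := dx_dy_C1 _ (dy (fun w => ln (lam w))) _ _ _ HD (fun x y Hd => proj2 (V1 x y Hd)) U3).
  assert (W0 : forall z, dx (fun w => Im (RtoC (ln (lam w)))) z = 0 /\ dy (fun w => Im (RtoC (ln (lam w)))) z = 0).
  { intros z. unfold dx, dy; simpl. split; apply Derive_const. }
  assert (Hconn : forall z, connection lam z =
     (dx (fun w => ln (lam w)) z, - dy (fun w => ln (lam w)) z)).
  { intros z. unfold connection, wirtinger. destruct (W0 z) as [-> ->].
    change (fun w => Re (RtoC (ln (lam w)))) with (fun w => ln (lam w)).
    unfold Cmult, Cminus, Cplus, Copp, RtoC, Ci; simpl. f_equal; field. }
  intros x y Hd. destruct (V1 x y Hd) as [A1 A2]. destruct (V2 x y Hd) as [B1 B2].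
  destruct (V3 x y Hd) as [C1 C2].
  split; [|split].
  - unfold laplacian. rewrite B1, C2. reflexivity.
  - rewrite Hconn, A1, A2. reflexivity.
  - unfold schwarzian. rewrite Hconn, A1, A2. unfold wirtinger.
    assert (E1 : dx (fun w => Re (connection lam w)) (x, y) = uxx x y /\
                 dy (fun w => Re (connection lam w)) (x, y) = uxy x y).
    { apply (dx_dy_C1 (punctured R0) _ ux); auto.
      intros a b Hab. rewrite Hconn. simpl. apply V1, Hab. }
    assert (E2 : dx (fun w => Im (connection lam w)) (x, y) = - uyx x y /\
                 dy (fun w => Im (connection lam w)) (x, y) = - uyy x y).
    { apply (dx_dy_C1 (punctured R0) _ (fun x y => - uy x y) (fun x y => - uyx x y) (fun x y => - uyy x y)); auto.
      - intros a b Hab. rewrite Hconn. simpl. f_equal. apply V1, Hab.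
      - intros a b Hab. destruct (U3 a b Hab) as [G1 [G2 [G3 G4]]]. split; [|split; [|split]].
        + apply (is_derive_opp (V := R_NormedModule)), G1.
        + apply (is_derive_opp (V := R_NormedModule)), G2.
        + apply continuity_2d_pt_opp, G3.
        + apply continuity_2d_pt_opp, G4. }
    destruct E1 as [-> ->]. destruct E2 as [-> ->].
    unfold Cmult, Cminus, Cplus, Copp, RtoC, Ci; simpl. f_equal; field.
Qed.

(** * Limits at the puncture *)

Lemma Cmod_radius x y : Cmod (x, y) = radius x y.
Proof. reflexivity. Qed.

Lemma locally'_radius (d : R) (P : C -> Prop) : 0 < d ->
  (forall x y, 0 < x ^ 2 + y ^ 2 -> radius x y < d -> P (x, y)) -> locally' (RtoC 0) P.
Proof.
  intros Hd H. exists (mkposreal (d / 2) ltac:(lra)). intros [x y] Hb Hne.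
  apply ball_C_0 in Hb. destruct Hb as [Hx Hy]. simpl in Hx, Hy.
  apply Rabs_def2 in Hx. apply Rabs_def2 in Hy.
  apply H; [apply nonzero_C, Hne|]. apply radius_lt; [exact Hd | nra].
Qed.

Lemma filterlim_C_intro (G : C -> C) (l1 l2 : R) :
  (forall eps, 0 < eps -> exists d, 0 < d /\ forall x y, 0 < x ^ 2 + y ^ 2 -> radius x y < d ->
     Rabs (fst (G (x, y)) - l1) <= eps /\ Rabs (snd (G (x, y)) - l2) <= eps) ->
  filterlim G (locally' (RtoC 0)) (locally ((l1, l2) : C)).
Proof.
  intros H P [eps HP]. assert (He := cond_pos eps).
  destruct (H (eps / 2) ltac:(lra)) as [d [Hd HG]].
  apply (locally'_radius d); [exact Hd|]. intros x y Hpos Hr.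
  destruct (HG x y Hpos Hr) as [H1 H2]. apply HP. split.
  - change (Rabs (fst (G (x, y)) - l1) < eps). lra.
  - change (Rabs (snd (G (x, y)) - l2) < eps). lra.
Qed.

Lemma locally'_log (T : R) (P : C -> Prop) :
  (forall x y, 0 < x ^ 2 + y ^ 2 -> T < - ln (radius x y) -> P (x, y)) ->
  locally' (RtoC 0) P.
Proof.
  intros H. apply (locally'_radius (exp (- T))); [apply exp_pos|]. intros x y Hpos Hr.
  apply H; [exact Hpos|].
  assert (L := ln_increasing _ _ (radius_pos x y Hpos) Hr). rewrite ln_exp in L. lra.
Qed.

Lemma filterlim_log : filterlim (fun z : C => - ln (Cmod z)) (locally' (RtoC 0)) (Rbar_locally p_infty).
Proof.
  intros P [T HT]. apply (locally'_log T). intros x y _ H. apply HT. exact H.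
Qed.

Lemma filterlim_log_right : filterlim (fun r => - ln r) (at_right 0) (Rbar_locally p_infty).
Proof.
  intros P [T HT]. exists (mkposreal _ (exp_pos (- T))). intros r Hr Hpos. apply HT.
  unfold ball in Hr; simpl in Hr. unfold AbsRing_ball, abs, minus, plus, opp in Hr; simpl in Hr.
  apply Rabs_def2 in Hr.
  assert (L := ln_increasing r (exp (- T)) Hpos ltac:(lra)). rewrite ln_exp in L. lra.
Qed.

Lemma ln_inv r : 0 < r -> ln (1 / r) = - ln r.
Proof. intros H. unfold Rdiv. rewrite Rmult_1_l. apply ln_Rinv, H. Qed.

(** On the circle |z| = e^(-t) every value of u lies within C / t of t + a(t), hence so does the
    supremum. *)
Lemma order_of_mean (u : C -> R) (a : R -> R) (gamma T C : R) :
  0 < T ->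
  (forall z : Coquelicot.Complex.C, 0 < Cmod z -> T <= - ln (Cmod z) ->
     Rabs (u z - (- ln (Cmod z) + a (- ln (Cmod z)))) <= C / (- ln (Cmod z))) ->
  is_lim (fun t => a t / t) p_infty (- gamma) ->
  has_order u (1 - gamma).
Proof.
  intros HT Hu Ha.
  assert (Hsup : forall r, 0 < r -> T <= - ln r -> exists s, circle_sup u r = Finite s /\
     Rabs (s - (- ln r + a (- ln r))) <= C / (- ln r)).
  { intros r Hr Ht. unfold circle_sup.
    set (E := fun x => exists z : Coquelicot.Complex.C, Cmod z = r /\ x = u z).
    assert (HE : forall x, E x -> Rabs (x - (- ln r + a (- ln r))) <= C / (- ln r)).
    { intros x [z [Hz ->]]. rewrite <- Hz in *. apply Hu; assumption. }
    assert (Hne : E (u (RtoC r))).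
    { exists (RtoC r). split; [rewrite Cmod_R; apply Rabs_right; lra | reflexivity]. }
    destruct (Lub_Rbar_correct E) as [Hub Hlub].
    assert (Hup : Rbar_le (Lub_Rbar E) (- ln r + a (- ln r) + C / (- ln r))).
    { apply Hlub. intros x Hx. specialize (HE x Hx). apply Rabs_le_between in HE. simpl. lra. }
    assert (Hlow := Hub _ Hne). assert (HE0 := HE _ Hne).
    destruct (Lub_Rbar E) as [s| |]; simpl in Hup, Hlow; try contradiction.
    exists s. split; [reflexivity|]. apply Rabs_le_between in HE0. apply Rabs_le. lra. }
  assert (Hev : at_right 0 (fun r => 0 < r /\ T <= - ln r)).
  { apply filter_and.
    - exists (mkposreal 1 Rlt_0_1). intros r _ Hr. exact Hr.
    - exact (filterlim_log_right _ (eventually_ge T)). }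
  split.
  - eapply filter_imp; [|exact Hev]. intros r [Hr Ht].
    destruct (Hsup r Hr Ht) as [s [-> _]]. reflexivity.
  - set (lo := fun t => 1 + a t / t - C * (/ t * / t)). set (hi := fun t => 1 + a t / t + C * (/ t * / t)).
    assert (Li : is_lim (fun t => / t) p_infty 0).
    { apply (is_lim_inv (fun t => t) p_infty p_infty); [apply is_lim_id | discriminate]. }
    assert (Lc : is_lim (fun t => C * (/ t * / t)) p_infty (C * (0 * 0))).
    { apply is_lim_mult'; [apply is_lim_const | apply is_lim_mult'; exact Li]. }
    assert (Lm : is_lim (fun t => 1 + a t / t) p_infty (1 + - gamma)).
    { apply is_lim_plus'; [apply is_lim_const | exact Ha]. }
    assert (Llo : is_lim lo p_infty (1 - gamma)).
    { replace (Finite (1 - gamma)) with (Finite (1 + - gamma - C * (0 * 0))) by (f_equal; ring).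
      apply is_lim_minus'; assumption. }
    assert (Lhi : is_lim hi p_infty (1 - gamma)).
    { replace (Finite (1 - gamma)) with (Finite (1 + - gamma + C * (0 * 0))) by (f_equal; ring).
      apply is_lim_plus'; assumption. }
    apply (filterlim_le_le (fun r => lo (- ln r)) _ (fun r => hi (- ln r)) (Finite (1 - gamma))).
    + eapply filter_imp; [|exact Hev]. intros r [Hr Ht].
      destruct (Hsup r Hr Ht) as [s [-> Hs]]. rewrite ln_inv by exact Hr. simpl real.
      set (t := - ln r) in *. apply Rabs_le_between in Hs.
      assert (Hi : 0 < / t) by (apply Rinv_0_lt_compat; lra).
      unfold lo, hi.
      replace (1 + a t / t - C * (/ t * / t)) with ((t + a t - C / t) * / t) by (field; lra).
      replace (1 + a t / t + C * (/ t * / t)) with ((t + a t + C / t) * / t) by (field; lra).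
      unfold Rdiv at 2. split; apply Rmult_le_compat_r; lra.
    + exact (filterlim_comp _ _ _ _ _ _ _ _ filterlim_log_right Llo).
    + exact (filterlim_comp _ _ _ _ _ _ _ _ filterlim_log_right Lhi).
Qed.

Lemma density_of_mean (lam : C -> R) (a : R -> R) (T C L : R) :
  0 < T ->
  (forall z : Coquelicot.Complex.C, 0 < Cmod z -> T <= - ln (Cmod z) -> 0 < lam z /\
     Rabs (ln (lam z) - (- ln (Cmod z) + a (- ln (Cmod z)))) <= C / (- ln (Cmod z))) ->
  is_lim (fun t => t * exp (a t)) p_infty L ->
  filterlim (fun z : Coquelicot.Complex.C => Cmod z * ln (1 / Cmod z) * lam z)
    (locally' (RtoC 0)) (locally L).
Proof.
  intros HT Hlam Ha.
  set (lo := fun t => t * exp (a t) * exp (- C * / t)). set (hi := fun t => t * exp (a t) * exp (C * / t)).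
  assert (Le : forall c, is_lim (fun t => exp (c * / t)) p_infty 1).
  { intros c. rewrite <- exp_0.
    apply (filterlim_comp _ _ _ (fun t => c * / t) exp _ (locally 0)).
    - replace (locally 0) with (Rbar_locally (c * 0)) by (simpl; rewrite Rmult_0_r; reflexivity).
      apply is_lim_mult'; [apply is_lim_const|].
      apply (is_lim_inv (fun t => t) p_infty p_infty); [apply is_lim_id | discriminate].
    - apply (continuous_exp 0). }
  assert (Lb : forall c, is_lim (fun t => t * exp (a t) * exp (c * / t)) p_infty L).
  { intros c. replace (Finite L) with (Finite (L * 1)) by (f_equal; ring).
    apply is_lim_mult'; [exact Ha | apply Le]. }
  apply (filterlim_le_le (fun z => lo (- ln (Cmod z))) _ (fun z => hi (- ln (Cmod z))) (Finite L)).
  - apply (locally'_log T). intros x y Hpos Ht. rewrite Cmod_radius.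
    assert (Hr := radius_pos x y Hpos).
    destruct (Hlam (x, y)) as [Hl Hb]; [rewrite Cmod_radius; exact Hr | rewrite Cmod_radius; lra |].
    rewrite Cmod_radius in Hb. rewrite ln_inv by exact Hr.
    assert (Er : radius x y = exp (ln (radius x y))) by (rewrite exp_ln; auto).
    set (t := - ln (radius x y)) in *.
    replace (ln (radius x y)) with (- t) in Er by (unfold t; ring).
    rewrite <- (exp_ln (lam (x, y)) Hl).
    replace (radius x y * t * exp (ln (lam (x, y)))) with (t * exp (ln (lam (x, y)) - t)).
    2: { unfold Rminus. rewrite exp_plus, <- Er. ring. }
    unfold lo, hi. rewrite !Rmult_assoc, <- !exp_plus.
    apply Rabs_le_between in Hb. unfold Rdiv in Hb.
    split; (apply Rmult_le_compat_l; [lra|]); apply exp_le_compat; lra.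
  - exact (filterlim_comp _ _ _ _ _ _ _ _ filterlim_log (Lb (- C))).
  - exact (filterlim_comp _ _ _ _ _ _ _ _ filterlim_log (Lb C)).
Qed.

(** * The curvature near the puncture *)

Lemma Rpower_small K beta eps : 0 <= K -> 0 < beta -> 0 < eps ->
  exists d, 0 < d /\ forall r, 0 < r <= d -> K * Rpower r beta <= eps.
Proof.
  intros HK Hb He. set (e := eps / (K + 1)).
  assert (Hee : 0 < e) by (apply Rdiv_lt_0_compat; lra).
  exists (Rpower e (/ beta)). split; [apply exp_pos|]. intros r Hr.
  assert (H : Rpower r beta <= e).
  { eapply Rle_trans; [apply Rpower_le_base; [exact Hr | lra]|].
    rewrite Rpower_mult, Rinv_l, Rpower_1 by lra. lra. }
  apply Rle_trans with (K * e); [apply Rmult_le_compat_l; assumption|].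
  assert (E : (K + 1) * e = eps) by (unfold e; field; lra). nra.
Qed.

Lemma holder_at_puncture (Omega : C -> Prop) (kappa : C -> R) R1 :
  0 < R1 -> (forall x y, punctured R1 x y -> Omega (x, y)) ->
  locally_holder (fun z => Omega z \/ z = RtoC 0) kappa ->
  kappa (RtoC 0) < 0 ->
  let k := fun x y => - kappa (x, y) in let k0 := - kappa (RtoC 0) in
  exists R0 beta K, 0 < R0 <= 1 /\ R0 <= R1 /\ 0 < beta <= 1 /\ 0 <= K /\
    (forall x y x' y', punctured R0 x y -> punctured R0 x' y' -> 0 < (x - x') ^ 2 + (y - y') ^ 2 ->
       Rabs (k x y - k x' y') <= K * Rpower (radius (x - x') (y - y')) beta) /\
    (forall x y, punctured R0 x y -> k0 / 2 <= k x y <= 2 * k0) /\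
    (forall eps, 0 < eps -> exists d, 0 < d /\ forall x y, punctured R0 x y ->
       x ^ 2 + y ^ 2 < d ^ 2 -> Rabs (k x y - k0) < eps).
Proof.
  intros HR1 HOm Hhol Hneg k k0.
  destruct (Hhol (RtoC 0) (or_intror eq_refl)) as [U [HU [beta [K [Hb HK]]]]].
  destruct (locally_C_2d U 0 0 HU) as [d Hd]. assert (Hd0 := cond_pos d).
  set (R2 := Rmin d (Rmin R1 1)).
  destruct (Rmin_bounds d (Rmin R1 1)) as [A1 A2].
  destruct (Rmin_bounds R1 1) as [A3 A4]. fold R2 in A1, A2.
  assert (HR2 : 0 < R2) by (apply Rmin_pos; [exact Hd0 | apply Rmin_pos; lra]).
  assert (Hk0 : 0 < k0) by (unfold k0; lra).
  assert (HUd : forall x y, x ^ 2 + y ^ 2 < R2 ^ 2 -> U (x, y)).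
  { intros x y H. destruct (radius_lt_abs x y R2 (radius_lt x y R2 HR2 H)).
    apply Hd; rewrite Rminus_0_r; lra. }
  assert (HA : forall x y, punctured R2 x y -> (Omega (x, y) \/ (x, y) = RtoC 0) /\ U (x, y)).
  { intros x y [H1 H2]. split; [left; apply HOm; split; [exact H1 |] | apply HUd, H2]. nra. }
  assert (HK1 : forall z w, (Omega z \/ z = RtoC 0) /\ U z -> (Omega w \/ w = RtoC 0) /\ U w -> z <> w ->
     Rabs (kappa z - kappa w) <= Rabs K * Rpower (Cmod (z - w)) beta).
  { intros z w Hz Hw Hne. eapply Rle_trans; [apply HK; assumption|].
    apply Rmult_le_compat_r; [left; apply exp_pos | apply Rle_abs]. }
  assert (Hhol0 : forall x y, punctured R2 x y -> Rabs (k x y - k0) <= Rabs K * Rpower (radius x y) beta).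
  { intros x y Hxy. unfold k, k0.
    replace (- kappa (x, y) - - kappa (RtoC 0)) with (- (kappa (x, y) - kappa (RtoC 0))) by ring.
    rewrite Rabs_Ropp. eapply Rle_trans; [apply HK1|].
    - apply HA, Hxy.
    - split; [right; reflexivity | apply (HUd 0 0)]. simpl. nra.
    - intros E. apply (f_equal fst) in E as E1. apply (f_equal snd) in E as E2. simpl in E1, E2.
      destruct Hxy as [H _]. rewrite E1, E2 in H. simpl in H. lra.
    - right. f_equal. f_equal. unfold Cmod, radius; simpl. f_equal. ring. }
  destruct (Rpower_small (Rabs K) beta (k0 / 2) (Rabs_pos K) ltac:(lra) ltac:(lra)) as [d1 [Hd1 Hs1]].
  set (R0 := Rmin R2 d1).
  destruct (Rmin_bounds R2 d1) as [B1 B2]. fold R0 in B1, B2.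
  assert (HR0 : 0 < R0) by (apply Rmin_pos; lra).
  assert (Hsub : forall x y, punctured R0 x y -> punctured R2 x y /\ 0 < radius x y < R0).
  { intros x y [H1 H2]. split; [split; [exact H1 | nra]|].
    split; [apply radius_pos, H1 | apply radius_lt; assumption]. }
  exists R0, beta, (Rabs K). split; [lra|]. split; [lra|]. split; [exact Hb|].
  split; [apply Rabs_pos|]. split; [|split].
  - intros x y x' y' H H' Hne. unfold k.
    replace (- kappa (x, y) - - kappa (x', y')) with (- (kappa (x, y) - kappa (x', y'))) by ring.
    rewrite Rabs_Ropp. apply (HK1 (x, y) (x', y')).
    + apply HA, Hsub, H.
    + apply HA, Hsub, H'.
    + intros E. apply (f_equal fst) in E as E1. apply (f_equal snd) in E as E2. simpl in E1, E2.
      rewrite E1, E2 in Hne. rewrite !Rminus_diag in Hne. simpl in Hne. lra.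
  - intros x y H. destruct (Hsub x y H) as [H2 Hr].
    assert (Hc := Hhol0 x y H2). assert (Hs := Hs1 (radius x y) ltac:(lra)).
    assert (Hcc : Rabs (k x y - k0) <= k0 / 2) by lra. apply Rabs_le_between in Hcc. lra.
  - intros eps He.
    destruct (Rpower_small (Rabs K) beta (eps / 2) (Rabs_pos K) ltac:(lra) ltac:(lra)) as [d2 [Hd2 Hs2]].
    exists d2. split; [exact Hd2|]. intros x y H Hlt. destruct (Hsub x y H) as [H2 Hr].
    assert (Hc := Hhol0 x y H2). assert (Hs := Hs2 (radius x y)).
    assert (Hl := radius_lt x y d2 Hd2 Hlt). specialize (Hs ltac:(lra)). lra.
Qed.

(** * The connection and the Schwarzian at the puncture *)

Lemma Rabs_cross a b x y : Rabs (a * x + b * y) <= Rabs a * Rabs x + Rabs b * Rabs y.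
Proof. eapply Rle_trans; [apply Rabs_triang|]. rewrite !Rabs_mult. lra. Qed.

Lemma connection_limit (G : C -> C) (ux uy : R -> R -> R) R0 alpha :
  0 < R0 ->
  (forall x y, punctured R0 x y -> G (x, y) = (ux x y, - uy x y)) ->
  vanishing R0 (fun x y =>
    radius x y * (Rabs (ux x y + alpha * lgx x y) + Rabs (uy x y + alpha * lgy x y))) ->
  forall eps, 0 < eps -> exists d, 0 < d <= R0 /\ forall x y, 0 < x ^ 2 + y ^ 2 -> radius x y < d ->
     Rabs (fst ((x, y) * G (x, y))%C - - alpha) <= eps /\ Rabs (snd ((x, y) * G (x, y))%C - 0) <= eps.
Proof.
  intros HR0 HG Hgrad eps He.
  destruct (Hgrad eps He) as [d [Hd Hb]]. exists d. split; [exact Hd|].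
  intros x y Hpos Hr. assert (H1 := Hb x y Hpos Hr).
  assert (Dxy : punctured R0 x y).
  { split; [exact Hpos|]. rewrite <- radius_sq. assert (X := radius_pos x y Hpos). nra. }
  rewrite (HG x y Dxy). simpl.
  destruct (radius_ge_abs x y) as [Rx Ry].
  set (a := ux x y + alpha * lgx x y) in *. set (b := uy x y + alpha * lgy x y) in *.
  assert (Pa := Rabs_pos a). assert (Pb := Rabs_pos b).
  split.
  - replace (x * ux x y - y * - uy x y - - alpha) with (x * a + y * b).
    + eapply Rle_trans; [apply Rabs_cross|]. nra.
    + unfold a, b, lgx, lgy. field. lra.
  - replace (x * - uy x y + y * ux x y - 0) with (y * a + (- x) * b).
    + eapply Rle_trans; [apply Rabs_cross|]. rewrite Rabs_Ropp. nra.
    + unfold a, b, lgx, lgy. field. lra.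
Qed.

(** Write z Gamma = e - alpha, and let q be the z-derivative of the connection of the metric with
    logarithmic density u + alpha log |z|. Then
    z^2 S = z^2 q + alpha (2 - alpha) / 2 + alpha e - e^2 / 2, where e and z^2 q tend to 0. *)
Lemma schwarzian_limit (S : C -> C) (ux uy uxx uxy uyx uyy : R -> R -> R) R0 alpha :
  0 < R0 ->
  (forall x y, punctured R0 x y -> S (x, y) =
        ((uxx x y - uyy x y) / 2 - (ux x y ^ 2 - uy x y ^ 2) / 2,
         - (uxy x y + uyx x y) / 2 + ux x y * uy x y)) ->
  vanishing R0 (fun x y =>
    radius x y * (Rabs (ux x y + alpha * lgx x y) + Rabs (uy x y + alpha * lgy x y))) ->
  vanishing R0 (fun x y => radius x y ^ 2 *
    (Rabs ((uxx x y + alpha * lgxx x y) - (uyy x y + alpha * lgyy x y)) +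
     Rabs ((uxy x y + alpha * lgxy x y) + (uyx x y + alpha * lgxy x y)))) ->
  forall eps, 0 < eps -> exists d, 0 < d /\ forall x y, 0 < x ^ 2 + y ^ 2 -> radius x y < d ->
     Rabs (fst ((x, y) * (x, y) * S (x, y))%C - alpha * (2 - alpha) / 2) <= eps /\
     Rabs (snd ((x, y) * (x, y) * S (x, y))%C - 0) <= eps.
Proof.
  intros HR0 HS Hgrad Hhess eps He.
  assert (Ha := Rabs_pos alpha).
  set (e := Rmin 1 (eps / (4 * (1 + Rabs alpha)))).
  assert (Hq : 0 < eps / (4 * (1 + Rabs alpha))) by (apply Rdiv_lt_0_compat; lra).
  assert (He0 : 0 < e) by (apply Rmin_pos; lra).
  assert (E1 : e <= 1) by apply Rmin_l.
  assert (E2 : e * (1 + Rabs alpha) <= eps / 4).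
  { apply Rle_trans with (eps / (4 * (1 + Rabs alpha)) * (1 + Rabs alpha)).
    - apply Rmult_le_compat_r; [lra | apply Rmin_r].
    - right. field. lra. }
  (* e bounds both components of z Gamma + alpha *)
  destruct (connection_limit (fun z => (ux (fst z) (snd z), - uy (fst z) (snd z))) ux uy R0 alpha HR0
    (fun x y _ => eq_refl) Hgrad e He0) as [d1 [Hd1 Hg]].
  destruct (Hhess (eps / 4) ltac:(lra)) as [d2 [Hd2 Hh]].
  exists (Rmin d1 d2). split; [apply Rmin_pos; lra|].
  destruct (Rmin_bounds d1 d2) as [B1 B2].
  intros x y Hpos Hr.
  destruct (Hg x y Hpos ltac:(lra)) as [G1 G2]. assert (H1 := Hh x y Hpos ltac:(lra)).
  cbn in G1, G2.
  assert (Dxy : punctured R0 x y).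
  { split; [exact Hpos|]. rewrite <- radius_sq. assert (X := radius_pos x y Hpos). nra. }
  rewrite (HS x y Dxy). simpl.
  rewrite radius_sq in H1.
  set (a := ux x y) in *. set (b := uy x y) in *.
  set (e1 := x * a - y * - b - - alpha) in *. set (e2 := x * - b + y * a - 0) in *.
  set (q1 := uxx x y + alpha * lgxx x y - (uyy x y + alpha * lgyy x y)) in *.
  set (q2 := uxy x y + alpha * lgxy x y + (uyx x y + alpha * lgxy x y)) in *.
  assert (Pe1 := Rabs_pos e1). assert (Pe2 := Rabs_pos e2).
  assert (Pq1 := Rabs_pos q1). assert (Pq2 := Rabs_pos q2).
  assert (Z1 : Rabs (x ^ 2 - y ^ 2) <= x ^ 2 + y ^ 2) by (apply Rabs_le; nra).
  assert (Z2 : Rabs (2 * x * y) <= x ^ 2 + y ^ 2).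
  { assert (X1 := pow2_ge_0 (x - y)). assert (X2 := pow2_ge_0 (x + y)). apply Rabs_le. simpl in *. lra. }
  assert (Sq1 : Rabs e1 * Rabs e1 <= e) by nra.
  assert (Sq2 : Rabs e2 * Rabs e2 <= e) by nra.
  assert (Sq3 : Rabs e1 * Rabs e2 <= e) by nra.
  assert (Al1 : Rabs alpha * Rabs e1 <= Rabs alpha * e) by (apply Rmult_le_compat_l; lra).
  assert (Al2 : Rabs alpha * Rabs e2 <= Rabs alpha * e) by (apply Rmult_le_compat_l; lra).
  assert (HT : forall w, Rabs w <= x ^ 2 + y ^ 2 ->
     Rabs w * Rabs q1 <= (x ^ 2 + y ^ 2) * Rabs q1 /\ Rabs w * Rabs q2 <= (x ^ 2 + y ^ 2) * Rabs q2)
    by (intros w Hw; split; apply Rmult_le_compat_r; assumption).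
  destruct (HT _ Z1) as [T1 T3]. destruct (HT _ Z2) as [T4 T2]. rewrite Rmult_plus_distr_l in H1.
  split.
  - match goal with |- Rabs ?l <= _ => replace l with
      (/ 2 * ((x ^ 2 - y ^ 2) * q1 + (2 * x * y) * q2) + alpha * e1
        - / 2 * (e1 * e1 + (- e2) * e2)) end.
    + assert (C1 := Rabs_cross (x ^ 2 - y ^ 2) (2 * x * y) q1 q2).
      assert (C2 := Rabs_cross e1 (- e2) e1 e2). rewrite Rabs_Ropp in C2.
      assert (C3 := Rabs_mult alpha e1).
      assert (C4 := Rle_abs (alpha * e1)). assert (C5 := Rle_abs (- (alpha * e1))). rewrite Rabs_Ropp in C5.
      apply Rabs_le_between in C1. apply Rabs_le_between in C2.
      apply Rabs_le. lra.
    + unfold e1, e2, q1, q2, lgxx, lgyy, lgxy. field. lra.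
  - match goal with |- Rabs ?l <= _ => replace l with
      (/ 2 * ((2 * x * y) * q1 + (- (x ^ 2 - y ^ 2)) * q2) + alpha * e2 - e1 * e2) end.
    + assert (C1 := Rabs_cross (2 * x * y) (- (x ^ 2 - y ^ 2)) q1 q2). rewrite Rabs_Ropp in C1.
      assert (C3 := Rabs_mult alpha e2).
      assert (C4 := Rle_abs (alpha * e2)). assert (C5 := Rle_abs (- (alpha * e2))). rewrite Rabs_Ropp in C5.
      assert (C6 := Rabs_mult e1 e2).
      assert (C7 := Rle_abs (e1 * e2)). assert (C8 := Rle_abs (- (e1 * e2))). rewrite Rabs_Ropp in C8.
      apply Rabs_le_between in C1. apply Rabs_le. lra.
    + unfold e1, e2, q1, q2, lgxx, lgyy, lgxy. field. lra.
Qed.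

Theorem theorem1p2 (Omega : C -> Prop) (lam kappa : C -> R)
  (HOmega : planar_domain Omega)
  (H0 : isolated_boundary_point Omega (RtoC 0))
  (Hlam : regular_metric Omega lam)
  (Hkappa : forall z, Omega z -> kappa z = curvature lam z)
  (Hholder : locally_holder (fun z => Omega z \/ z = RtoC 0) kappa)
  (Hneg : kappa (RtoC 0) < 0) :
  exists alpha : R,
    has_order (fun z => ln (lam z)) alpha /\ alpha <= 1 /\
    (alpha < 1 ->
       filterlim (fun z : C => Cmod z * ln (1 / Cmod z) * lam z)
                 (locally' (RtoC 0)) (locally 0)) /\
    (alpha = 1 ->
       filterlim (fun z : C => Cmod z * ln (1 / Cmod z) * lam z)
                 (locally' (RtoC 0)) (locally (1 / sqrt (- kappa (RtoC 0))))) /\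
    filterlim (fun z : C => z * connection lam z)%C
              (locally' (RtoC 0)) (locally (RtoC (- alpha))) /\
    filterlim (fun z : C => z * z * schwarzian lam z)%C
              (locally' (RtoC 0)) (locally (RtoC (alpha * (2 - alpha) / 2))).
Proof.
  destruct (isolated_punctured Omega (proj1 HOmega) H0) as [R1 [HR1 HOm1]].
  destruct (holder_at_puncture Omega kappa R1 HR1 HOm1 Hholder Hneg)
    as [R0 [beta [K [HR0 [HR01 [Hbeta [HK [Hhol [Hk Hlim]]]]]]]]].
  assert (HOm : forall x y, punctured R0 x y -> Omega (x, y)).
  { intros x y [A B]. apply HOm1. split; [exact A | nra]. }
  set (k := fun x y => - kappa (x, y)) in *. set (k0 := - kappa (RtoC 0)) in *.
  assert (Hk0 : 0 < k0) by (unfold k0; lra).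
  destruct (log_density_C2 Omega R0 lam Hlam HOm) as [ux [uy [uxx [uxy [uyx [uyy [Hu Hid]]]]]]].
  set (u := fun x y => ln (lam (x, y))) in *.
  assert (Hpos : forall x y, punctured R0 x y -> 0 < lam (x, y)).
  { intros x y Hd. apply (proj1 Hlam), HOm, Hd. }
  assert (Heq : forall x y, punctured R0 x y -> uxx x y + uyy x y = k x y * exp (2 * u x y)).
  { intros x y Hd. destruct (Hid x y Hd) as [E _]. assert (P := Hpos x y Hd).
    unfold k. rewrite Hkappa by (apply HOm, Hd). unfold curvature. rewrite E.
    replace (2 * u x y) with (u x y + u x y) by ring. unfold u. rewrite exp_plus, exp_ln by exact P.
    field. lra. }
  assert (HR0p : 0 < R0) by lra. assert (Hm : 0 < k0 / 2) by lra.
  destruct (cylinder_asymptotics R0 (k0 / 2) (2 * k0) k0 u ux uy uxx uxy uyx uyy k HR0p Hm Hk0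
    Hu Heq Hk Hlim) as [gamma [T [C [Hg [HT0 [HT [HC [Hcyl [Hslope [Hz0 Hz1]]]]]]]]]].
  assert (Hgrad := gradient_asymptotics R0 (k0 / 2) (2 * k0) u ux uy uxx uxy uyx uyy k HR0 Hm Hu Heq Hk
    gamma T C HT0 HT HC Hcyl Hslope).
  assert (Hhess := hessian_asymptotics R0 (k0 / 2) (2 * k0) u ux uy uxx uxy uyx uyy k HR0 Hm Hu Heq Hk
    gamma T C HT0 HT HC Hcyl Hslope beta K Hbeta HK Hhol).
  cbv beta zeta in Hgrad, Hhess.
  assert (Hmean : forall z : Coquelicot.Complex.C, 0 < Cmod z -> T <= - ln (Cmod z) -> 0 < lam z /\
     Rabs (ln (lam z) - (- ln (Cmod z) + mean u (- ln (Cmod z)))) <= C / (- ln (Cmod z))).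
  { intros [x y]. rewrite Cmod_radius. intros Hr Ht.
    assert (Hxy : 0 < x ^ 2 + y ^ 2) by (rewrite <- radius_sq; apply pow_lt, Hr).
    assert (Hd : punctured R0 x y).
    { split; [exact Hxy|]. rewrite <- radius_sq.
      assert (radius x y < R0).
      { apply ln_lt_inv; [exact Hr | exact HR0p | lra]. }
      nra. }
    split; [apply Hpos, Hd|].
    destruct (cartesian x y Hxy) as [phi E].
    destruct (Hcyl _ phi Ht) as [Hb _]. unfold cyl in Hb. rewrite <- (E u) in Hb.
    replace (ln (lam (x, y)) - (- ln (radius x y) + mean u (- ln (radius x y))))
      with (u x y - - ln (radius x y) - mean u (- ln (radius x y))) by (unfold u; ring).
    exact Hb. }
  exists (1 - gamma). split; [|split; [lra | split; [|split; [|split]]]].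
  - apply (order_of_mean _ (mean u) gamma T C HT).
    + intros z Hz Ht. apply Hmean; assumption.
    + apply (quotient_limit_inf _ (mean_t ux uy) T); [|exact Hslope].
      intros t Ht. apply (is_derive_mean R0 u ux uy uxx uxy uyx uyy HR0p Hu). lra.
  - intros Hlt. apply (density_of_mean lam (mean u) T C 0 HT Hmean). apply Hz1. lra.
  - intros E. replace (1 / sqrt k0) with (/ sqrt k0) by (unfold Rdiv; ring).
    apply (density_of_mean lam (mean u) T C _ HT Hmean). apply Hz0. lra.
  - apply filterlim_C_intro. intros eps He.
    destruct (connection_limit (connection lam) ux uy R0 (1 - gamma) HR0p
      (fun x y Hd => proj1 (proj2 (Hid x y Hd))) Hgrad eps He) as [d [Hd Hb]].
    exists d. split; [lra | exact Hb].
  - apply filterlim_C_intro.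
    exact (schwarzian_limit (schwarzian lam) ux uy uxx uxy uyx uyy R0 (1 - gamma) HR0p
      (fun x y Hd => proj2 (proj2 (Hid x y Hd))) Hgrad Hhess).
Qed.
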